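(* Let $d\ge 1$ be an integer and let $\mathfrak h$ be a $2d$-dimensional complex vector space with a nondegenerate skew-symmetric bilinear form. Then the vertex operator algebra $SF^+$ is irrational, i.e. it is not rational: there exists a $\mathbb Z_{\ge0}$-gradable weak $SF^+$-module which is not completely reducible.
   Context: Construction of $SF$. Let $\langle\cdot,\cdot\rangle$ be the skew-symmetric form on $\mathfrak h$. A canonical basis of $\mathfrak h$ is a basis $\{e^i,f^i\}_{1\le i\le d}$ with $\langle e^i,e^j\rangle=\langle f^i,f^j\rangle=0$ and $\langle e^i,f^j\rangle=-\langle f^j,e^i\rangle=-\delta_{i,j}$. Let $\mathcal A$ be the unital associative $\mathbb Z_2$-graded algebra generated by odd elements $\psi(m)$ ($\psi\in\mathfrak h$, $m\in\mathbb Z$, linear in $\psi$) with relations $\psi(m)\phi(n)+\phi(n)\psi(m)=m\langle\psi,\phi\rangle\delta_{m+n,0}$. Let $\mathcal A_{\ge 0}$ be the left ideal generated by all $\psi(m)$ with $m\ge 0$, $SF=\mathcal A/\mathcal A_{\ge0}$, and $\mathbf 1=1+\mathcal A_{\ge 0}$. $SF$ is a vertex operator superalgebra with vacuum $\mathbf 1$, fields $Y(\psi(-1)\mathbf 1,z)=\psi(z)=\sum_{n\in\mathbb Z}\psi(n)z^{-n-1}$, and $Y(\psi^1(-n_1)\cdots\psi^r(-n_r)\mathbf 1,z)={:}\partial^{(n_1-1)}\psi^1(z)\cdots\partial^{(n_r-1)}\psi^r(z){:}$ for $n_i\ge1$, where $\partial^{(n)}=\frac1{n!}\frac{d^n}{dz^n}$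 and ${:}\ {:}$ is fermionic normal ordering (modes $\psi(n)$ with $n\ge 0$ moved to the right, with signs). The Virasoro vector is $\omega=\sum_{i=1}^d e^i(-1)f^i(-1)\mathbf 1$, of central charge $-2d$. Weights are nonnegative integers. $SF^+$ is the even part of $SF$, a vertex operator algebra. Rationality. A weak module for a vertex operator algebra $V$ is a vector space $M$ with fields $Y(a,z)=\sum_{n\in\mathbb Z}a_{(n)}z^{-n-1}$ satisfying truncation, $Y(\mathbf 1,z)=\mathrm{id}$ and the Borcherds identity. It is $\mathbb Z_{\ge0}$-gradable if $M=\bigoplus_{n\ge0}M(n)$ with $a_{(n)}M(m)\subset M(k+m-n-1)$ for $a\in V_k$, $m,n\in\mathbb Z$ (with $M(n)=0$ for $n<0$). $V$ is rational if every $\mathbb Z_{\ge0}$-gradable weak $V$-module is completely reducible. *)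

(* Defs.v *)
From HB Require Import structures.
From mathcomp Require Import all_boot all_order all_algebra generic_quotient.
From mathcomp Require Import ring_quotient sesquilinear.
From mathcomp Require Import boolp classical_sets functions fsbigop.
From mathcomp Require Export reals complex.

Set Implicit Arguments.
Unset Strict Implicit.
Unset Printing Implicit Defensive.
Import Order.TTheory GRing.Theory Num.Theory.
Local Open Scope classical_set_scope.
Local Open Scope quotient_scope.
Local Open Scope ring_scope.

(* The binomial coefficient x(x-1)...(x-j+1)/j! for an arbitrary integer x. *)
Definition binz (K : fieldType) (x : int) (j : nat) : K :=
  (\prod_(i < j) (x - i%:Z)%:~R) / j`!%:R.

Section LinearAlgebra.
Variables (K : fieldType) (M : lmodType K).

Definition subspace (N : set M) : Prop :=
  N 0 /\ forall (c : K) u v, N u -> N v -> N (c *: u + v).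

(* M is the (internal) direct sum of the subspaces N i. *)
Definition direct_sum (I : choiceType) (N : I -> set M) : Prop :=
  [/\ forall i, subspace (N i),
      forall u, exists (s : seq I) (x : I -> M),
        (forall i, N i (x i)) /\ u = \sum_(i <- s) x i
    & forall (s : seq I) (x : I -> M), uniq s -> (forall i, N i (x i)) ->
        \sum_(i <- s) x i = 0 -> forall i, i \in s -> x i = 0].

End LinearAlgebra.

(* The data underlying a vertex operator algebra, vprod a n b being a_(n) b.
   The notions of module and of rationality depend only on these data. *)
Record voa_data (K : fieldType) := VoaData {
  voa_sort :> lmodType K;
  vacuum : voa_sort;
  vprod : voa_sort -> int -> voa_sort -> voa_sort;
  conformal : voa_sort
}.

Section Modules.
Variables (K : fieldType) (V : voa_data K).

(* V_k is the eigenspace of L(0) = omega_(1) with eigenvalue k. *)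
Definition weight_space (k : nat) : set V :=
  [set a | vprod (conformal V) 1 a = k%:R *: a].

(* mode a n u is a_(n) u. The sums over i below are finite by truncation. *)
Record weak_module := WeakModule {
  wm_sort :> lmodType K;
  mode : V -> int -> wm_sort -> wm_sort;
  mode_linearl : forall n u (c : K) a b,
    mode (c *: a + b) n u = c *: mode a n u + mode b n u;
  mode_linearr : forall a n (c : K) u v,
    mode a n (c *: u + v) = c *: mode a n u + mode a n v;
  mode_truncation : forall a u, exists N : int, forall n, N <= n -> mode a n u = 0;
  mode_vacuum : forall n u, mode (vacuum V) n u = if n == -1 then u else 0;
  mode_borcherds : forall a b (p q r : int) u,
    \sum_(i \in [set: nat])
       binz K p i *: mode (vprod a (r + i%:Z) b) (p + q - i%:Z) u =
    \sum_(i \in [set: nat])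
       ((-1) ^+ i * binz K r i) *:
         (mode a (p + r - i%:Z) (mode b (q + i%:Z) u)
          - (-1) ^ r *: mode b (q + r - i%:Z) (mode a (p + i%:Z) u))
}.

Definition gradable (M : weak_module) : Prop :=
  exists G : int -> set M,
    [/\ direct_sum G,
        forall n, n < 0 -> G n = [set 0]
      & forall (k : nat) a (m n : int) u, weight_space k a -> G m u ->
          G (k%:Z + m - n - 1) (mode a n u)].

Definition submodule (M : weak_module) (N : set M) : Prop :=
  subspace N /\ forall a n u, N u -> N (mode a n u).

Definition irreducible_submodule (M : weak_module) (N : set M) : Prop :=
  [/\ submodule N, N <> [set 0] &
      forall N' : set M, submodule N' -> N' `<=` N -> N' = [set 0] \/ N' = N].

Definition completely_reducible (M : weak_module) : Prop :=
  exists (I : choiceType) (N : I -> set M),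
    (forall i, irreducible_submodule (N i)) /\ direct_sum N.

Definition rational : Prop :=
  forall M : weak_module, gradable M -> completely_reducible M.

End Modules.

Section Algebra.
Variables (K : fieldType) (h : lmodType K) (form : h -> h -> K).

(* The algebra A is the set of formal expressions in the generators psi(m)
   and the scalars, modulo the congruence generated by the axioms of unital
   associative K-algebras and the defining relations. *)
Inductive term : Type :=
| TGen of h & int
| TCst of K
| TAdd of term & term
| TMul of term & term.

Inductive teq : term -> term -> Prop :=
| teq_refl x : teq x x
| teq_sym x y : teq x y -> teq y x
| teq_trans x y z : teq x y -> teq y z -> teq x z
| teq_add x x' y y' : teq x x' -> teq y y' -> teq (TAdd x y) (TAdd x' y')
| teq_mul x x' y y' : teq x x' -> teq y y' -> teq (TMul x y) (TMul x' y')
| teq_addA x y z : teq (TAdd x (TAdd y z)) (TAdd (TAdd x y) z)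
| teq_addC x y : teq (TAdd x y) (TAdd y x)
| teq_add0 x : teq (TAdd (TCst 0) x) x
| teq_mulA x y z : teq (TMul x (TMul y z)) (TMul (TMul x y) z)
| teq_mul1 x : teq (TMul (TCst 1) x) x
| teq_mul0 x : teq (TMul (TCst 0) x) (TCst 0)
| teq_mulDl x y z : teq (TMul (TAdd x y) z) (TAdd (TMul x z) (TMul y z))
| teq_mulDr x y z : teq (TMul x (TAdd y z)) (TAdd (TMul x y) (TMul x z))
| teq_cstD a b : teq (TCst (a + b)) (TAdd (TCst a) (TCst b))
| teq_cstM a b : teq (TCst (a * b)) (TMul (TCst a) (TCst b))
| teq_cstC a x : teq (TMul (TCst a) x) (TMul x (TCst a))
| teq_gen a psi phi m :
    teq (TGen (a *: psi + phi) m)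
        (TAdd (TMul (TCst a) (TGen psi m)) (TGen phi m))
| teq_comm psi phi m n :
    teq (TAdd (TMul (TGen psi m) (TGen phi n)) (TMul (TGen phi n) (TGen psi m)))
        (TCst (m%:~R * form psi phi * (m + n == 0)%:R)).

HB.instance Definition _ := gen_eqMixin term.
HB.instance Definition _ := gen_choiceMixin term.

Definition teqb : rel term := fun x y => `[< teq x y >].

Lemma teqb_equiv : equiv_class_of teqb.
Proof.
split=> [x|x y|y x z].
- by apply/asboolP; exact: teq_refl.
- by apply/asboolP/asboolP; exact: teq_sym.
- by move=> /asboolP xy /asboolP yz; apply/asboolP; exact: teq_trans xy yz.
Qed.

Canonical teqb_equivRel := EquivRelPack teqb_equiv.
Canonical teqb_encModRel := defaultEncModRel teqb.

Definition algA := {eq_quot teqb}.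
HB.instance Definition _ : EqQuotient term teqb algA := EqQuotient.on algA.
HB.instance Definition _ := Choice.on algA.

Lemma algA_eqP x y : \pi_algA x = \pi_algA y <-> teq x y.
Proof.
split=> [|xy].
  by move=> /eqP; rewrite piE => /asboolP.
by apply/eqP; rewrite piE; apply/asboolP.
Qed.

Lemma teq_repr x : teq (repr (\pi_algA x)) x.
Proof. by apply/algA_eqP; rewrite reprK. Qed.

Definition addA (a b : algA) : algA := \pi_algA (TAdd (repr a) (repr b)).
Definition mulA (a b : algA) : algA := \pi_algA (TMul (repr a) (repr b)).
Definition cstA (c : K) : algA := \pi_algA (TCst c).
Definition gen (psi : h) (m : int) : algA := \pi_algA (TGen psi m).

Lemma addA_pi x y : addA (\pi_algA x) (\pi_algA y) = \pi_algA (TAdd x y).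
Proof. by apply/algA_eqP; apply: teq_add; exact: teq_repr. Qed.

Lemma mulA_pi x y : mulA (\pi_algA x) (\pi_algA y) = \pi_algA (TMul x y).
Proof. by apply/algA_eqP; apply: teq_mul; exact: teq_repr. Qed.

Lemma algA_ind (P : algA -> Prop) : (forall x, P (\pi_algA x)) -> forall a, P a.
Proof. by move=> Ppi a; rewrite -[a]reprK. Qed.

Fact algA_addA : associative addA.
Proof.
elim/algA_ind=> x; elim/algA_ind=> y; elim/algA_ind=> z.
by rewrite !addA_pi; apply/algA_eqP; exact: teq_addA.
Qed.

Fact algA_addC : commutative addA.
Proof.
elim/algA_ind=> x; elim/algA_ind=> y.
by rewrite !addA_pi; apply/algA_eqP; exact: teq_addC.
Qed.

Fact algA_add0 : left_id (cstA 0) addA.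
Proof.
by elim/algA_ind=> x; rewrite addA_pi; apply/algA_eqP; exact: teq_add0.
Qed.

Fact algA_addN : left_inverse (cstA 0) (mulA (cstA (-1))) addA.
Proof.
elim/algA_ind=> x; rewrite mulA_pi addA_pi; apply/algA_eqP.
apply: teq_trans (teq_add (teq_refl _) (teq_sym (teq_mul1 x))) _.
apply: teq_trans (teq_sym (teq_mulDl _ _ _)) _.
apply: teq_trans (teq_mul (teq_sym (teq_cstD _ _)) (teq_refl _)) _.
by rewrite addNr; exact: teq_mul0.
Qed.

HB.instance Definition _ :=
  GRing.isZmodule.Build algA algA_addA algA_addC algA_add0 algA_addN.

Fact algA_mulA : associative mulA.
Proof.
elim/algA_ind=> x; elim/algA_ind=> y; elim/algA_ind=> z.
by rewrite !mulA_pi; apply/algA_eqP; exact: teq_mulA.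
Qed.

Fact algA_mul1l : left_id (cstA 1) mulA.
Proof.
by elim/algA_ind=> x; rewrite mulA_pi; apply/algA_eqP; exact: teq_mul1.
Qed.

Fact algA_mul1r : right_id (cstA 1) mulA.
Proof.
elim/algA_ind=> x; rewrite mulA_pi; apply/algA_eqP.
exact: teq_trans (teq_sym (teq_cstC _ _)) (teq_mul1 _).
Qed.

Fact algA_mulDl : left_distributive mulA addA.
Proof.
elim/algA_ind=> x; elim/algA_ind=> y; elim/algA_ind=> z.
by rewrite addA_pi !mulA_pi addA_pi; apply/algA_eqP; exact: teq_mulDl.
Qed.

Fact algA_mulDr : right_distributive mulA addA.
Proof.
elim/algA_ind=> x; elim/algA_ind=> y; elim/algA_ind=> z.
by rewrite addA_pi !mulA_pi addA_pi; apply/algA_eqP; exact: teq_mulDr.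
Qed.

HB.instance Definition _ := GRing.Zmodule_isPzRing.Build algA
  algA_mulA algA_mul1l algA_mul1r algA_mulDl algA_mulDr.

Definition scaleA (c : K) (a : algA) : algA := cstA c * a.

Fact algA_scaleA (b c : K) (a : algA) : scaleA b (scaleA c a) = scaleA (b * c) a.
Proof.
rewrite /scaleA mulrA; congr (_ * _).
by apply: etrans (mulA_pi _ _) _; apply/algA_eqP/teq_sym; exact: teq_cstM.
Qed.

Fact algA_scale1 : left_id 1 scaleA.
Proof. by move=> a; exact: mul1r. Qed.

Fact algA_scaleDr : right_distributive scaleA +%R.
Proof. by move=> c a b; exact: mulrDr. Qed.

Fact algA_scaleDl (a : algA) : {morph scaleA^~ a : b c / b + c}.
Proof.
move=> b c; rewrite /scaleA -mulrDl; congr (_ * _).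
by symmetry; apply: etrans (addA_pi _ _) _; apply/algA_eqP/teq_sym; exact: teq_cstD.
Qed.

HB.instance Definition _ := GRing.Zmodule_isLmodule.Build K algA
  algA_scaleA algA_scale1 algA_scaleDr algA_scaleDl.

Lemma algA_scaleAl (c : K) (a b : algA) : c *: (a * b) = (c *: a) * b.
Proof. exact: mulrA. Qed.

Lemma algA_scaleAr (c : K) (a b : algA) : c *: (a * b) = a * (c *: b).
Proof.
have cC : cstA c * a = a * cstA c.
  elim/algA_ind: a => x; apply: etrans (mulA_pi _ _) _; apply/esym.
  by apply: etrans (mulA_pi _ _) _; apply/algA_eqP/teq_sym; exact: teq_cstC.
by rewrite -[LHS]/(cstA c * (a * b)) mulrA cC -mulrA.
Qed.

(* The left ideal generated by the psi(m) with m >= 0. *)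
Inductive left_ideal_ge0 : algA -> Prop :=
| li_zero : left_ideal_ge0 0
| li_gen a psi m : 0 <= m -> left_ideal_ge0 (a * gen psi m)
| li_add a b : left_ideal_ge0 a -> left_ideal_ge0 b -> left_ideal_ge0 (a + b).

Definition A_ge0 : {pred algA} := fun a => `[< left_ideal_ge0 a >].

Lemma A_ge0P a : reflect (left_ideal_ge0 a) (a \in A_ge0).
Proof. exact: asboolP. Qed.

Lemma A_ge0_mull b a : a \in A_ge0 -> b * a \in A_ge0.
Proof.
move=> /A_ge0P aI; apply/A_ge0P; elim: aI => [|c psi m m0|x y _ bx _ by'].
- by rewrite mulr0; exact: li_zero.
- by rewrite mulrA; exact: li_gen.
- by rewrite mulrDr; exact: li_add.
Qed.

Fact A_ge0_zmod : zmod_closed A_ge0.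
Proof.
split=> [|a b aI bI]; first by apply/A_ge0P; exact: li_zero.
have /A_ge0P nbI : - b \in A_ge0 by rewrite -mulN1r; exact: A_ge0_mull.
by apply/A_ge0P; apply: li_add => //; exact/A_ge0P.
Qed.

HB.instance Definition _ := GRing.isZmodClosed.Build algA A_ge0 A_ge0_zmod.

Definition SF := Quotient.quot A_ge0.
HB.instance Definition _ := GRing.Zmodule.on SF.
HB.instance Definition _ := ZmodQuotient.on SF.

Definition SFvac : SF := \pi_SF (1 : algA).

Definition lact (a : algA) (v : SF) : SF := \pi_SF (a * repr v).

Lemma SF_eqP (a b : algA) : \pi_SF a = \pi_SF b <-> a - b \in A_ge0.
Proof.
rewrite Quotient.idealrBE; split=> [->|/eqP//]; exact: eqxx.
Qed.

Lemma lact_pi (a b : algA) : lact a (\pi_SF b) = \pi_SF (a * b).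
Proof.
by apply/SF_eqP; rewrite -mulrBr; apply: A_ge0_mull; apply/SF_eqP; rewrite reprK.
Qed.

Lemma SF_ind (P : SF -> Prop) : (forall a, P (\pi_SF a)) -> forall v, P v.
Proof. by move=> Ppi v; rewrite -[v]reprK. Qed.

Lemma lactM a b v : lact (a * b) v = lact a (lact b v).
Proof. by elim/SF_ind: v => c; rewrite !lact_pi mulrA. Qed.

Lemma lactDr a : {morph lact a : u v / u + v}.
Proof.
elim/SF_ind=> b; elim/SF_ind=> c; rewrite -(raddfD \pi_SF) !lact_pi.
by rewrite mulrDr raddfD.
Qed.

Lemma lactDl v : {morph lact^~ v : a b / a + b}.
Proof. by elim/SF_ind: v => c a b; rewrite !lact_pi mulrDl raddfD. Qed.

Definition scaleSF (c : K) (v : SF) : SF := lact (cstA c) v.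

Fact SF_scaleA (b c : K) (v : SF) : scaleSF b (scaleSF c v) = scaleSF (b * c) v.
Proof.
rewrite /scaleSF -lactM; congr lact; rewrite -[cstA c]mulr1.
by rewrite [LHS]algA_scaleA [LHS]mulr1.
Qed.

Fact SF_scale1 : left_id 1 scaleSF.
Proof. by elim/SF_ind=> a; rewrite /scaleSF lact_pi; congr (\pi_SF _); exact: mul1r. Qed.

Fact SF_scaleDr : right_distributive scaleSF +%R.
Proof. by move=> c u v; exact: lactDr. Qed.

Fact SF_scaleDl (v : SF) : {morph scaleSF^~ v : b c / b + c}.
Proof.
move=> b c; rewrite /scaleSF -lactDl; congr lact.
by have := algA_scaleDl 1 b c; rewrite /scaleA !mulr1.
Qed.

HB.instance Definition _ := GRing.Zmodule_isLmodule.Build K SF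
  SF_scaleA SF_scale1 SF_scaleDr SF_scaleDl.

(* The product x_1 ... x_r applied to v, where (psi, m) stands for psi(m). *)
Definition word (s : seq (h * int)) (v : SF) : SF :=
  foldr (fun x => lact (gen x.1 x.2)) v s.

(* Fermionic normal ordering: annihilation modes are moved to the right, and
   crossings counts the transpositions this requires. *)
Definition creation (x : h * int) : bool := x.2 < 0.

Fixpoint crossings (s : seq (h * int)) : nat :=
  if s is x :: s' then
    ((if creation x then 0 else count creation s') + crossings s')%N
  else 0%N.

Definition normal_ordered (s : seq (h * int)) (v : SF) : SF :=
  (-1) ^+ crossings s *:
    word (filter creation s ++ filter (predC creation) s) v.

(* From here on (psi, n) : h * nat encodes the creation mode psi(-n-1), so that
   w encodes psi^1(-n_1) ... psi^r(-n_r) 1 with all n_i >= 1. *)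
Definition fock (w : seq (h * nat)) : SF :=
  word [seq (x.1, - x.2.+1%:Z) | x <- w] SFvac.

(* The coefficient of z^(-k-1) in the normally ordered product of the fields
   d^(n) psi(z) = \sum_m binom(-m-1, n) psi(m) z^(-m-n-1), for (psi, n) in w,
   where m runs over all integers; applied to v, only finitely many tuples of
   modes have a nonzero contribution. *)
Definition normal_field (w : seq (h * nat)) (k : int) (v : SF) : SF :=
  \sum_(ms \in [set ms : seq int | size ms = size w /\
                  \sum_(x <- zip w ms) (x.2 + x.1.2%:Z + 1) = k + 1])
    (\prod_(x <- zip w ms) binz K (- x.2 - 1) x.1.2) *:
      normal_ordered [seq (x.1.1, x.2) | x <- zip w ms] v.

(* Y a k v is a_(k) v, where Y(a, z) = \sum_k a_(k) z^(-k-1). Exactly one Y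
   satisfies this: the vectors fock w span SF, and by the PBW theorem their only
   linear relations express that fock is multilinear and alternating in the
   letters of w, properties that normal_field shares. *)
Definition state_field (Y : SF -> int -> SF -> SF) : Prop :=
  (forall k v (c : K) a b, Y (c *: a + b) k v = c *: Y a k v + Y b k v) /\
  (forall w k v, Y (fock w) k v = normal_field w k v).

Definition SFprod : SF -> int -> SF -> SF :=
  xget (fun _ _ _ => 0) [set Y | state_field Y].

(* The span of the products of an even number of the odd generators, applied
   to the vacuum. *)
Inductive SF_even : SF -> Prop :=
| even_word s : ~~ odd (size s) -> SF_even (word s SFvac)
| even_linear (c : K) u v : SF_even u -> SF_even v -> SF_even (c *: u + v).

Definition SFeven : {pred SF} := fun v => `[< SF_even v >].

Lemma SFevenP v : reflect (SF_even v) (v \in SFeven).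
Proof. exact: asboolP. Qed.

Fact SFeven_submod : submod_closed SFeven.
Proof.
have e1 : SF_even SFvac by exact: (@even_word [::]).
split=> [|c u v /SFevenP uE /SFevenP vE]; apply/SFevenP; last exact: even_linear.
by rewrite -(addNr SFvac) -scaleN1r; exact: even_linear.
Qed.

HB.instance Definition _ := GRing.isSubmodClosed.Build K SF SFeven SFeven_submod.

Record SFplus := SFPlus { SFplus_val :> SF; _ : SFplus_val \in SFeven }.
HB.instance Definition _ := [isSub for SFplus_val].
HB.instance Definition _ := [Choice of SFplus by <:].
HB.instance Definition _ := [SubChoice_isSubLmodule of SFplus by <:].

Lemma SFvac_even : SFvac \in SFeven.
Proof. by apply/SFevenP; exact: (@even_word [::]). Qed.

Definition SFomega (d : nat) (e f : 'I_d -> h) : SF :=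
  \sum_(i < d) fock [:: (e i, 0%N); (f i, 0%N)].

Lemma SFomega_even d (e f : 'I_d -> h) : SFomega e f \in SFeven.
Proof. by apply: rpred_sum => i _; apply/SFevenP; exact: even_word. Qed.

(* SF^+ is closed under the products a_(n) b, so that insubd merely restricts
   them to SF^+. *)
Definition SFplus_voa (d : nat) (e f : 'I_d -> h) : voa_data K :=
  @VoaData K SFplus (SFPlus SFvac_even)
    (fun a n b => insubd (0 : SFplus) (SFprod (val a) n (val b)))
    (SFPlus (SFomega_even e f)).

End Algebra.

Definition canonical_basis (K : fieldType) (h : vectType K) (form : h -> h -> K)
    (d : nat) (e f : 'I_d -> h) : Prop :=
  [/\ basis_of fullv (codom e ++ codom f),
      forall i j, form (e i) (e j) = 0,
      forall i j, form (f i) (f j) = 0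
    & forall i j, form (e i) (f j) = - (i == j)%:R /\
                  form (f j) (e i) = (i == j)%:R].

(* Main.v *)
Require Import Defs.
From HB Require Import structures.
From mathcomp Require Import all_boot all_order all_algebra sesquilinear.
From mathcomp Require Import boolp classical_sets functions fsbigop.
From mathcomp Require Import ssrAC zify ring.

Set Implicit Arguments.
Unset Strict Implicit.
Unset Printing Implicit Defensive.
Import Order.TTheory GRing.Theory Num.Theory.
Local Open Scope ring_scope.

(** The zero modes psi(0) anticommute with all modes and kill the vacuum, so
    they act by zero on SF. The relations of A leave room for self-extensions of
    SF in which some psi(0) acts by a nonzero nilpotent map. Such an extension
    does not split over SF^+ either, and SF^+ is therefore irrational.

    The extension is SF + SF, where psi(0) sends (u, v) to (lam(psi) v', 0);
    here lam is a nonzero linear form and v' is v with the sign of its parity.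
    Take lam(e) = 1 and lam(f) = 0 for a pair e = e^i, f = f^i of the canonical
    basis. In L(0) zero modes occur only in the products f^i(0) e^i(0), which
    vanish, so L(0) is diagonal, and its kernel is spanned by the two vacua
    (1, 0) and (0, 1) (ext_L0, weight_degree). If the extension were a direct
    sum of irreducibles, some summand would contain a vector x = (a 1, b 1)
    with b nonzero, because L(0) maps each summand to itself. The zeroth mode
    of e(-1)f(-1)1 is even and contains the term f(-1)e(0), whence it maps x
    to (- b f(-1)1, 0) (Ef_mode). So the summand meets the first copy of SF in
    a proper nonzero submodule, a contradiction
    (ext_not_completely_reducible).

    It remains to see that this module over A is a module over SF^+. Let M be
    a module over A on which every psi(n) u vanishes for large n. The fields
    on M carry an action of A: psi(m) acts as the m-th product with psi(z)
    (nprod_comm), and the identity field is killed by A_{>=0}. As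
    SF = A / A_{>=0}, there is a unique A-linear map Y from SF to the fields on
    M that sends the vacuum to the identity field. Inductions on the number of
    modes in a state give the commutator formula with psi(m) (Y_comm) and then
    the Borcherds identity: its two sides for psi(n)a are one and the same
    expression in its two sides for a (bor_l_step, bor_r_step). When M = SF,
    the field Y(fock w) is the normally ordered product that defines the
    products of SF (normal_fieldE), so these products come from Y (SFprodE),
    and every M is a weak module over SF^+ (weak_of_ferm).

    That SF is not zero, which the contradiction above needs, follows by
    mapping it to the space of functions on sets of natural numbers, where
    Jordan-Wigner operators give a representation of A (SFvac_neq0). *)

(** * Binomial coefficients with an integer upper index *)

Section Binomials.
Variable K : numFieldType.
Implicit Types (x y n m : int) (i j k l s : nat).

Lemma fact_neq0 j : (j`!%:R : K) != 0.
Proof. by rewrite pnatr_eq0 -lt0n fact_gt0. Qed.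

Lemma binz_def x j : binz K x j * j`!%:R = \prod_(i < j) (x - i%:Z)%:~R.
Proof. by rewrite /binz divfK ?fact_neq0. Qed.

Lemma binz0 x : binz K x 0 = 1.
Proof. by rewrite /binz big_ord0 fact0 divr1. Qed.

Lemma binzS x j : j.+1%:R * binz K x j.+1 = (x - j%:Z)%:~R * binz K x j.
Proof.
rewrite /binz big_ord_recr /= factS natrM.
have h1 := fact_neq0 j.
have h2 : (j.+1%:R : K) != 0 by rewrite pnatr_eq0.
by field; rewrite h1 addrC natr1 h2.
Qed.

Lemma binzSl x j : j.+1%:R * binz K (x + 1) j.+1 = (x + 1)%:~R * binz K x j.
Proof.
rewrite /binz big_ord_recl /= factS natrM subr0.
have -> : \prod_(i < j) (x + 1 - (bump 0 i)%:Z)%:~R = \prod_(i < j) (x - i%:Z)%:~R :> K.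
  by apply: eq_bigr => i _; congr (_ %:~R); rewrite /bump /=; lia.
have h1 := fact_neq0 j.
have h2 : (j.+1%:R : K) != 0 by rewrite pnatr_eq0.
by field; rewrite h1 addrC natr1 h2.
Qed.

Lemma binz_pascal x j : binz K (x + 1) j.+1 = binz K x j.+1 + binz K x j.
Proof.
have h : (j.+1%:R : K) != 0 by rewrite pnatr_eq0.
apply: (mulfI h); rewrite binzSl mulrDr binzS -mulrDl; congr (_ * _).
by rewrite -[j.+1%:R]/((j.+1)%:Z%:~R) -intrD; congr (_ %:~R); lia.
Qed.

Lemma binz_small (n j : nat) : (n < j)%N -> binz K n%:Z j = 0.
Proof.
move=> nj; rewrite /binz (bigD1 (Ordinal nj)) //= subrr mulr0z !mul0r //.
Qed.

Lemma binz_nat (n j : nat) : binz K n%:Z j = 'C(n, j)%:R.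
Proof.
elim: n j => [|n IH] [|j]; rewrite ?binz0 ?bin0 ?bin0n //.
  by rewrite binz_small.
rewrite (_ : n.+1%:Z = n%:Z + 1); last by lia.
by rewrite binz_pascal !IH binS natrD.
Qed.

(** Induction on an integer in both directions: enough for polynomial
    identities in the upper index that are compatible with Pascal's rule. *)
Lemma int_up_down (P : int -> Prop) :
  P 0 -> (forall x, P x -> P (x + 1)) -> (forall x, P (x + 1) -> P x) ->
  forall x, P x.
Proof.
move=> P0 Pu Pd; elim/int_rec => // n IH.
  by rewrite (_ : n.+1%:Z = n%:Z + 1); [exact: Pu | lia].
by apply: Pd; rewrite (_ : _ + 1 = - n%:Z) //; lia.
Qed.

(** Vandermonde's identity. Both sides satisfy Pascal's rule in x, upwards and
    downwards, and they agree at x = 0. *)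
Lemma binz_vdm x y s :
  \sum_(j < s.+1) binz K x (s - j) * binz K y j = binz K (x + y) s.
Proof.
pose V x s := \sum_(j < s.+1) binz K x (s - j) * binz K y j.
have V0 z : V z 0%N = 1 by rewrite /V big_ord1 !binz0 mulr1.
have VS z t : V (z + 1) t.+1 = V z t.+1 + V z t.
  rewrite /V big_ord_recr [in RHS]big_ord_recr /= !subnn !binz0 addrAC -big_split /=.
  congr (_ + _); apply: eq_bigr => j _.
  by rewrite subSn ?binz_pascal ?mulrDl // -ltnS ltn_ord.
rewrite -/(V x s); elim/int_up_down: x s => [s|x IH s|x IH s].
- rewrite add0r /V big_ord_recr /= subnn binz0 mul1r big1 ?add0r // => j _.
  by rewrite (binz_small (n := 0%N)) ?mul0r // subn_gt0 ltn_ord.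
- case: s => [|s]; first by rewrite V0 binz0.
  by rewrite VS !IH (_ : x + 1 + y = x + y + 1) ?binz_pascal //; lia.
- elim: s => [|s IHs]; first by rewrite V0 binz0.
  have := IH s.+1; rewrite VS IHs (_ : x + 1 + y = x + y + 1) ?binz_pascal; last by lia.
  by move/addIr.
Qed.

Lemma binz_tri x j l :
  binz K x j * binz K (x - j%:Z) l = binz K x (j + l) * binz K (j + l)%N%:Z j.
Proof.
have ff : \prod_(i < j + l) (x - i%:Z)%:~R =
    \prod_(i < j) (x - i%:Z)%:~R * \prod_(i < l) (x - j%:Z - i%:Z)%:~R :> K.
  rewrite big_split_ord /=; congr (_ * _); apply: eq_bigr => i _.
  by congr (_ %:~R); lia.
rewrite binz_nat; apply: (mulIf (fact_neq0 (j + l))).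
rewrite mulrAC [RHS]mulrAC binz_def ff -!binz_def.
rewrite -(bin_fact (leq_addr l j)) !natrM addKn; ring.
Qed.

Lemma binz_triC x j l :
  binz K x j * binz K (x - j%:Z) l = binz K x l * binz K (x - l%:Z) j.
Proof.
rewrite !binz_tri addnC; congr (_ * _).
by rewrite !binz_nat -(@bin_sub (l + j) j) ?leq_addl // addnK.
Qed.

Lemma binz_neg x s : (-1) ^+ s * binz K x s = binz K (s%:Z - x - 1) s.
Proof.
rewrite /binz mulrA; congr (_ / _).
rewrite [in RHS](reindex_inj rev_ord_inj) /=.
rewrite -[s in (-1) ^+ s](card_ord s) -prodr_const -big_split /=.
apply: eq_bigr => i _; rewrite mulN1r -mulrNz; congr (_ %:~R).
by have := ltn_ord i; lia.
Qed.

(** The extension by zero to a negative lower index. *)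
Definition binZ x (z : int) : K := if z is Posz j then binz K x j else 0.

(** The coefficients of the expansion of (1 - t)^x. *)
Definition sbin x i : K := (-1) ^+ i * binz K x i.
Definition sbinZ x (z : int) : K := if z is Posz j then sbin x j else 0.

Lemma binZ_neg x z : z < 0 -> binZ x z = 0. Proof. by case: z. Qed.
Lemma sbinZ_neg x z : z < 0 -> sbinZ x z = 0. Proof. by case: z. Qed.

Lemma binZ_absorb x z : z%:~R * binZ x z = x%:~R * binZ (x - 1) (z - 1).
Proof.
case: z => [[|j]|j]; rewrite ?mul0r ?mulr0 //.
rewrite (_ : j.+1%:Z - 1 = j); last by lia.
by have := binzSl (x - 1) j; rewrite subrK.
Qed.

Lemma signz_nat i : (-1) ^ (i%:Z) = (-1) ^+ i :> K.
Proof. by []. Qed.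

Lemma signzD (z t : int) : (-1) ^ (z + t) = (-1) ^ z * (-1) ^ t :> K.
Proof. by rewrite expfzDr // oppr_eq0 oner_eq0. Qed.

Lemma signzN (z : int) : (-1) ^ (- z) = (-1) ^ z :> K.
Proof. by case: z => [n|n]; rewrite ?NegzE ?opprK -exprnN ?signz_nat -signr_odd; case: odd; rewrite ?expr0 ?expr1 ?invrN ?invr1. Qed.

Lemma signzM (z : int) : (-1) ^ z * (-1) ^ z = 1 :> K.
Proof. by rewrite -{1}signzN -signzD addNr. Qed.

Lemma sbin_sign x i : sbin x i * (-1) ^ (x - i%:Z) = (-1) ^ x * binz K x i.
Proof.
rewrite signzD signzN signz_nat /sbin.
have E : (-1) ^+ i * (-1) ^+ i = 1 :> K by rewrite -expr2 sqrr_sign.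
transitivity ((-1) ^+ i * (-1) ^+ i * ((-1) ^ x * binz K x i)); last by rewrite E mul1r.
by rewrite mulrACA [in RHS]mulrACA; congr (_ * _); rewrite mulrC.
Qed.

(** For n < 0 the expansions of (x - z)^n in the two regions |x| > |z| and
    |z| > |x| differ by a derivative of the formal delta function; this is the
    coefficient of x^(-m) z^(m+n) in the difference. For n >= 0 they agree. *)
Lemma binz_delta n m :
  sbinZ n (m + n) - (-1) ^ n * sbinZ n (- m) = binZ (m - 1) (- n - 1).
Proof.
have E z : sbinZ n z = (-1) ^ z * binZ n z by case: z => // k; rewrite mulr0.
have sym (a b : nat) : binz K (a + b)%N%:Z a = binz K (a + b)%N%:Z b.
  by rewrite !binz_nat -(@bin_sub (a + b) a) ?leq_addr // addKn.
have refl z : sbinZ n z = binZ (z - n - 1) z.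
  by rewrite E; case: z => [k|k]; rewrite /= ?mulr0 ?signz_nat ?binz_neg.
have [n0|n0] := ltP n 0.
  have [m0|m0] := ltP 0 m.
    rewrite [sbinZ n (- m)](_ : _ = 0) ?mulr0 ?subr0; last by rewrite sbinZ_neg //; lia.
    rewrite refl (_ : m + n - n - 1 = m - 1); last by lia.
    have [mn|mn] := leP 0 (m + n).
      have -> : m + n = `|(m + n)%R|%N by lia.
      have -> : - n - 1 = `|(- n - 1)%R|%N by lia.
      have -> : m - 1 = (`|(m + n)%R| + `|(- n - 1)%R|)%N by lia.
      by rewrite /= sym.
    have -> : - n - 1 = `|(- n - 1)%R|%N by lia.
    have -> : m - 1 = `|(m - 1)%R|%N by lia.
    rewrite /= binz_small; last by lia.
    by rewrite binZ_neg //; lia.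
  have -> : sbinZ n (m + n) = 0 by rewrite sbinZ_neg //; lia.
  rewrite sub0r refl /=.
  have -> : - m = `|m|%N by lia.
  have E1 : - n - 1 = `|(- n - 1)%R|%N by lia.
  have -> : `|m|%N%:Z - n - 1 = (`|m| + `|(- n - 1)%R|)%N by lia.
  have := binz_neg (`|m| + `|(- n - 1)%R|)%N `|(- n - 1)%R|.
  rewrite -signz_nat -E1 signzD signzN [X in _ * X * _ = _]exprN1 invrN1 mulrN1 /= sym.
  rewrite mulNr => ->.
  by rewrite [in RHS]E1 /=; congr (binz _ _ _); lia.
have -> : binZ (m - 1) (- n - 1) = 0 by rewrite binZ_neg //; lia.
apply/eqP; rewrite subr_eq0; apply/eqP; rewrite !E mulrA -signzD.
have -> : (-1) ^ (n - m) = (-1) ^ (m + n) :> K.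
  by rewrite addrC !signzD signzN.
congr (_ * _).
have En : n = `|n|%N by lia.
have [m0|m0] := ltP 0 m.
  have -> : m + n = `|(m + n)%R|%N by lia.
  rewrite [X in binZ X]En /= binz_small; last by lia.
  by rewrite binZ_neg //; lia.
have [mn|mn] := leP 0 (m + n).
  have -> : - m = `|m|%N by lia.
  have -> : m + n = `|(m + n)%R|%N by lia.
  have : n = (`|(m + n)%R| + `|m|)%N by lia.
  by move: `|(m + n)%R|%N `|m|%N => a b ->; rewrite /= sym.
have -> : - m = `|m|%N by lia.
rewrite [X in _ = binZ X _]En /= binz_small; last by lia.
by rewrite binZ_neg //; lia.
Qed.

End Binomials.

(** * Locally finite sums *)

(** Summing over all natural numbers, with finitely supported summands, leaves
    out the truncation bounds that depend on the vectors involved. *)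
Definition isum (V : zmodType) (f : nat -> V) : V :=
  \sum_(i \in [set: nat]%classic) f i.

Definition fin (V : zmodType) (f : nat -> V) : Prop :=
  exists N, forall i, (N <= i)%N -> f i = 0.

Definition fin2 (V : zmodType) (f : nat -> nat -> V) : Prop :=
  exists N, forall i j, (N <= i)%N || (N <= j)%N -> f i j = 0.

Lemma isumE (V : zmodType) N (f : nat -> V) : (forall i, (N <= i)%N -> f i = 0) -> isum f = \sum_(i < N) f i.
Proof.
move=> fN; rewrite fsbig_ord; apply/esym/fsbig_widen => // i [_ /= /negP].
by rewrite -leqNgt => /fN.
Qed.

Section LocallyFiniteSums.
Variable V : zmodType.
Implicit Types (f g : nat -> V) (F G : nat -> nat -> V).

Lemma eq_isum f g : f =1 g -> isum f = isum g.
Proof. by move=> /funext ->. Qed.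

Lemma isum0 : isum (fun=> 0 : V) = 0.
Proof. by rewrite (@isumE _ 0) ?big_ord0. Qed.

Lemma isum_eq0 f : (forall i, f i = 0) -> isum f = 0.
Proof. by move=> f0; rewrite -[RHS](isum0); exact: eq_isum. Qed.

Lemma fin_le (W : zmodType) f (g : nat -> W) :
  (forall i, f i = 0 -> g i = 0) -> fin f -> fin g.
Proof. by move=> fg [N fN]; exists N => i /fN /fg. Qed.

Lemma fin2_le (W : zmodType) F (G : nat -> nat -> W) :
  (forall i j, F i j = 0 -> G i j = 0) -> fin2 F -> fin2 G.
Proof. by move=> fg [N fN]; exists N => i j /fN /fg. Qed.

Lemma finD f g : fin f -> fin g -> fin (fun i => f i + g i).
Proof.
move=> [N fN] [N' gN]; exists (maxn N N') => i; rewrite geq_max => /andP[a b].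
by rewrite fN // gN // addr0.
Qed.

Lemma fin2D F G : fin2 F -> fin2 G -> fin2 (fun i j => F i j + G i j).
Proof.
move=> [N fN] [N' gN]; exists (maxn N N') => i j; rewrite !geq_max => H.
rewrite fN ?gN ?addr0 //.
  by case/orP: H => /andP[_ ->]; rewrite ?orbT.
by case/orP: H => /andP[-> _]; rewrite ?orbT.
Qed.

Lemma finN f : fin f -> fin (fun i => - f i).
Proof. by apply: fin_le => i ->; rewrite oppr0. Qed.

Lemma isumD f g : fin f -> fin g -> isum (fun i => f i + g i) = isum f + isum g.
Proof.
move=> [N fN] [N' gN]; pose m := maxn N N'.
have [a b] : (N <= m)%N /\ (N' <= m)%N by rewrite /m leq_maxl leq_maxr.
rewrite !(@isumE _ m) ?big_split // => i mi.
- by rewrite gN // (leq_trans b).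
- by rewrite fN // (leq_trans a).
- by rewrite fN ?gN ?addr0 // ?(leq_trans b) ?(leq_trans a).
Qed.

Lemma isum_raddf (W : zmodType) (phi : {additive V -> W}) f :
  fin f -> phi (isum f) = isum (fun i => phi (f i)).
Proof.
move=> [N fN]; rewrite (isumE fN) raddf_sum (@isumE _ N) // => i /fN ->.
by rewrite raddf0.
Qed.

Lemma isumN f : fin f -> isum (fun i => - f i) = - isum f.
Proof. by move=> fN; rewrite (isum_raddf (-%R)). Qed.

Lemma isumB f g : fin f -> fin g -> isum (fun i => f i - g i) = isum f - isum g.
Proof. by move=> ff fg; rewrite isumD ?isumN //; apply: finN. Qed.

Lemma isum_balance (f1 f2 g1 g2 : nat -> V) : fin f1 -> fin f2 -> fin g1 -> fin g2 ->
  (forall i, f1 i - f2 i = - g1 i + g2 i) -> isum f1 - isum f2 = - isum g1 + isum g2.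
Proof.
move=> F1 F2 G1 G2 E; rewrite -isumB // -isumN // -isumD //; last exact: finN.
exact: eq_isum.
Qed.

Lemma isum_shift j f :
  (forall i, (i < j)%N -> f i = 0) -> fin f -> isum f = isum (fun l => f (j + l)%N).
Proof.
move=> f0 [N fN]; rewrite (@isumE _ (j + N)); last first.
  by move=> i h; rewrite fN // (leq_trans _ h) // leq_addl.
rewrite (@isumE _ N); last by move=> i h; rewrite fN // (leq_trans h) // leq_addl.
by rewrite big_split_ord /= big1 ?add0r // => i _; rewrite f0.
Qed.

Lemma isum_pick (P : nat -> bool) (i : nat) f :
  (forall j, P j = (j == i)) -> isum (fun j => if P j then f j else 0) = f i.
Proof.
move=> Pi; rewrite (@isumE _ i.+1); last by move=> j; rewrite Pi; case: eqP => //; lia.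
rewrite big_ord_recr /= Pi eqxx big1 ?add0r // => j _.
by rewrite Pi; have := ltn_ord j; case: eqP => //; lia.
Qed.

Lemma fin_pick (P : nat -> bool) (z : int) f :
  (forall j, P j = (j%:Z == z)) -> fin (fun j => if P j then f j else 0).
Proof. by move=> Pi; exists `|z|.+1 => j; rewrite Pi; case: eqP => //; lia. Qed.

Lemma fin2_row F i : fin2 F -> fin (F i).
Proof. by move=> [N FN]; exists N => j Nj; rewrite FN // Nj orbT. Qed.

Lemma fin2_col F j : fin2 F -> fin (F^~ j).
Proof. by move=> [N FN]; exists N => i Nj; rewrite FN // Nj. Qed.

Lemma fin2_isum F : fin2 F -> fin (fun i => isum (F i)).
Proof.
move=> [N FN]; exists N => i Ni; rewrite (_ : F i = fun=> 0) ?isum0 //.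
by apply: funext => j; rewrite FN // Ni.
Qed.

Lemma fin2_tr F : fin2 F -> fin2 (fun j i => F i j).
Proof. by move=> [N FN]; exists N => i j; rewrite orbC => /FN. Qed.

Lemma fin_bound F n : (forall i, fin (F i)) ->
  exists N, forall i j, (i < n)%N -> (N <= j)%N -> F i j = 0.
Proof.
move=> Ff; elim: n => [|n [N FN]]; first by exists 0%N.
have [N' FN'] := Ff n; exists (maxn N N') => i j; rewrite geq_max ltnS leq_eqVlt.
by move=> /predU1P[->|ilt] /andP[? ?]; [exact: FN' | exact: FN].
Qed.

Lemma fin2_of F : (exists N, forall i j, (N <= i)%N -> F i j = 0) ->
  (forall i, fin (F i)) -> fin2 F.
Proof.
move=> [N FN] Ff; have [N' FN'] := fin_bound N Ff.
exists (maxn N N') => i j; rewrite !geq_max.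
have [Ni _|iN] := leqP N i; first exact: FN.
by move=> /= /andP[_ N'j]; exact: FN'.
Qed.

Lemma fin2_ofr F : (exists N, forall i j, (N <= j)%N -> F i j = 0) ->
  (forall j, fin (F^~ j)) -> fin2 F.
Proof.
move=> [N FN] Ff; apply: (@fin2_tr (fun j i => F i j)).
by apply: fin2_of => //; exists N => i j; exact: FN.
Qed.

Lemma fin2_diag F f : (forall i j, f (i + j)%N = 0 -> F i j = 0) -> fin f -> fin2 F.
Proof. by move=> fF [N fN]; exists N => i j ij; apply/fF/fN; lia. Qed.

Lemma isum_exch F : fin2 F ->
  isum (fun i => isum (F i)) = isum (fun j => isum (F^~ j)).
Proof.
move=> [N FN]; have z1 i : (N <= i)%N -> isum (F i) = 0.
  by move=> Ni; rewrite (@isumE _ 0) ?big_ord0 // => j _; rewrite FN // Ni.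
have z2 j : (N <= j)%N -> isum (F^~ j) = 0.
  by move=> Ni; rewrite (@isumE _ 0) ?big_ord0 // => i _; rewrite FN // Ni orbT.
rewrite !(@isumE _ N) //.
transitivity (\sum_(i < N) \sum_(j < N) F i j).
  by apply: eq_bigr => i _; rewrite (@isumE _ N) // => j Nj; rewrite FN // Nj orbT.
rewrite exchange_big /=; apply: eq_bigr => j _; rewrite (@isumE _ N) // => i Ni.
by rewrite FN // Ni.
Qed.

Lemma isum_lower F : fin2 F -> (forall k j, (k < j)%N -> F k j = 0) ->
  isum (fun k => isum (F k)) = isum (fun j => isum (fun l => F (j + l)%N j)).
Proof.
move=> F2 F0; rewrite isum_exch //; apply: eq_isum => j.
by apply: isum_shift; [move=> k /F0 | exact: fin2_col].
Qed.

End LocallyFiniteSums.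

Section BinomialSums.
Variables (K : numFieldType) (V : lmodType K).
Implicit Types (x y : int) (f g : nat -> V) (G : nat -> nat -> V).

Lemma scaler_swap (a b : K) (v : V) : a *: (b *: v) = b *: (a *: v).
Proof. by rewrite !scalerA mulrC. Qed.

Lemma finZ (c : nat -> K) f : fin f -> fin (fun i => c i *: f i).
Proof. by apply: fin_le => i ->; rewrite scaler0. Qed.

Lemma fin2Z (c : nat -> nat -> K) G : fin2 G -> fin2 (fun i j => c i j *: G i j).
Proof. by apply: fin2_le => i j ->; rewrite scaler0. Qed.

Lemma isumZ (c : K) f : fin f -> isum (fun i => c *: f i) = c *: isum f.
Proof. by move=> ff; rewrite (isum_raddf ( *:%R c)). Qed.

Lemma isum_lin (W : lmodType K) (phi : {linear V -> W}) (c : nat -> K) f :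
  fin f -> phi (isum (fun i => c i *: f i)) = isum (fun i => c i *: phi (f i)).
Proof.
move=> ff; rewrite isum_raddf; last exact: finZ.
by apply: eq_isum => i /=; rewrite linearZ.
Qed.

Lemma isum_vdm x y g : fin g ->
  isum (fun i => isum (fun j => (binz K x i * binz K y j) *: g (i + j)%N)) =
  isum (fun s => binz K (x + y) s *: g s).
Proof.
move=> gf.
pose F s j := if (j <= s)%N then (binz K x (s - j) * binz K y j) *: g s else 0.
have Ff : fin2 F.
  have [N gN] := gf; exists N => i j; rewrite /F => H; case: (leqP j i) => // ji.
  by rewrite gN ?scaler0 //; lia.
have -> : isum (fun s => binz K (x + y) s *: g s) = isum (fun s => isum (F s)).
  apply: eq_isum => s; rewrite -binz_vdm scaler_suml (@isumE _ s.+1) => [|i h].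
    by apply: eq_bigr => j _; rewrite /F -ltnS ltn_ord.
  by rewrite /F leqNgt h.
rewrite (isum_lower Ff) => [|k j kj]; last by rewrite /F leqNgt kj.
have Gf : fin2 (fun i j => (binz K x i * binz K y j) *: g (i + j)%N).
  by apply: (fin2_diag (f := g)) => // i j ->; rewrite scaler0.
rewrite (isum_exch Gf); apply: eq_isum => j; apply: eq_isum => l.
by rewrite /F leq_addr addKn addnC.
Qed.

Lemma isum_svdm x y g : fin g ->
  isum (fun i => isum (fun j => (sbin K x i * sbin K y j) *: g (i + j)%N)) =
  isum (fun s => sbin K (x + y) s *: g s).
Proof.
move=> gf; have := @isum_vdm x y (fun s => (-1) ^+ s *: g s) (finZ _ gf).
under eq_isum do under eq_isum do rewrite scalerA.
under [in RHS]eq_isum do rewrite scalerA mulrC.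
move=> <-; apply: eq_isum => i; apply: eq_isum => j; congr (_ *: _).
by rewrite /sbin exprD; ring.
Qed.

Lemma sbin_tri x (j l : nat) :
  sbin K x (j + l) * binz K (j + l)%N%:Z j = sbin K x j * sbin K (x - j%:Z) l.
Proof. by rewrite /sbin -mulrA -binz_tri exprD; ring. Qed.

Lemma sbin_binz_triC x (k j : nat) :
  sbin K x k * binz K (x - k%:Z) j = binz K x j * sbin K (x - j%:Z) k.
Proof. by rewrite /sbin -mulrA binz_triC mulrCA. Qed.

Lemma isum_tri x G : fin2 (fun k j => if (j <= k)%N then G k j else 0) ->
  isum (fun k => isum (fun j => (sbin K x k * binz K k%:Z j) *: G k j)) =
  isum (fun j => isum (fun l => (sbin K x j * sbin K (x - j%:Z) l) *: G (j + l)%N j)).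
Proof.
move=> Gf; rewrite isum_lower => [||k j kj].
- by apply: eq_isum => j; apply: eq_isum => l; rewrite sbin_tri.
- move: Gf; apply: fin2_le => k j; case: leqP => [_ ->|kj _]; first by rewrite scaler0.
  by rewrite binz_small // mulr0 scale0r.
- by rewrite binz_small // mulr0 scale0r.
Qed.

Lemma isum_sbin_pick x (z : int) (P : nat -> bool) (F : int -> V) :
  (forall i, P i = (i%:Z == z)) ->
  isum (fun i => sbin K x i *: (if P i then F i%:Z else 0)) = sbinZ K x z *: F z.
Proof.
case: z => [i|i] Pi; last first.
  rewrite (_ : (fun _ => _) = fun=> 0) ?isum0 ?scale0r //.
  by apply: funext => j; rewrite Pi scaler0.
rewrite -(isum_pick (P := P) (fun j => sbin K x j *: F j)) => [|j]; last by rewrite Pi.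
by apply: eq_isum => j; case: ifP; rewrite ?scaler0.
Qed.

Lemma isum_binz_pick x (z : int) (P : nat -> bool) (F : int -> V) :
  (forall i, P i = (i%:Z == z)) ->
  isum (fun i => binz K x i *: (if P i then F i%:Z else 0)) = binZ K x z *: F z.
Proof.
case: z => [i|i] Pi; last first.
  rewrite (_ : (fun _ => _) = fun=> 0) ?isum0 ?scale0r //.
  by apply: funext => j; rewrite Pi scaler0.
rewrite -(isum_pick (P := P) (fun j => binz K x j *: F j)) => [|j]; last by rewrite Pi.
by apply: eq_isum => j; case: ifP; rewrite ?scaler0.
Qed.

Lemma isum_exchZ (x y : nat -> K) G : fin2 G ->
  isum (fun i => x i *: isum (fun j => y j *: G i j)) =
  isum (fun j => y j *: isum (fun i => x i *: G i j)).
Proof.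
move=> Gf; transitivity (isum (fun i => isum (fun j => (x i * y j) *: G i j))).
  apply: eq_isum => i; rewrite -isumZ; last by apply: finZ; exact: fin2_row.
  by apply: eq_isum => j; rewrite scalerA.
rewrite isum_exch; last exact: fin2Z.
apply: eq_isum => j; rewrite -isumZ; last by apply: finZ; exact: (fin2_col j Gf).
by apply: eq_isum => i; rewrite scalerA mulrC.
Qed.

Lemma isum_vdmZ x y g : fin g ->
  isum (fun i => binz K x i *: isum (fun j => binz K y j *: g (i + j)%N)) =
  isum (fun s => binz K (x + y) s *: g s).
Proof.
move=> gf; rewrite -isum_vdm //; apply: eq_isum => i; rewrite -isumZ.
  by apply: eq_isum => j; rewrite scalerA.
by apply: finZ; apply: (fin2_row i (fin2_diag (F := fun i j => g (i + j)%N) _ gf)).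
Qed.

Lemma isum_svdmZ x y g : fin g ->
  isum (fun i => sbin K x i *: isum (fun j => sbin K y j *: g (i + j)%N)) =
  isum (fun s => sbin K (x + y) s *: g s).
Proof.
move=> gf; rewrite -isum_svdm //; apply: eq_isum => i; rewrite -isumZ.
  by apply: eq_isum => j; rewrite scalerA.
by apply: finZ; apply: (fin2_row i (fin2_diag (F := fun i j => g (i + j)%N) _ gf)).
Qed.

Lemma fin2_triangle G : fin2 (fun k j => if (j <= k)%N then G k j else 0) ->
  fin2 (fun k j => binz K k%:Z j *: G k j).
Proof.
apply: fin2_le => k j; case: leqP => [_ ->|kj _]; first by rewrite scaler0.
by rewrite binz_small // scale0r.
Qed.

(** Summation by C(x,k) C(k,j) = C(x,j) C(x-j,k-j), with k = j + l. *)
Lemma isum_triZ x G : fin2 (fun k j => if (j <= k)%N then G k j else 0) ->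
  isum (fun k => sbin K x k *: isum (fun j => binz K k%:Z j *: G k j)) =
  isum (fun j => sbin K x j *: isum (fun l => sbin K (x - j%:Z) l *: G (j + l)%N j)).
Proof.
move=> Gf; transitivity (isum (fun k => isum (fun j =>
    (sbin K x k * binz K k%:Z j) *: G k j))).
  apply: eq_isum => k; rewrite -isumZ; last exact: (fin2_row k (fin2_triangle Gf)).
  by apply: eq_isum => j; rewrite scalerA.
rewrite isum_tri //; apply: eq_isum => j; rewrite -isumZ.
  by apply: eq_isum => l; rewrite scalerA.
apply: finZ; case: Gf => N GN; exists N => l Nl; have := GN (j + l)%N j.
by rewrite leq_addr => -> //; rewrite (leq_trans Nl) ?leq_addl.
Qed.

(** Summation by C(x,k) C(x-k,j) = C(x,j) C(x-j,k). *)
Lemma isum_triCZ x G : fin2 G ->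
  isum (fun k => sbin K x k *: isum (fun j => binz K (x - k%:Z) j *: G k j)) =
  isum (fun j => binz K x j *: isum (fun k => sbin K (x - j%:Z) k *: G k j)).
Proof.
move=> Gf; transitivity (isum (fun k => isum (fun j =>
    (binz K x j * sbin K (x - j%:Z) k) *: G k j))).
  apply: eq_isum => k; rewrite -isumZ; last by apply: finZ; exact: fin2_row.
  by apply: eq_isum => j; rewrite scalerA sbin_binz_triC.
rewrite isum_exch; last exact: fin2Z.
apply: eq_isum => j; rewrite -isumZ; last by apply: finZ; exact: (fin2_col j Gf).
by apply: eq_isum => k; rewrite scalerA.
Qed.

End BinomialSums.

(** * The universal property of SF *)

Section UniversalProperty.
Local Open Scope quotient_scope.
Variables (K : fieldType) (h : lmodType K) (form : h -> h -> K).
Local Notation SF := (SF form).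
Local Notation act psi m := (lact (gen form psi m)).

Lemma SF_scaleE (c : K) (v : SF) : c *: v = lact (cstA form c) v.
Proof. by []. Qed.

Lemma lact_cstC (c : K) (a : algA form) (v : SF) : lact a (c *: v) = c *: lact a v.
Proof.
rewrite !SF_scaleE -!lactM; congr (lact _ v).
have E1 : c *: (1 : algA form) = cstA form c by exact: mulr1.
by have := algA_scaleAr c a 1; rewrite mulr1 E1 => <-.
Qed.

Lemma lact_lin (a : algA form) (c : K) (u v : SF) :
  lact a (c *: u + v) = c *: lact a u + lact a v.
Proof. by rewrite lactDr lact_cstC. Qed.

Lemma lact_TAdd x y (v : SF) :
  lact (\pi_(algA form) (TAdd x y)) v = lact (\pi_(algA form) x) v + lact (\pi_(algA form) y) v.
Proof. by rewrite -lactDl; congr (lact _ v); apply/esym/addA_pi. Qed.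

Lemma lact_TMul x y (v : SF) :
  lact (\pi_(algA form) (TMul x y)) v = lact (\pi_(algA form) x) (lact (\pi_(algA form) y) v).
Proof. by rewrite -lactM; congr (lact _ v); apply/esym/mulA_pi. Qed.

Lemma lact_TCst c (v : SF) : lact (\pi_(algA form) (TCst h c)) v = c *: v.
Proof. by []. Qed.

Lemma act_linl (c : K) psi phi m (v : SF) :
  act (c *: psi + phi) m v = c *: act psi m v + act phi m v.
Proof.
rewrite -lact_TCst -lact_TMul -lact_TAdd; congr (lact _ v).
by apply/algA_eqP; exact: teq_gen.
Qed.

Lemma act_comm psi phi m n (v : SF) :
  act psi m (act phi n v) + act phi n (act psi m v) =
  (m%:~R * form psi phi * (m + n == 0)%:R) *: v.
Proof.
rewrite -!lact_TMul -lact_TAdd -lact_TCst; congr (lact _ v).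
by apply/algA_eqP; exact: teq_comm.
Qed.

Lemma act_vac psi m : 0 <= m -> act psi m (SFvac form) = 0.
Proof.
move=> m0; rewrite /SFvac lact_pi mulr1 -(raddf0 \pi_SF); apply/SF_eqP.
by rewrite subr0 -[gen _ _ _]mul1r; apply/A_ge0P; exact: li_gen.
Qed.

(** The words in the modes, in any order, span SF, since the modes generate A.
    No ordering of the modes enters here; SF_fock_ind is the sharper form. *)
Lemma SF_word_ind (P : SF -> Prop) :
  (forall (c : K) u v, P u -> P v -> P (c *: u + v)) -> P (SFvac form) ->
  (forall psi m v, P v -> P (act psi m v)) -> forall v, P v.
Proof.
move=> Plin Pvac Pact.
have P0 : P 0 by rewrite -(addNr (SFvac form)) -scaleN1r; exact: Plin.
have lactP x : forall v, P v -> P (lact (\pi_(algA form) x) v).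
  elim: x => [psi m|c|x IHx y IHy|x IHx y IHy] v Pv.
  - exact: Pact.
  - by rewrite lact_TCst -[_ *: v]addr0; exact: Plin.
  - by rewrite lact_TAdd -[X in X + _]scale1r; apply: Plin; [exact: IHx | exact: IHy].
  - by rewrite lact_TMul; apply/IHx/IHy.
elim/SF_ind; elim/algA_ind=> x; rewrite -[X in \pi_SF X]mulr1 -lact_pi; exact: lactP.
Qed.

Variables (P : lmodType K) (g : h -> int -> P -> P) (v0 : P).
Hypothesis g_lin : forall psi m c u v, g psi m (c *: u + v) = c *: g psi m u + g psi m v.
Hypothesis g_linl : forall c psi phi m u,
  g (c *: psi + phi) m u = c *: g psi m u + g phi m u.
Hypothesis g_comm : forall psi phi m n u,
  g psi m (g phi n u) + g phi n (g psi m u) =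
  (m%:~R * form psi phi * (m + n == 0)%:R) *: u.
Hypothesis g_vac : forall psi m, 0 <= m -> g psi m v0 = 0.

Fixpoint eval_term (x : term h) (u : P) : P :=
  match x with
  | TGen psi m => g psi m u
  | TCst c => c *: u
  | TAdd x y => eval_term x u + eval_term y u
  | TMul x y => eval_term x (eval_term y u)
  end.

Lemma eval_lin x c u v :
  eval_term x (c *: u + v) = c *: eval_term x u + eval_term x v.
Proof.
elim: x u v => [psi m|b|x IHx y IHy|x IHx y IHy] u v /=.
- exact: g_lin.
- by rewrite scalerDr !scalerA mulrC.
- by rewrite IHx IHy scalerDr addrACA.
- by rewrite IHy IHx.
Qed.

Lemma eval0 x : eval_term x 0 = 0.
Proof. by have := eval_lin x (-1) 0 0; rewrite scaler0 addr0 scaleN1r addNr. Qed.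

Lemma evalZ x c u : eval_term x (c *: u) = c *: eval_term x u.
Proof. by rewrite -[c *: u]addr0 eval_lin eval0 addr0. Qed.

Lemma evalD x u v : eval_term x (u + v) = eval_term x u + eval_term x v.
Proof. by rewrite -[u in LHS]scale1r eval_lin scale1r. Qed.

Lemma eval_teq x y : teq form x y -> eval_term x =1 eval_term y.
Proof.
elim=> {x y} /=.
- by [].
- by move=> x y _ IH u; rewrite IH.
- by move=> x y z _ IH _ IH' u; rewrite IH IH'.
- by move=> x x' y y' _ IH _ IH' u; rewrite IH IH'.
- by move=> x x' y y' _ IH _ IH' u; rewrite IH IH'.
- by move=> x y z u; rewrite addrA.
- by move=> x y u; rewrite addrC.
- by move=> x u; rewrite scale0r add0r.
- by [].
- by move=> x u; rewrite scale1r.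
- by move=> x u; rewrite !scale0r.
- by [].
- by move=> x y z u; rewrite evalD.
- by move=> a b u; rewrite scalerDl.
- by move=> a b u; rewrite scalerA.
- by move=> a x u; rewrite evalZ.
- by move=> a psi phi m u; rewrite g_linl.
- by move=> psi phi m n u; rewrite g_comm.
Qed.

(** The left ideal A_{>=0} annihilates v0, so evaluation at v0 descends to the
    quotient. *)
Lemma eval_ge0 (a : algA form) : left_ideal_ge0 a -> eval_term (repr a) v0 = 0.
Proof.
elim=> {a} [|a psi m m0|a b _ IHa _ IHb].
- by rewrite (eval_teq (teq_repr form (TCst h 0))) /= scale0r.
- by rewrite (eval_teq (teq_repr form (TMul _ _))) /=
     (eval_teq (teq_repr form (TGen _ _))) /= g_vac ?eval0.
- by rewrite (eval_teq (teq_repr form (TAdd _ _))) /= IHa IHb addr0.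
Qed.

Definition SF_lift (v : SF) : P := eval_term (repr (repr v)) v0.

Lemma SF_lift_pi (x : term h) : SF_lift (\pi_SF (\pi_(algA form) x)) = eval_term x v0.
Proof.
rewrite /SF_lift; set a := repr (\pi_SF _).
have /SF_eqP/A_ge0P/eval_ge0 : \pi_SF a = \pi_SF (\pi_(algA form) x) by rewrite reprK.
rewrite (eval_teq (teq_repr form (TAdd _ _))) /=.
rewrite (eval_teq (teq_repr form (TMul _ _))) /= (eval_teq (teq_repr form (TCst _ _))) /=.
by rewrite (eval_teq (teq_repr form x)) scaleN1r => /subr0_eq.
Qed.

Lemma SF_lift_vac : SF_lift (SFvac form) = v0.
Proof. by rewrite SF_lift_pi /= scale1r. Qed.

Lemma SF_lift_act psi m v : SF_lift (act psi m v) = g psi m (SF_lift v).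
Proof.
elim/SF_ind: v; elim/algA_ind=> x; rewrite SF_lift_pi lact_pi.
have -> : gen form psi m * \pi_(algA form) x = \pi_(algA form) (TMul (TGen psi m) x).
  exact: mulA_pi.
by rewrite SF_lift_pi.
Qed.

Lemma SF_lift_lin (c : K) u v : SF_lift (c *: u + v) = c *: SF_lift u + SF_lift v.
Proof.
elim/SF_ind: u; elim/algA_ind=> x; elim/SF_ind: v; elim/algA_ind=> y.
rewrite !SF_lift_pi SF_scaleE lact_pi -raddfD.
have -> : cstA form c * \pi_(algA form) x + \pi_(algA form) y =
    \pi_(algA form) (TAdd (TMul (TCst h c) x) y).
  by rewrite -addA_pi -mulA_pi.
by rewrite SF_lift_pi.
Qed.

End UniversalProperty.

(** * Fields on a fermionic module and their products *)

(** A module over A on which truncation holds, with a parity. The parity is an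
    involution that anticommutes with the modes; signs are written by means of
    it, so that vectors need not be split into homogeneous components. *)
Record ferm_module (K : numFieldType) (h : lmodType K) (form : h -> h -> K) :=
  FermModule {
  fm_sort :> lmodType K;
  fact : h -> int -> {linear fm_sort -> fm_sort};
  fpar : {linear fm_sort -> fm_sort};
  fact_linl : forall c psi phi m u,
    fact (c *: psi + phi) m u = c *: fact psi m u + fact phi m u;
  fact_comm : forall psi phi m n u,
    fact psi m (fact phi n u) + fact phi n (fact psi m u) =
    (m%:~R * form psi phi * (m + n == 0)%:R) *: u;
  fact_fin : forall psi u, fin (fun i => fact psi i%:Z u);
  fparK : involutive fpar;
  fpar_fact : forall psi m u, fpar (fact psi m u) = - fact psi m (fpar u)
}.

Arguments fact {K h form f} psi m.
Arguments fpar {K h form f}.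

Section Fields.
Variables (K : numFieldType) (M : lmodType K).

Definition is_field (a : int -> M -> M) : Prop :=
  (forall n c u v, a n (c *: u + v) = c *: a n u + a n v) /\
  (forall u, fin (fun i => a i%:Z u)).

Definition field_pred : {pred int -> M -> M} := fun a => `[< is_field a >].

Fact field_submod : submod_closed field_pred.
Proof.
split=> [|c a b /asboolP[al af] /asboolP[bl bf]]; apply/asboolP.
  by split=> [n c u v|u]; [rewrite scaler0 addr0 | exists 0%N].
split=> [n k u v|u]; last first.
  rewrite (_ : (fun i => _) = (fun i => c *: a i%:Z u + b i%:Z u)) //.
  by apply: finD => //; exact: (finZ (fun=> c)).
rewrite -[LHS]/(c *: a n (k *: u + v) + b n (k *: u + v)) al bl.
rewrite -[RHS]/(k *: (c *: a n u + b n u) + (c *: a n v + b n v)).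
by rewrite !scalerDr !scalerA [c * k]mulrC addrACA.
Qed.

HB.instance Definition _ := GRing.isSubmodClosed.Build K (int -> M -> M)
  field_pred field_submod.

Record field := Field { field_fun : int -> M -> M; _ : field_fun \in field_pred }.
HB.instance Definition _ := [isSub for field_fun].
HB.instance Definition _ := [Choice of field by <:].
HB.instance Definition _ := [SubChoice_isSubLmodule of field by <:].

Definition fmode (a : field) : int -> M -> M := field_fun a.

Lemma field_is_field (a : field) : is_field (fmode a).
Proof. exact/asboolP/(valP a). Qed.

Fact fmode_lin (a : field) n : linear (fmode a n).
Proof. by move=> c u v; have [H _] := field_is_field a; exact: H. Qed.

HB.instance Definition _ (a : field) n :=
  GRing.isLinear.Build K M M *:%R (fmode a n) (fmode_lin a n).

Definition mkfield (a : int -> M -> M) (af : is_field a) : field :=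
  @Field a (introT (asboolP _) af).

Lemma mkfieldE a af : fmode (@mkfield a af) = a. Proof. by []. Qed.

Lemma field_eq (a b : field) : (forall n u, fmode a n u = fmode b n u) -> a = b.
Proof. by move=> ab; apply: val_inj; apply: funext => n; apply: funext => u; exact: ab. Qed.

Lemma fmodeD a b n u : fmode (a + b) n u = fmode a n u + fmode b n u.
Proof. by []. Qed.

Lemma fmodeZ c a n u : fmode (c *: a) n u = c *: fmode a n u.
Proof. by []. Qed.

Lemma fmodeN a n u : fmode (- a) n u = - fmode a n u.
Proof. by rewrite -[- a]scaleN1r fmodeZ scaleN1r. Qed.

Lemma fmode0 n u : fmode 0 n u = 0.
Proof. by []. Qed.

Lemma fmode_fin (a : field) n u : fin (fun i => fmode a (n + i%:Z) u).
Proof.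
have [_ /(_ u)[N aN]] := field_is_field a.
exists (N + `|n|)%N => i Ni; have -> : n + i%:Z = `|(n + i%:Z)%R|%N by lia.
by apply: aN; lia.
Qed.

Fact id_is_field : is_field (fun n u => if n == -1 then u else 0).
Proof.
split=> [n c u v|u]; first by case: ifP; rewrite ?scaler0 ?addr0.
by exists 0%N.
Qed.
Definition idfield := mkfield id_is_field.

End Fields.

Section Products.
Variables (K : numFieldType) (h : lmodType K) (form : h -> h -> K).
Variable M : ferm_module form.
Local Notation sbin := (sbin K).
Implicit Types (a b : field M) (psi phi : h) (m n k : int) (u v : M).

Lemma act_fpar psi m u : fact psi m (fpar u) = - fpar (fact psi m u) :> M.
Proof. by rewrite fpar_fact opprK. Qed.

Fact conj_is_field a : is_field (fun n u => fpar (fmode a n (fpar u)) : M).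
Proof.
split=> [n c u v|u]; first by rewrite !linearP.
by apply: fin_le (fmode_fin a 0 (fpar u)) => i; rewrite add0r => ->; rewrite linear0.
Qed.
(** A field of parity e is fixed by this conjugation up to the sign (-1)^e, so
    replacing a by fconj a is the sign rule for moving an odd operator past a. *)
Definition fconj a := mkfield (conj_is_field a).

Lemma fconjE a n u : fmode (fconj a) n u = fpar (fmode a n (fpar u)). Proof. by []. Qed.

Lemma fconjK : involutive fconj.
Proof. by move=> a; apply: field_eq => n u; rewrite !fconjE !fparK. Qed.

Fact fconj_lin : linear fconj.
Proof. by move=> c a b; apply: field_eq => n u; rewrite !(fconjE, fmodeD, fmodeZ) linearP. Qed.
HB.instance Definition _ := GRing.isLinear.Build K (field M) (field M) *:%R fconj fconj_lin.

#[global] Opaque fconj.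

Lemma lprod_fin psi m a n u :
  fin (fun i => fact psi (m - i%:Z) (fmode a (n + i%:Z) u)).
Proof. by apply: fin_le (fmode_fin a n u) => i ->; rewrite linear0. Qed.

Fact lprod_is_field psi m a :
  is_field (fun n u => isum (fun i =>
    sbin m i *: fact psi (m - i%:Z) (fmode a (n + i%:Z) u))).
Proof.
split=> [n c u v|u].
  have F := lprod_fin psi m a n.
  rewrite -isumZ -?isumD; do ?[exact: finZ | apply: (finZ (fun=> c)); exact: finZ].
  by apply: eq_isum => i; rewrite !linearP.
apply: fin2_isum; apply: fin2_diag (fmode_fin a 0 u) => i j.
by rewrite add0r PoszD => ->; rewrite linear0 scaler0.
Qed.
(** The terms in which psi(z) acts last in the m-th product of psi(z) and a(z):
    Res_x (x - z)^m psi(x) a(z), expanded for |x| > |z|. *)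
Definition lprod psi m a := mkfield (lprod_is_field psi m a).

Lemma rprod_fin psi (f : nat -> int) a u :
  fin (fun i => fmode a (f i) (fact psi i%:Z u)).
Proof. by apply: fin_le (fact_fin psi u) => i ->; rewrite linear0. Qed.

Lemma rprod_fin2 psi m a n u :
  fin2 (fun j i => fmode a (n + j%:Z + m - i%:Z) (fact psi i%:Z u)).
Proof.
apply: fin2_ofr => [|i].
  by have [N uN] := fact_fin psi u; exists N => j i /uN ->; rewrite linear0.
have := fmode_fin a (n + m - i%:Z) (fact psi i%:Z u); apply: fin_le => j <-.
by congr (fmode a _ _); lia.
Qed.

Fact rprod_is_field psi m a :
  is_field (fun n u => isum (fun i =>
    sbin m i *: fmode (fconj a) (n + m - i%:Z) (fact psi i%:Z u))).
Proof.
split=> [n c u v|u].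
  have F := rprod_fin psi (fun i => n + m - i%:Z) (fconj a).
  rewrite -isumZ -?isumD; do ?[exact: finZ | apply: (finZ (fun=> c)); exact: finZ].
  by apply: eq_isum => i; rewrite !linearP.
apply: fin2_isum; apply: fin2_le (rprod_fin2 psi m (fconj a) 0 u) => j i.
by rewrite add0r => ->; rewrite scaler0.
Qed.
(** The terms in which psi(z) acts first: Res_x (x - z)^m a(z) psi(x) expanded
    for |z| > |x|, without the sign (-1)^m and with the parity sign of a. *)
Definition rprod psi m a := mkfield (rprod_is_field psi m a).

Lemma lprodE psi m a n u : fmode (lprod psi m a) n u =
  isum (fun i => sbin m i *: fact psi (m - i%:Z) (fmode a (n + i%:Z) u)).
Proof. by []. Qed.

Lemma rprodE psi m a n u : fmode (rprod psi m a) n u =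
  isum (fun i => sbin m i *: fmode (fconj a) (n + m - i%:Z) (fact psi i%:Z u)).
Proof. by []. Qed.

(* Unfolding these two sums during unification is never useful. *)
#[global] Opaque lprod rprod.

Fact lprod_lin psi m : linear (lprod psi m).
Proof.
move=> c a b; apply: field_eq => n u; rewrite !(fmodeD, fmodeZ, lprodE).
have Fa := lprod_fin psi m a n u; have Fb := lprod_fin psi m b n u.
rewrite -isumZ -?isumD; do ?[exact: finZ | apply: (finZ (fun=> c)); exact: finZ].
by apply: eq_isum => i; rewrite !linearP.
Qed.
HB.instance Definition _ psi m := GRing.isLinear.Build K (field M) (field M) *:%R
  (lprod psi m) (lprod_lin psi m).

Fact rprod_lin psi m : linear (rprod psi m).
Proof.
move=> c a b; apply: field_eq => n u; rewrite !(fmodeD, fmodeZ, rprodE).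
have Fa := rprod_fin psi (fun i => n + m - i%:Z) (fconj a) u.
have Fb := rprod_fin psi (fun i => n + m - i%:Z) (fconj b) u.
rewrite -isumZ -?isumD; do ?[exact: finZ | apply: (finZ (fun=> c)); exact: finZ].
apply: eq_isum => i; rewrite linearP fmodeD fmodeZ scalerDr !scalerA.
by rewrite [c * _]mulrC.
Qed.
HB.instance Definition _ psi m := GRing.isLinear.Build K (field M) (field M) *:%R
  (rprod psi m) (rprod_lin psi m).

Lemma lprod_linl c psi phi m a :
  lprod (c *: psi + phi) m a = c *: lprod psi m a + lprod phi m a.
Proof.
apply: field_eq => n u; rewrite !(fmodeD, fmodeZ, lprodE).
have Fa := lprod_fin psi m a n u; have Fb := lprod_fin phi m a n u.
rewrite -isumZ -?isumD; do ?[exact: finZ | apply: (finZ (fun=> c)); exact: finZ].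
apply: eq_isum => i; rewrite fact_linl scalerDr !scalerA.
by rewrite [c * _]mulrC.
Qed.

Lemma rprod_linl c psi phi m a :
  rprod (c *: psi + phi) m a = c *: rprod psi m a + rprod phi m a.
Proof.
apply: field_eq => n u; rewrite !(fmodeD, fmodeZ, rprodE).
have Fa := rprod_fin psi (fun i => n + m - i%:Z) (fconj a) u.
have Fb := rprod_fin phi (fun i => n + m - i%:Z) (fconj a) u.
rewrite -isumZ -?isumD; do ?[exact: finZ | apply: (finZ (fun=> c)); exact: finZ].
apply: eq_isum => i; rewrite fact_linl linearP scalerDr !scalerA.
by rewrite [c * _]mulrC.
Qed.

Lemma sbin_absorb (x : int) i : sbin x i * (x - i%:Z)%:~R = x%:~R * sbin (x - 1) i.
Proof.
have := binzSl K (x - 1) i; rewrite subrK binzS => E.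
by rewrite /sbin -mulrA [binz _ _ _ * _]mulrC E; ring.
Qed.

(** The anticommutators of the modes produce the coefficient of t^(m+n) in
    m (1 - t)^(m-1) (1 - t)^n, by Vandermonde; up to sign it is m times
    C(m+n-1, m+n), which vanishes unless m + n = 0. *)
Lemma lprod_comm psi phi m n a :
  lprod psi m (lprod phi n a) + lprod phi n (lprod psi m a) =
  (m%:~R * form psi phi * (m + n == 0)%:R) *: a.
Proof.
apply: field_eq => k u; rewrite !(fmodeD, fmodeZ).
pose A psi phi (m n : int) (i j : nat) :=
  fact psi (m - i%:Z) (fact phi (n - j%:Z) (fmode a (k + (i + j)%N%:Z) u)).
have Af psi' phi' m' n' : fin2 (A psi' phi' m' n').
  by apply: fin2_diag (fmode_fin a k u) => i j; rewrite /A => ->; rewrite !linear0.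
have E psi' phi' m' n' : fmode (lprod psi' m' (lprod phi' n' a)) k u =
    isum (fun i => isum (fun j => (sbin m' i * sbin n' j) *: A psi' phi' m' n' i j)).
  rewrite lprodE; apply: eq_isum => i; rewrite lprodE isum_lin; last exact: lprod_fin.
  rewrite -isumZ; last first.
    apply: finZ; move: (fin2_row i (Af psi' phi' m' n')); apply: fin_le => j.
    by rewrite /A PoszD addrA.
  by apply: eq_isum => j; rewrite scalerA /A PoszD addrA.
rewrite !E [X in _ + X]isum_exch; last exact: fin2Z.
rewrite -isumD; try by [apply: fin2_isum; apply: fin2Z | apply/fin2_isum/fin2_tr/fin2Z].
transitivity (isum (fun i => isum (fun j => (sbin (m - 1) i * sbin n j) *:
    (if (i + j)%N%:Z == m + n then (m%:~R * form psi phi) *: fmode a (k + (i + j)%N%:Z) u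
     else 0)))).
  apply: eq_isum => i; rewrite -isumD; last 2 first.
  - by apply: finZ; exact: fin2_row.
  - by apply: (finZ (fun j => sbin n j * sbin m i)); apply: (fin2_row i (fin2_tr _)).
  apply: eq_isum => j; rewrite [sbin n j * _]mulrC -scalerDr /A [(j + i)%N]addnC fact_comm.
  have -> : (m - i%:Z + (n - j%:Z) == 0) = ((i + j)%N%:Z == m + n) by lia.
  case: eqP => _ /=; last by rewrite mulr0 scale0r !scaler0.
  rewrite mulr1 !scalerA; congr (_ *: _).
  by rewrite mulrAC !mulrA sbin_absorb; ring.
rewrite (isum_svdm (m - 1) n (g := fun s => if s%:Z == m + n then
   (m%:~R * form psi phi) *: fmode a (k + s%:Z) u else 0)); last first.
  exact: (fin_pick (z := m + n)).
rewrite (isum_sbin_pick (z := m + n) _ (fun s => (m%:~R * form psi phi) *: fmode a (k + s) u)) //.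
rewrite scalerA; case: eqP => [mn|mn].
  by rewrite mn /= addr0 /sbin binz0 expr0 mulr1 !mul1r mulr1.
suff -> : sbinZ K (m - 1 + n) (m + n) = 0 by rewrite mul0r mulr0 !scale0r.
case E' : (m + n) => [s|s] //=.
rewrite (_ : m - 1 + n = s.-1%:Z) /sbin ?binz_small ?mulr0 //; lia.
Qed.

Lemma lrprod_comm psi phi m n a :
  lprod psi m (rprod phi n a) = - rprod phi n (lprod psi m a).
Proof.
apply: field_eq => k u; rewrite fmodeN.
pose A i j := fact psi (m - i%:Z) (fmode (fconj a) (k + i%:Z + n - j%:Z) (fact phi j%:Z u)).
have Af : fin2 A.
  by apply: fin2_le (rprod_fin2 phi n (fconj a) k u) => i j; rewrite /A => ->; rewrite linear0.
transitivity (isum (fun i => isum (fun j => (sbin m i * sbin n j) *: A i j))).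
  rewrite lprodE; apply: eq_isum => i; rewrite rprodE isum_lin; last exact: rprod_fin.
  rewrite -isumZ; last by apply: finZ; exact: (fin2_row i Af).
  by apply: eq_isum => j; rewrite scalerA.
rewrite isum_exch; last exact: fin2Z.
rewrite -isumN; last first.
  by apply: finZ; exact: (rprod_fin phi (fun i => k + n - i%:Z)).
apply: eq_isum => j; rewrite fconjE lprodE isum_lin; last exact: lprod_fin.
rewrite -scalerN -isumN; last first.
  apply: finZ; apply: fin_le (lprod_fin psi m a (k + n - j%:Z) (fpar (fact phi j%:Z u))).
  by move=> i ->; rewrite linear0.
rewrite -isumZ; last first.
  apply: finN; apply: finZ.
  apply: fin_le (lprod_fin psi m a (k + n - j%:Z) (fpar (fact phi j%:Z u))).
  by move=> i ->; rewrite linear0.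
apply: eq_isum => i; rewrite fpar_fact !scalerN opprK scalerA mulrC; congr (_ *: _).
by rewrite /A fconjE; congr (fact _ _ (fpar (fmode _ _ _))); lia.
Qed.

(** Only modes psi(i), phi(j) with i, j >= 0 occur, and these anticommute. *)
Lemma rprod_comm psi phi m n a :
  rprod psi m (rprod phi n a) = - rprod phi n (rprod psi m a).
Proof.
apply: field_eq => k u; rewrite fmodeN.
pose A psi phi (m n : int) (i j : nat) :=
  fmode a (k + m + n - (i + j)%N%:Z) (fact phi j%:Z (fact psi i%:Z u)).
have Af psi' phi' m' n' : fin2 (A psi' phi' m' n').
  apply: fin2_of => [|i]; last by apply: (rprod_fin phi' (fun j => k + m' + n' - (i + j)%N%:Z)).
  by have [N uN] := fact_fin psi' u; exists N => i j /uN; rewrite /A => ->; rewrite !linear0.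
have E psi' phi' m' n' : fmode (rprod psi' m' (rprod phi' n' a)) k u =
    - isum (fun i => isum (fun j => (sbin m' i * sbin n' j) *: A psi' phi' m' n' i j)).
  rewrite rprodE -isumN; last by apply: fin2_isum; exact: fin2Z.
  apply: eq_isum => i; rewrite fconjE rprodE isum_lin; last exact: rprod_fin.
  rewrite -isumN; last by apply: finZ; exact: fin2_row.
  rewrite -isumZ; last first.
    by apply: finZ; apply: fin_le (fact_fin phi' (fpar (fact psi' i%:Z u))) => j ->; rewrite !linear0.
  apply: eq_isum => j; rewrite fconjE fparK fpar_fact fparK linearN !scalerN scalerA /A.
  by congr (- (_ *: fmode _ _ _)); lia.
rewrite !E opprK; apply/eqP; rewrite eq_sym -addr_eq0 addrC; apply/eqP.
rewrite [X in _ + X]isum_exch; last exact: fin2Z.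
rewrite -isumD; try by [apply: fin2_isum; apply: fin2Z | apply/fin2_isum/fin2_tr/fin2Z].
rewrite -[RHS](isum0 M); apply: eq_isum => i.
rewrite -isumD; last 2 first.
- by apply: finZ; exact: fin2_row.
- by apply: (finZ (fun j => sbin n j * sbin m i)); apply: (fin2_row i (fin2_tr _)).
rewrite -[RHS](isum0 M); apply: eq_isum => j.
rewrite [sbin n j * _]mulrC -scalerDr /A [(j + i)%N]addnC.
rewrite [k + n + m]addrAC -linearD fact_comm.
case: eqP => [ij|_]; last by rewrite mulr0 scale0r linear0 scaler0.
have -> : j = 0%N by lia.
by rewrite mulr0z !mul0r scale0r linear0 scaler0.
Qed.

(** The m-th product of the field psi(z) with a(z). By nprod_comm these products
    make the fields on M a module over A. *)
Definition nprod psi m a : field M := lprod psi m a - (-1) ^ m *: rprod psi m a.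

(** Expanding an anticommutator of differences: the mixed terms cancel because
    left and right parts anticommute, the right-right terms because the right
    parts do. *)
Lemma combine_comm (V : lmodType K) (s t : K) (ll ll' lr lr' rl rl' rr rr' : V) :
  lr = - rl' -> lr' = - rl -> rr = - rr' ->
  (ll - t *: lr - s *: (rl - t *: rr)) + (ll' - s *: lr' - t *: (rl' - s *: rr')) =
  ll + ll'.
Proof.
move=> -> -> ->; rewrite !scalerBr !scalerN !scalerA [t * s]mulrC !opprB !opprK.
move: (t *: rl') (s *: rl) ((s * t) *: rr') => p q r.
rewrite -!addrA [ll' + _]addrCA addKr [ll' + _]addrCA addKr [p + _]addrC subrK //.
Qed.

Lemma combine_lin (V : lmodType K) (c s : K) (x y z w : V) :
  c *: x + y - s *: (c *: z + w) = c *: (x - s *: z) + (y - s *: w).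
Proof. by rewrite scalerDr scalerBr !scalerA [s * c]mulrC opprD addrACA. Qed.

Fact nprod_lin psi m : linear (nprod psi m).
Proof. by move=> c a b; rewrite /nprod (linearP (lprod psi m)) (linearP (rprod psi m)) combine_lin. Qed.
HB.instance Definition _ psi m := GRing.isLinear.Build K (field M) (field M) *:%R
  (nprod psi m) (nprod_lin psi m).

Fact nprod_linl c psi phi m a :
  nprod (c *: psi + phi) m a = c *: nprod psi m a + nprod phi m a.
Proof. by rewrite /nprod lprod_linl rprod_linl combine_lin. Qed.

Fact nprod_comm psi phi m n a :
  nprod psi m (nprod phi n a) + nprod phi n (nprod psi m a) =
  (m%:~R * form psi phi * (m + n == 0)%:R) *: a.
Proof.
have LB psi' m' x y s : lprod psi' m' (x - s *: y) = lprod psi' m' x - s *: lprod psi' m' y.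
  by rewrite raddfB /=; congr (_ - _); exact: linearZ.
have RB psi' m' x y s : rprod psi' m' (x - s *: y) = rprod psi' m' x - s *: rprod psi' m' y.
  by rewrite raddfB /=; congr (_ - _); exact: linearZ.
rewrite -lprod_comm /nprod !LB !RB.
by apply: combine_comm; [exact: lrprod_comm | exact: lrprod_comm | exact: rprod_comm].
Qed.

(** The two expansions of (x - z)^m meet in this case, and binz_delta evaluates
    their difference, which is zero for m >= 0: the identity field is a vacuum
    vector. *)
Lemma nprod_id psi m k u : fmode (nprod psi m (idfield M)) k u =
  (- ((-1) ^ m * binZ K k (- m - 1))) *: fact psi (k + m + 1) u.
Proof.
rewrite /nprod fmodeD fmodeN fmodeZ lprodE rprodE.
have -> : isum (fun i => sbin m i *: fact psi (m - i%:Z) (fmode (idfield M) (k + i%:Z) u)) =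
    sbinZ K m (- (k + 1)) *: fact psi (k + m + 1) u.
  rewrite -(@isum_sbin_pick _ _ m (- (k + 1)) (fun i => k + i%:Z == -1)
     (fun _ => fact psi (k + m + 1) u)) => [|i]; last by lia.
  apply: eq_isum => i; rewrite mkfieldE; case: eqP => [ki|_]; last by rewrite linear0.
  by congr (_ *: fact psi _ u); lia.
have -> : isum (fun i => sbin m i *: fmode (fconj (idfield M)) (k + m - i%:Z) (fact psi i%:Z u)) =
    sbinZ K m (k + 1 + m) *: fact psi (k + m + 1) u.
  rewrite (_ : k + m + 1 = k + 1 + m); last by lia.
  apply: etrans (@isum_sbin_pick _ _ m (k + 1 + m) (fun i => k + m - i%:Z == -1)
     (fun i => fact psi i u) _) => [|i]; last by lia.
  by apply: eq_isum => i; rewrite fconjE mkfieldE; case: eqP; rewrite ?linear0 ?fparK.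
rewrite scalerA -scalerBl; congr (_ *: _).
have := binz_delta K m (k + 1); rewrite addrK => <-.
by rewrite mulrBr mulrA signzM mul1r opprB.
Qed.

Lemma nprod_vac psi m : 0 <= m -> nprod psi m (idfield M) = 0.
Proof.
move=> m0; apply: field_eq => k u; rewrite nprod_id fmode0 binZ_neg ?mulr0 ?oppr0 ?scale0r //.
lia.
Qed.

End Products.

(** * States as fields and the commutator formula *)

Section FermionicModuleSF.
Variables (K : numFieldType) (h : lmodType K) (form : h -> h -> K).
Local Notation SF := (SF form).
Local Notation act psi m := (lact (gen form psi m)).

HB.instance Definition _ (a : algA form) :=
  GRing.isLinear.Build K SF SF *:%R (lact a) (lact_lin a).

(** The parity of SF, obtained from the universal property by changing the sign
    of every mode. *)
Definition SFpar : SF -> SF := SF_lift (fun psi m v => - act psi m v) (SFvac form).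

Let g_lin psi m (c : K) (u v : SF) :
  - act psi m (c *: u + v) = c *: (- act psi m u) + - act psi m v.
Proof. by rewrite linearP opprD scalerN. Qed.
Let g_linl (c : K) psi phi m (u : SF) :
  - act (c *: psi + phi) m u = c *: (- act psi m u) + - act phi m u.
Proof. by rewrite act_linl opprD scalerN. Qed.
Let g_comm psi phi m n (u : SF) :
  - act psi m (- act phi n u) + - act phi n (- act psi m u) =
  (m%:~R * form psi phi * (m + n == 0)%:R) *: u.
Proof. by rewrite !linearN !opprK act_comm. Qed.
Let g_vac psi m : 0 <= m -> - act psi m (SFvac form) = 0.
Proof. by move=> m0; rewrite act_vac ?oppr0. Qed.

Fact SFpar_lin : linear SFpar.
Proof. by move=> c u v; exact: (SF_lift_lin g_lin g_linl g_comm g_vac). Qed.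
HB.instance Definition _ := GRing.isLinear.Build K SF SF *:%R SFpar SFpar_lin.

Lemma SFpar_vac : SFpar (SFvac form) = SFvac form.
Proof. exact: (SF_lift_vac g_lin g_linl g_comm g_vac). Qed.

Lemma SFpar_act psi m v : SFpar (act psi m v) = - act psi m (SFpar v).
Proof. exact: (SF_lift_act g_lin g_linl g_comm g_vac). Qed.

Lemma SFparK : involutive SFpar.
Proof.
apply: SF_word_ind => [c u v IHu IHv||psi m v IH]; rewrite ?SFpar_vac //.
  by rewrite !linearP /= IHu IHv.
by rewrite SFpar_act linearN /= SFpar_act opprK IH.
Qed.

(** Truncation on SF: moving psi(i) past one mode phi(m) costs a scalar that is
    nonzero for at most one i. *)
Lemma SFact_fin psi (v : SF) : fin (fun i => act psi i%:Z v).
Proof.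
elim/SF_word_ind: v => [c u v IHu IHv||phi m v IH].
- rewrite (_ : (fun i => _) = fun i : nat => c *: act psi i u + act psi i v); last first.
    by apply: funext => i; rewrite linearP.
  by apply: finD => //; exact: (finZ (fun=> c)).
- by exists 0%N => i _; rewrite act_vac.
- rewrite (_ : (fun i => _) = fun i : nat => - act phi m (act psi i v) +
      (if i%:Z + m == 0 then (i%:Z%:~R * form psi phi) *: v else 0)); last first.
    apply: funext => i; apply/eqP; rewrite eq_sym addrC subr_eq eq_sym act_comm; apply/eqP.
    by case: eqP => _; rewrite ?mulr1 // mulr0 scale0r.
  apply: finD; first by apply: finN; apply: fin_le IH => i ->; rewrite linear0.
  by apply: (fin_pick (z := - m)) => j; lia.
Qed.

Definition SFmod : ferm_module form :=
  @FermModule K h form SF (fun psi m => [the {linear SF -> SF} of act psi m])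
   [the {linear SF -> SF} of SFpar]
   (@act_linl _ _ form) (@act_comm _ _ form) SFact_fin SFparK SFpar_act.

End FermionicModuleSF.

Section StateField.
Variables (K : numFieldType) (h : lmodType K) (form : h -> h -> K).
Local Notation SF := (SF form).
Local Notation act psi m := (lact (gen form psi m)).
Variable M : ferm_module form.
Implicit Types (v w : SF) (u : M) (a : field M) (psi phi : h).

(** The homomorphism of A-modules from SF to the fields on M that sends the
    vacuum to the identity field. *)
Definition Y : SF -> field M := SF_lift (@nprod _ _ _ M) (idfield M).

Fact Y_lin : linear Y.
Proof.
move=> c u v; apply: SF_lift_lin; first by move=> psi m b x y; exact: linearP.
- exact: nprod_linl.
- exact: nprod_comm.
- exact: nprod_vac.
Qed.
HB.instance Definition _ := GRing.isLinear.Build K SF (field M) *:%R Y Y_lin.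

Lemma Y_vac : Y (SFvac form) = idfield M.
Proof.
apply: SF_lift_vac; first by move=> psi m b x y; exact: linearP.
- exact: nprod_linl.
- exact: nprod_comm.
- exact: nprod_vac.
Qed.

Lemma Y_act psi m v : Y (act psi m v) = nprod psi m (Y v).
Proof.
apply: SF_lift_act; first by move=> ? ? b x y; exact: linearP.
- exact: nprod_linl.
- exact: nprod_comm.
- exact: nprod_vac.
Qed.

Lemma Y_gen psi m u : fmode (Y (act psi (-1) (SFvac form))) m u = fact psi m u.
Proof.
rewrite Y_act Y_vac nprod_id (_ : - -1 - 1 = 0%N%:Z) // /= binz0 mulr1.
by rewrite exprN1 invrN1 opprK scale1r; congr (fact _ _ u); lia.
Qed.

Lemma fconj_id : fconj (idfield M) = idfield M.
Proof.
by apply: field_eq => n u; rewrite fconjE mkfieldE; case: ifP; rewrite ?fparK ?linear0.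
Qed.

Lemma fconj_nprod psi m a : fconj (nprod psi m a) = - nprod psi m (fconj a).
Proof.
rewrite /nprod linearB linearZ /=.
suff [-> ->] : fconj (lprod psi m a) = - lprod psi m (fconj a) /\
               fconj (rprod psi m a) = - rprod psi m (fconj a).
  by rewrite scalerN opprD.
split; apply: field_eq => n u; rewrite fconjE fmodeN.
- rewrite !lprodE isum_lin; last exact: lprod_fin.
  rewrite -isumN; last by apply: finZ; exact: lprod_fin.
  by apply: eq_isum => i; rewrite fpar_fact scalerN.
- rewrite !rprodE isum_lin; last exact: rprod_fin.
  rewrite -isumN; last by apply: finZ; exact: rprod_fin.
  apply: eq_isum => i; rewrite act_fpar linearN /= linearN scalerN.
  by rewrite -fconjE.
Qed.

Lemma fconj_Y v : fconj (Y v) = Y (SFpar v).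
Proof.
elim/SF_word_ind: v => [c v w IHv IHw||psi m v IH].
- by rewrite !linearP /= IHv IHw.
- by rewrite SFpar_vac Y_vac fconj_id.
- by rewrite SFpar_act linearN /= !Y_act fconj_nprod IH.
Qed.

Lemma fpar_Y v n u : fpar (fmode (Y v) n u) = fmode (Y (SFpar v)) n (fpar u).
Proof. by rewrite -fconj_Y fconjE fparK. Qed.

Lemma Yact_fin psi v (f : nat -> int) u :
  fin (fun j => fmode (Y (act psi j%:Z v)) (f j) u).
Proof. by have [N vN] := SFact_fin psi v; exists N => j /vN ->; rewrite linear0. Qed.

Section Commutator.
Variables (psi : h) (m : int).

Fact commf_is_field a : is_field
  (fun k u => fact psi m (fmode a k u) - fmode (fconj a) k (fact psi m u)).
Proof.
split=> [n c u v|u].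
  rewrite (linearP (fmode a n)) !(linearP (fact psi m)) (linearP (fmode _ n)) /=.
  by rewrite opprD addrACA -scalerBr.
have F1 := fmode_fin a 0 u; have F2 := fmode_fin (fconj a) 0 (fact psi m u).
apply: finD; [apply: fin_le F1 | apply: finN; apply: fin_le F2] => i; rewrite add0r //.
by move=> ->; rewrite linear0.
Qed.
(** The supercommutator of psi(m) with a field. *)
Definition commf a := mkfield (commf_is_field a).

Lemma commfE a k u : fmode (commf a) k u =
  fact psi m (fmode a k u) - fmode (fconj a) k (fact psi m u).
Proof. by []. Qed.

Fact commf_lin : linear commf.
Proof.
move=> c a b; apply: field_eq => k u; rewrite !(fmodeD, fmodeZ, commfE) (linearP (@fconj _ _ _ M)).
by rewrite linearP !(fmodeD, fmodeZ) /= opprD addrACA -scalerBr.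
Qed.
HB.instance Definition _ := GRing.isLinear.Build K (field M) (field M) *:%R commf commf_lin.

Lemma fpar_fconj phi n k a u :
  fpar (fmode (fconj a) k (fact phi n (fpar u))) = - fmode a k (fact phi n u).
Proof. by rewrite fconjE fparK fpar_fact fparK linearN. Qed.

Lemma fconj_commf a k u :
  fmode (fconj (commf a)) k u = fmode a k (fact psi m u) - fact psi m (fmode (fconj a) k u).
Proof.
rewrite fconjE commfE (linearB fpar) /= fpar_fconj fpar_fact opprK addrC.
by congr (_ - _).
Qed.

(** In lprod and rprod alike, the commutator passes inside at the cost of one
    term where psi and phi are paired; binz_delta adds up the two costs. *)
Lemma commf_nprod phi n a k u : fmode (commf (nprod phi n a)) k u =
  - fmode (nprod phi n (commf a)) k u +
  (m%:~R * form psi phi * binZ K (m - 1) (- n - 1)) *: fmode a (k + m + n) u.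
Proof.
have HL : fmode (commf (lprod phi n a)) k u = - fmode (lprod phi n (commf a)) k u +
    (m%:~R * form psi phi * sbinZ K n (m + n)) *: fmode a (k + m + n) u.
  rewrite commfE fconjE !lprodE (isum_lin (fact psi m)) ?(isum_lin fpar); try exact: lprod_fin.
  have -> : (m%:~R * form psi phi * sbinZ K n (m + n)) *: fmode a (k + m + n) u =
      isum (fun i => sbin K n i *: (if m + (n - i%:Z) == 0
        then (m%:~R * form psi phi) *: fmode a (k + i%:Z) u else 0)).
    rewrite (@isum_sbin_pick _ _ n (m + n) _ (fun z => (m%:~R * form psi phi) *: fmode a (k + z) u)).
      by rewrite scalerA [sbinZ _ _ _ * _]mulrC addrA.
    by move=> i; lia.
  apply: isum_balance => [||||i].
  - by apply: finZ; apply: fin_le (lprod_fin phi n a k u) => i ->; rewrite linear0.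
  - by apply: finZ; apply: fin_le (lprod_fin phi n a k (fpar (fact psi m u))) => i ->; rewrite linear0.
  - by apply: finZ; exact: lprod_fin.
  - by apply: finZ; apply: (fin_pick (z := m + n)) => i; lia.
  rewrite -scalerBr -scalerN -scalerDr; congr (_ *: _).
  rewrite commfE fconjE linearB /= fpar_fact opprK opprB -addrA addrC; congr (_ + _).
  apply/eqP; rewrite addrC -subr_eq opprK fact_comm; apply/eqP.
  by case: eqP => _; rewrite ?mulr1 // mulr0 scale0r.
have HR : fmode (commf (rprod phi n a)) k u = - fmode (rprod phi n (commf a)) k u +
    (m%:~R * form psi phi * sbinZ K n (- m)) *: fmode a (k + m + n) u.
  rewrite commfE fconjE !rprodE (isum_lin (fact psi m)) ?(isum_lin fpar); try exact: rprod_fin.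
  have -> : (m%:~R * form psi phi * sbinZ K n (- m)) *: fmode a (k + m + n) u =
      isum (fun i => sbin K n i *: (if m + i%:Z == 0
        then (m%:~R * form psi phi) *: fmode a (k + n - i%:Z) u else 0)).
    rewrite (@isum_sbin_pick _ _ n (- m) _ (fun z => (m%:~R * form psi phi) *: fmode a (k + n - z) u)).
      rewrite scalerA [sbinZ _ _ _ * _]mulrC; congr (_ *: fmode _ _ _); lia.
    by move=> i; lia.
  apply: isum_balance => [||||i].
  - by apply: finZ; apply: fin_le (rprod_fin phi (fun i => k + n - i%:Z) (fconj a) u) => i ->; rewrite linear0.
  - by apply: finZ; apply: fin_le (rprod_fin phi (fun i => k + n - i%:Z) (fconj a) (fpar (fact psi m u))) => i ->; rewrite linear0.
  - by apply: finZ; exact: rprod_fin.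
  - by apply: finZ; apply: (fin_pick (z := - m)) => i; lia.
  rewrite -scalerBr -scalerN -scalerDr; congr (_ *: _).
  rewrite fconj_commf fpar_fconj opprK opprB -[RHS]addrA; congr (_ + _).
  have := congr1 (fmode a (k + n - i%:Z)) (fact_comm psi phi m i%:Z u).
  rewrite linearD /= => /(canRL (addKr _)) ->; congr (_ + _).
  case: eqP => [mi|_] /=; last by rewrite mulr0 scale0r linear0.
  by rewrite mulr1 linearZ.
have -> : commf (nprod phi n a) = commf (lprod phi n a) - (-1) ^ n *: commf (rprod phi n a).
  by rewrite /nprod raddfB /=; congr (_ - _); exact: linearZ.
rewrite /nprod !(fmodeD, fmodeN, fmodeZ) HL HR scalerDr scalerN scalerA !opprD !opprK.
rewrite addrACA; congr (_ + _); rewrite -scalerBl; congr (_ *: _).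
by rewrite -binz_delta; ring.
Qed.

End Commutator.

(** The commutator formula: moving psi(m) through a mode of Y(v) produces only
    the products psi(j)v with j >= 0. The proof is by induction on the word v:
    the pairing of psi(m) with the first letter phi(n0) found in commf_nprod is
    the same as the one in psi(j) phi(n0) v with j = - n0. *)
Lemma Y_comm v psi m n u :
  fact psi m (fmode (Y v) n u) = fmode (fconj (Y v)) n (fact psi m u) +
  isum (fun j => binz K m j *: fmode (Y (act psi j%:Z v)) (m + n - j%:Z) u).
Proof.
apply/eqP; rewrite addrC -subr_eq -commfE; apply/eqP.
elim/SF_word_ind: v n u => [c v w IHv IHw|n u|phi n0 v IH n u].
- move=> n u; rewrite 2!linearP fmodeD fmodeZ IHv IHw -isumZ -?isumD.
  + by apply: eq_isum => j; rewrite !linearP.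
  + by apply: (finZ (fun=> c)); apply: finZ; exact: Yact_fin.
  + by apply: finZ; exact: Yact_fin.
  + by apply: finZ; exact: Yact_fin.
- rewrite (_ : (fun _ => _) = fun=> 0) ?isum0; last first.
    by apply: funext => j; rewrite act_vac // linear0 fmode0 scaler0.
  rewrite Y_vac commfE fconj_id !mkfieldE /=; case: ifP => _; by [rewrite subrr | rewrite oppr0 addr0 linear0].
- rewrite Y_act commf_nprod.
  (* The term j = - n0 carries the pairing of psi with phi. *)
  have Ej j : fmode (Y (act psi j%:Z (act phi n0 v))) (m + n - j%:Z) u =
     - fmode (nprod phi n0 (Y (act psi j%:Z v))) (m + n - j%:Z) u +
     (if j%:Z + n0 == 0 then (j%:Z%:~R * form psi phi) *: fmode (Y v) (m + n - j%:Z) u else 0).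
    have /(canRL (addrK _)) -> := act_comm psi phi j n0 v.
    rewrite (linearB Y) fmodeD fmodeN [LHS]addrC; congr (_ + _); first by rewrite -Y_act.
    case: eqP => _; last by rewrite mulr0 scale0r linear0.
    by rewrite mulr1 linearZ.
  under eq_isum do rewrite Ej scalerDr scalerN.
  have FL : fin2 (fun j i => fact phi (n0 - i%:Z)
      (fmode (Y (act psi j%:Z v)) (m + (n + i%:Z) - j%:Z) u)).
    apply: fin2_of => [|j].
      have [N vN] := SFact_fin psi v; exists N => j i /vN ->.
      by rewrite linear0 fmode0 linear0.
    apply: fin_le (lprod_fin phi n0 (Y (act psi j%:Z v)) (m + n - j%:Z) u) => i.
    by rewrite (_ : m + (n + i%:Z) - j%:Z = m + n - j%:Z + i%:Z) //; lia.
  have FR : fin2 (fun j i => fmode (fconj (Y (act psi j%:Z v)))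
      (m + (n + n0 - i%:Z) - j%:Z) (fact phi i%:Z u)).
    apply: fin2_of => [|j]; last exact: rprod_fin.
    have [N vN] := SFact_fin psi v; exists N => j i /vN ->.
    by rewrite linear0 linear0.
  have EL : fmode (lprod phi n0 (commf psi m (Y v))) n u =
     isum (fun j => binz K m j *: fmode (lprod phi n0 (Y (act psi j%:Z v))) (m + n - j%:Z) u).
    rewrite lprodE.
    transitivity (isum (fun i => isum (fun j => (binz K m j * sbin K n0 i) *:
       fact phi (n0 - i%:Z) (fmode (Y (act psi j%:Z v)) (m + (n + i%:Z) - j%:Z) u)))).
      apply: eq_isum => i; rewrite IH isum_lin; last exact: Yact_fin.
      rewrite -isumZ; last by apply: finZ; exact: (fin2_col i FL).
      by apply: eq_isum => j; rewrite scalerA mulrC.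
    rewrite isum_exch; last by apply: fin2Z; apply: fin2_tr.
    apply: eq_isum => j; rewrite lprodE -isumZ; last by apply: finZ; exact: lprod_fin.
    apply: eq_isum => i; rewrite scalerA; congr (_ *: fact _ _ (fmode _ _ _)); lia.
  have ER : fmode (rprod phi n0 (commf psi m (Y v))) n u =
     isum (fun j => binz K m j *: fmode (rprod phi n0 (Y (act psi j%:Z v))) (m + n - j%:Z) u).
    rewrite rprodE.
    transitivity (isum (fun i => isum (fun j => (binz K m j * sbin K n0 i) *:
       fmode (fconj (Y (act psi j%:Z v))) (m + (n + n0 - i%:Z) - j%:Z) (fact phi i%:Z u)))).
      apply: eq_isum => i; rewrite fconjE IH isum_lin; last exact: Yact_fin.
      rewrite -isumZ; last by apply: finZ; exact: (fin2_col i FR).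
      by apply: eq_isum => j; rewrite scalerA mulrC fconjE.
    rewrite isum_exch; last by apply: fin2Z; apply: fin2_tr.
    apply: eq_isum => j; rewrite rprodE -isumZ; last by apply: finZ; exact: rprod_fin.
    apply: eq_isum => i; rewrite scalerA; congr (_ *: fmode _ _ _); lia.
  rewrite isumD; last 2 first.
  - apply: finN; apply: finZ; have [N vN] := SFact_fin psi v; exists N => j /vN ->.
    by rewrite !linear0 fmode0.
  - by apply: finZ; apply: (fin_pick (z := - n0)) => j; lia.
  rewrite isumN; last first.
    apply: finZ; have [N vN] := SFact_fin psi v; exists N => j /vN ->.
    by rewrite !linear0 fmode0.
  congr (- _ + _).
    rewrite /nprod fmodeD fmodeN fmodeZ EL ER.
    have FLj : fin (fun j => fmode (lprod phi n0 (Y (act psi j%:Z v))) (m + n - j%:Z) u).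
      have [N vN] := SFact_fin psi v; exists N => j /vN ->.
      by rewrite !linear0 fmode0.
    have FRj : fin (fun j => fmode (rprod phi n0 (Y (act psi j%:Z v))) (m + n - j%:Z) u).
      have [N vN] := SFact_fin psi v; exists N => j /vN ->.
      by rewrite !linear0 fmode0.
    rewrite -isumZ -?isumB; do ?[exact: finZ | apply: (finZ (fun=> _)); exact: finZ].
    apply: eq_isum => j; rewrite fmodeD fmodeN fmodeZ scalerBr !scalerA.
    by rewrite [_ * binz _ _ _]mulrC.
  rewrite (@isum_binz_pick _ _ m (- n0) _
    (fun z => (z%:~R * form psi phi) *: fmode (Y v) (m + n - z) u)); last by move=> j; lia.
  rewrite scalerA mulrA [binZ _ _ _ * _]mulrC binZ_absorb opprK [m + n]addrC.
  by rewrite mulrAC.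
Qed.

End StateField.

(** The products of fields are natural in the module. The scalar s allows maps
    that reverse the parity, such as the projection of an extension onto its
    parity-shifted quotient. *)
Lemma Y_intertwine (K : numFieldType) (h : lmodType K) (form : h -> h -> K)
    (M M' : ferm_module form) (theta : {linear M -> M'}) (s : K) :
  s * s = 1 -> (forall psi m u, theta (fact psi m u) = fact psi m (theta u)) ->
  (forall u, theta (fpar u) = s *: fpar (theta u)) ->
  forall v n u, theta (fmode (Y M v) n u) = fmode (Y M' v) n (theta u).
Proof.
move=> ss tact tpar v; elim/SF_word_ind: v => [c v w IHv IHw||psi m v IH] n u.
- by rewrite (linearP (Y M)) (linearP (Y M')) !(fmodeD, fmodeZ) (linearP theta) /= IHv IHw.
- by rewrite !Y_vac !mkfieldE; case: ifP => _; rewrite ?linear0.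
rewrite 2!Y_act /nprod 2!fmodeD 2!fmodeN 2!fmodeZ 2!lprodE 2!rprodE.
rewrite linearB linearZ /= !(isum_lin theta); last 2 first.
- exact: (rprod_fin psi (fun i => n + m - i%:Z) (fconj (Y M v)) u).
- exact: lprod_fin.
congr (_ - _ *: _); apply: eq_isum => i; first by rewrite tact IH.
congr (_ *: _); rewrite tpar IH tpar (linearZ_LR (fmode (Y M' v) _)) (linearZ_LR fpar) /=.
by rewrite scalerA ss scale1r tact.
Qed.

(** * The Borcherds identity *)

Section Borcherds.
Variables (K : numFieldType) (h : lmodType K) (form : h -> h -> K).
Local Notation SF := (SF form).
Local Notation act psi m := (lact (gen form psi m)).
Variable M : ferm_module form.
Local Notation YV := (Y (SFmod form)).
Local Notation YM := (Y M).
Local Notation sbin := (sbin K).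
Local Notation binz := (binz K).
Implicit Types (b : SF) (u v : M) (p q r : int).

(** Linear as a function of the state, for use under sums over states. *)
Definition state_mode (n : int) (u : M) (w : SF) : M := fmode (YM w) n u.

Fact state_mode_lin n u : linear (state_mode n u).
Proof. by move=> c v w; rewrite /state_mode linearP fmodeD fmodeZ. Qed.
HB.instance Definition _ n u := GRing.isLinear.Build K SF M *:%R
  (state_mode n u) (state_mode_lin n u).

(** The left-hand side of the Borcherds identity. *)
Definition bor_l (a : SF) p q r b u : M :=
  isum (fun i => binz p i *: state_mode (p + q - i%:Z) u (fmode (YV a) (r + i%:Z) b)).

(** The two halves of the right-hand side, for arbitrary fields. *)
Definition bor_r1 (A B : field M) p q r u : M :=
  isum (fun i => sbin r i *: fmode A (p + r - i%:Z) (fmode B (q + i%:Z) u)).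

Definition bor_r2 (A B : field M) p q r u : M :=
  isum (fun i => sbin r i *: fmode B (q + r - i%:Z) (fmode A (p + i%:Z) u)).

Lemma bor_r1_fin (A B : field M) (f : nat -> int) q u :
  fin (fun i => fmode A (f i) (fmode B (q + i%:Z) u)).
Proof. by apply: fin_le (fmode_fin B q u) => i ->; rewrite linear0. Qed.

Definition twist (e : bool) (B : field M) : field M := if e then fconj B else B.

(** The right-hand side for a state a of parity e. The sign of exchanging a with
    b is -1 to the product of the parities, which is what the twist of Y(b) by e
    accounts for, without b being homogeneous. *)
Definition bor_r e (a : SF) p q r b u : M :=
  bor_r1 (YM a) (YM b) p q r u - (-1) ^ r *: bor_r2 (YM a) (twist e (YM b)) p q r u.

(** How either side of the identity for psi(n)a depends on the same side for a.
    The three sums are psi(n-k) applied to the left, psi(k) applied to u, and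
    psi(j) applied to b. *)
Definition bor_step e psi n (X : int -> int -> int -> SF -> M -> M) p q r b u : M :=
  isum (fun k => sbin n k *: fact psi (n - k%:Z) (X (p + k%:Z) q r b u))
  - (-1) ^ n *: isum (fun k => sbin n k *: fpar (X (p + n - k%:Z) q r b (fpar (fact psi k%:Z u))))
  - ((-1) ^ n * (-1) ^+ e) *: isum (fun j => sbin n j *: X p q (r + n - j%:Z) (act psi j%:Z b) u).

Section Step.
Variables (psi : h) (n : int) (e : bool) (a : SF).
Hypothesis parV : fconj (YV a) = (-1) ^+ e *: YV a.
Hypothesis parM : fconj (YM a) = (-1) ^+ e *: YM a.

Let afin r b : fin (fun i => fmode (YV a) (r + i%:Z) b).
Proof. exact: fmode_fin. Qed.

(** Expanding psi(n)a in SF leaves psi inside Y(psi(n-j) a_(t) b), which nprod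
    expands once more. Exchanging binomials turns both expansions into sums to
    which Vandermonde applies, and the result has the form bor_step. *)
Lemma bor_l_step p q r b u :
  bor_l (act psi n a) p q r b u = bor_step e psi n (bor_l a) p q r b u.
Proof.
pose al t := fmode (YV a) (r + t%:Z) b.
have alf : fin al by exact: afin.
pose be j t := fmode (YV a) (r + n - j%:Z + t%:Z) (act psi j%:Z b).
have bef : fin2 be.
  apply: fin2_of => [|j]; last exact: afin.
  by have [N bN] := SFact_fin psi b; exists N => j t /bN; rewrite /be => ->; rewrite linear0.
have E1 i : fmode (YV (act psi n a)) (r + i%:Z) b =
    isum (fun j => sbin n j *: act psi (n - j%:Z) (al (i + j)%N)) -
    ((-1) ^ n * (-1) ^+ e) *: isum (fun j => sbin n j *: be j i).
  rewrite Y_act /nprod fmodeD fmodeN fmodeZ lprodE rprodE -scalerA; congr (_ - _ *: _).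
    by apply: eq_isum => j; rewrite /al PoszD addrA.
  rewrite -isumZ; last by apply: finZ; exact: (fin2_col i bef).
  apply: eq_isum => j; rewrite parV fmodeZ /be scaler_swap.
  by congr (_ *: (_ *: fmode _ _ _)); lia.
pose T1 i := isum (fun j => sbin n j *: state_mode (p + q - i%:Z) u (act psi (n - j%:Z) (al (i + j)%N))).
pose T2 i := isum (fun j => sbin n j *: state_mode (p + q - i%:Z) u (be j i)).
have alij i : fin (fun j => act psi (n - j%:Z) (al (i + j)%N)).
  have [N aN] := alf; exists N => j Nj; rewrite aN ?linear0 //; lia.
have E2 i : state_mode (p + q - i%:Z) u (fmode (YV (act psi n a)) (r + i%:Z) b) =
    T1 i - ((-1) ^ n * (-1) ^+ e) *: T2 i.
  rewrite E1 linearB linearZ /= !(isum_lin (state_mode _ _)) //.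
  exact: (fin2_col i bef).
have T2f : fin2 (fun i j => state_mode (p + q - i%:Z) u (be j i)).
  by apply: fin2_le (fin2_tr bef) => i j ->; rewrite linear0.
have T1f : fin T1.
  have [N aN] := alf; exists N => i Ni; rewrite /T1 (_ : (fun _ => _) = fun=> 0) ?isum0 //.
  by apply: funext => j; rewrite aN ?linear0 ?scaler0 //; lia.
rewrite /bor_l; under eq_isum do rewrite E2 scalerBr.
rewrite isumB; last 2 first.
- exact: finZ.
- apply: finZ; apply: (finZ (fun=> _)); apply: fin2_isum; exact: (fin2Z (fun _ j => sbin n j)).
under [X in _ - X]eq_isum do rewrite scaler_swap.
rewrite [X in _ - X]isumZ; last first.
  by apply: finZ; apply: fin2_isum; exact: (fin2Z (fun _ j => sbin n j)).
rewrite /bor_step; congr (_ - _ *: _); last first.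
  by rewrite isum_exchZ.
pose G i k j := state_mode (p + q - i%:Z + (k%:Z - j%:Z)) u (al (i + j)%N).
have Gf i : fin2 (fun k j => if (j <= k)%N then G i k j else 0).
  apply: fin2_ofr => [|j].
    have [N aN] := alf; exists N => k j Nj; rewrite /G aN ?linear0; last by lia.
    by case: ifP.
  apply: fin_le (fmode_fin (YM (al (i + j)%N)) (p + q - i%:Z - j%:Z) u) => k E.
  rewrite /G /state_mode -[RHS]E; case: ifP => _; last by rewrite E.
  by congr (fmode _ _ _); lia.
pose F i k := isum (fun j => binz k%:Z j *: G i k j).
have Ff : fin2 F.
  apply: fin2_of => [|i]; last by apply: fin2_isum; exact: fin2_triangle.
  have [N aN] := alf; exists N => i k Ni; rewrite /F (_ : (fun _ => _) = fun=> 0) ?isum0 //.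
  by apply: funext => j; rewrite /G aN ?linear0 ?scaler0 //; lia.
pose H i l j := fpar (state_mode (p + q + n - (i + j)%N%:Z - l%:Z)
   (fpar (fact psi l%:Z u)) (al (i + j)%N)).
have Hf i : fin2 (H i).
  apply: fin2_of => [|l].
    by have [N uN] := fact_fin psi u; exists N => l j /uN; rewrite /H /state_mode => ->; rewrite !linear0.
  by have [N aN] := alf; exists N => j Nj; rewrite /H aN ?linear0 //; lia.
(* The summation indices of the second expansion are rearranged here so that
   the indices i and j occur only through i + j, as Vandermonde requires. *)
have ET i : T1 i = isum (fun k => sbin n k *: fact psi (n - k%:Z) (F i k)) -
    (-1) ^ n *: isum (fun l => sbin n l *: isum (fun j => binz (n - l%:Z) j *: H i l j)).
  rewrite isum_triCZ //.
  have -> : isum (fun k => sbin n k *: fact psi (n - k%:Z) (F i k)) =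
     isum (fun j => sbin n j *: isum (fun l => sbin (n - j%:Z) l *:
        fact psi (n - (j + l)%N%:Z) (G i (j + l)%N j))).
    rewrite -(isum_triZ _ (G := fun k j => fact psi (n - k%:Z) (G i k j))).
      apply: eq_isum => k; rewrite /F isum_lin //.
      by have [N aN] := alf; exists N => j Nj; rewrite /G aN ?linear0 //; lia.
    by apply: fin2_le (Gf i) => k j; case: ifP => // _ ->; rewrite linear0.
  have fin_al (X : nat -> M) : (forall j, al (i + j)%N = 0 -> X j = 0) -> fin X.
    by have [N aN] := alf => HX; exists N => j Nj; apply/HX/aN; lia.
  rewrite -isumZ; last first.
    apply: fin_al => j aj; rewrite /H aj; under eq_isum do rewrite !linear0.
    by rewrite isum0 !scaler0.
  rewrite -isumB; last 2 first.
  - apply: fin_al => j aj; rewrite /G aj; under eq_isum do rewrite !linear0.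
    by rewrite isum0 !scaler0.
  - apply: fin_al => j aj; rewrite /H aj; under eq_isum do rewrite !linear0.
    by rewrite isum0 !scaler0.
  apply: eq_isum => j; rewrite /state_mode Y_act /nprod fmodeD fmodeN fmodeZ.
  rewrite scalerBr !scalerA sbin_sign; congr (_ *: _ - _ *: _).
    rewrite lprodE; apply: eq_isum => l; rewrite /G /state_mode.
    by congr (_ *: fact _ _ (fmode _ _ _)); lia.
  rewrite rprodE; apply: eq_isum => l; rewrite /H /state_mode fconjE.
  by congr (_ *: fpar (fmode _ _ _)); lia.
pose HH i l := isum (fun j => binz (n - l%:Z) j *: H i l j).
have HHf : fin2 HH.
  apply: fin2_of => [|i]; last by apply: fin2_isum; exact: fin2Z.
  have [N aN] := alf; exists N => i l Ni; rewrite /HH (_ : (fun _ => _) = fun=> 0) ?isum0 //.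
  by apply: funext => j; rewrite /H aN ?linear0 ?scaler0 //; lia.
have FFf : fin2 (fun i k => fact psi (n - k%:Z) (F i k)).
  by apply: fin2_le Ff => i k ->; rewrite linear0.
under eq_isum do rewrite ET scalerBr scaler_swap.
rewrite isumB; last 2 first.
- by apply: finZ; apply: fin2_isum; exact: fin2Z.
- by apply: (finZ (fun=> _)); apply: finZ; apply: fin2_isum; exact: fin2Z.
rewrite isumZ; last by apply: finZ; apply: fin2_isum; exact: (fin2Z _ HHf).
congr (_ - _ *: _); first rewrite (isum_exchZ _ _ FFf); last rewrite (isum_exchZ _ _ HHf).
all: apply: eq_isum => k; congr (_ *: _).
  rewrite -(isum_lin (fact psi (n - k%:Z))); last exact: (fin2_col k Ff).
  congr (fact _ _ _).
  rewrite -(isum_vdmZ p k%:Z (g := fun t => state_mode (p + k%:Z + q - t%:Z) u (al t))).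
    apply: eq_isum => i; congr (_ *: _); apply: eq_isum => j; congr (_ *: _).
    by rewrite /G; congr (state_mode _ _ _); lia.
  by apply: fin_le alf => t ->; rewrite linear0.
have tf : fin (fun t => state_mode (p + n - k%:Z + q - t%:Z) (fpar (fact psi k%:Z u)) (al t)).
  by apply: fin_le alf => t ->; rewrite linear0.
rewrite isum_lin // (_ : p + n - k%:Z = p + (n - k%:Z)); last by lia.
rewrite -(isum_vdmZ p (n - k%:Z) (g := fun t =>
    fpar (state_mode (p + (n - k%:Z) + q - t%:Z) (fpar (fact psi k%:Z u)) (al t)))).
  apply: eq_isum => i; congr (_ *: _); apply: eq_isum => j; congr (_ *: _).
  by rewrite /H; congr (fpar (state_mode _ _ _)); lia.
by apply: fin_le alf => t ->; rewrite !linear0.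
Qed.

Lemma nprod_mode m v : fmode (nprod psi n (YM a)) m v =
  isum (fun k => sbin n k *: fact psi (n - k%:Z) (fmode (YM a) (m + k%:Z) v)) -
  ((-1) ^ n * (-1) ^+ e) *:
    isum (fun k => sbin n k *: fmode (YM a) (m + n - k%:Z) (fact psi k%:Z v)).
Proof.
rewrite /nprod fmodeD fmodeN fmodeZ lprodE rprodE -scalerA; congr (_ - _ *: _).
rewrite -isumZ; last by apply: finZ; exact: rprod_fin.
by apply: eq_isum => k; rewrite parM fmodeZ scaler_swap.
Qed.

(** The commutator formula, read as moving psi(m) from the right of Y(b) to its
    left. *)
Lemma twist_comm f b m N v :
  fmode (twist (~~ f) (YM b)) N (fact psi m v) =
  fact psi m (fmode (twist f (YM b)) N v) -
  (-1) ^+ f *: isum (fun j => binz m j *: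
     fmode (twist f (YM (act psi j%:Z b))) (m + N - j%:Z) v).
Proof.
case: f => /=.
  have := Y_comm (SFpar b) psi m N v; rewrite -fconj_Y fconjK.
  move=> ->; rewrite -[LHS]addr0 -[RHS]addrA; congr (_ + _).
  rewrite expr1 scaleN1r opprK -isumD; last 2 first.
  - by apply: finZ; exact: Yact_fin.
  - apply: finZ; have [K0 bK] := SFact_fin psi b; exists K0 => j /bK ->.
    by rewrite !linear0 /= ?fmode0.
  rewrite -[LHS](isum0 M); apply: eq_isum => j; rewrite -scalerDr fconj_Y.
  rewrite (_ : act psi j (SFpar b) = - SFpar (act psi j b)) ?linearN ?fmodeN ?addNr ?scaler0 //.
  by rewrite SFpar_act opprK.
by rewrite expr0 scale1r Y_comm addrK.
Qed.

(** In a_(.) psi(k) b_(.) u the mode psi(k) is moved past b by the commutator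
    formula; this produces the terms with psi(j) b. *)
Lemma bor_r1_step p q r b u :
  bor_r1 (nprod psi n (YM a)) (YM b) p q r u =
  isum (fun k => sbin n k *: fact psi (n - k%:Z) (bor_r1 (YM a) (YM b) (p + k%:Z) q r u)) -
  ((-1) ^ n * (-1) ^+ e) *:
   (isum (fun k => sbin n k *:
      bor_r1 (YM a) (fconj (YM b)) (p + n - k%:Z) q r (fact psi k%:Z u)) +
    isum (fun j => sbin n j *: bor_r1 (YM a) (YM (act psi j%:Z b)) p q (r + n - j%:Z) u)).
Proof.
pose U i k := fact psi (n - k%:Z)
  (fmode (YM a) (p + k%:Z + r - i%:Z) (fmode (YM b) (q + i%:Z) u)).
have [Nb bN] := fmode_fin (YM b) q u.
have Uf : fin2 U.
  apply: fin2_of => [|i]; first by exists Nb => i k /bN; rewrite /U => ->; rewrite !linear0.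
  apply: fin_le (fmode_fin (YM a) (p + r - i%:Z) (fmode (YM b) (q + i%:Z) u)) => k E.
  by rewrite /U (_ : p + k%:Z + r - i%:Z = p + r - i%:Z + k%:Z) ?E ?linear0 //; lia.
pose V i k := fmode (YM a) (p + n - k%:Z + r - i%:Z)
  (fmode (fconj (YM b)) (q + i%:Z) (fact psi k%:Z u)).
have Vf : fin2 V.
  apply: fin2_ofr => [|k].
    by have [N uN] := fact_fin psi u; exists N => i k /uN; rewrite /V => ->; rewrite !linear0.
  by apply: fin_le (fmode_fin (fconj (YM b)) q (fact psi k%:Z u)) => i E; rewrite /V E linear0.
pose Z j t := fmode (YM a) (p + (r + n - j%:Z) - t%:Z) (fmode (YM (act psi j%:Z b)) (q + t%:Z) u).
have [Nj jN] := SFact_fin psi b.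
have Z0 j : (Nj <= j)%N -> Z j =1 fun=> 0.
  by move=> /jN E t; rewrite /Z E linear0 fmode0 linear0.
have Zf j : fin (Z j).
  by apply: fin_le (fmode_fin (YM (act psi j%:Z b)) q u) => t; rewrite /Z => ->; rewrite linear0.
pose W i k j := fmode (YM a) (p + r + n - i%:Z - k%:Z)
  (fmode (YM (act psi j%:Z b)) (k%:Z + (q + i%:Z) - j%:Z) u).
have Wf i : fin2 (fun k j => if (j <= k)%N then W i k j else 0).
  apply: fin2_ofr => [|j].
    by exists Nj => k j /jN E; rewrite /W E linear0 fmode0 linear0; case: ifP.
  apply: fin_le (fmode_fin (YM (act psi j%:Z b)) (q + i%:Z - j%:Z) u) => k E.
  case: ifP => // _; rewrite /W (_ : k%:Z + (q + i%:Z) - j%:Z = q + i%:Z - j%:Z + k%:Z); last by lia.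
  by rewrite E linear0.
pose WW i k := isum (fun j => binz k%:Z j *: W i k j).
pose VW i k := fmode (YM a) (p + n - k%:Z + r - i%:Z) (fact psi k%:Z (fmode (YM b) (q + i%:Z) u)).
have VWf : fin2 VW.
  apply: fin2_of => [|i]; first by exists Nb => i k /bN; rewrite /VW => ->; rewrite !linear0.
  by apply: fin_le (fact_fin psi (fmode (YM b) (q + i%:Z) u)) => k; rewrite /VW => ->; rewrite linear0.
have VWE i k : VW i k = V i k + WW i k.
  rewrite /VW Y_comm linearD /=; congr (_ + _).
  rewrite isum_lin; last exact: Yact_fin.
  apply: eq_isum => j; rewrite /W; congr (_ *: fmode _ _ _); lia.
have WWf : fin2 WW.
  rewrite (_ : WW = fun i k => VW i k + (- 1) *: V i k); first by apply: fin2D => //; exact: fin2Z.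
  by apply: funext => i; apply: funext => k; rewrite VWE scaleN1r addrAC subrr add0r.
have E1 i : fmode (nprod psi n (YM a)) (p + r - i%:Z) (fmode (YM b) (q + i%:Z) u) =
   isum (fun k => sbin n k *: U i k) - ((-1) ^ n * (-1) ^+ e) *:
     (isum (fun k => sbin n k *: V i k) + isum (fun k => sbin n k *: WW i k)).
  rewrite nprod_mode; congr (_ - _ *: _).
    by apply: eq_isum => k; rewrite /U; congr (_ *: fact _ _ (fmode _ _ _)); lia.
  rewrite -isumD; try by apply: finZ; exact: fin2_row.
  apply: eq_isum => k; rewrite -scalerDr -VWE /VW.
  by congr (_ *: fmode _ _ _); lia.
rewrite /bor_r1; under eq_isum do rewrite E1 scalerBr scaler_swap scalerDr.
have fU : fin (fun i => sbin r i *: isum (fun k => sbin n k *: U i k)).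
  by apply: finZ; apply: fin2_isum; exact: fin2Z.
have fV : fin (fun i => sbin r i *: isum (fun k => sbin n k *: V i k)).
  by apply: finZ; apply: fin2_isum; exact: fin2Z.
have fW : fin (fun i => sbin r i *: isum (fun k => sbin n k *: WW i k)).
  by apply: finZ; apply: fin2_isum; exact: fin2Z.
have fVW := finD fV fW.
rewrite isumB //; last exact: (finZ (fun=> _)).
rewrite (isumZ _ fVW) (isumD fV fW); congr (_ - _ *: (_ + _)).
- rewrite (isum_exchZ _ _ Uf).
  apply: eq_isum => k; congr (_ *: _); rewrite (isum_lin (fact psi _)) //.
  exact: bor_r1_fin.
- by rewrite (isum_exchZ _ _ Vf).
pose X i j := isum (fun l => sbin (n - j%:Z) l *: Z j (i + l)%N).
have Xf : fin2 X.
  apply: fin2_ofr => [|j].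
    exists Nj => i j /Z0 E; rewrite /X (_ : (fun _ => _) = fun=> 0) ?isum0 //.
    by apply: funext => l; rewrite E scaler0.
  have [N ZN] := Zf j; exists N => i Ni; rewrite /X (_ : (fun _ => _) = fun=> 0) ?isum0 //.
  by apply: funext => l; rewrite ZN ?scaler0 //; lia.
transitivity (isum (fun i => sbin r i *: isum (fun j => sbin n j *: X i j))).
  apply: eq_isum => i; congr (_ *: _); rewrite isum_triZ //.
  apply: eq_isum => j; congr (_ *: _); apply: eq_isum => l; congr (_ *: _).
  by rewrite /W /Z; congr (fmode _ _ (fmode _ _ _)); lia.
rewrite (isum_exchZ _ _ Xf); apply: eq_isum => j; congr (_ *: _).
rewrite (isum_svdmZ r (n - j%:Z) (Zf j)).
by rewrite addrA.
Qed.

(** In b_(.) psi(n-k) a_(.) u the mode psi(n-k) is moved past b, to the left;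
    this also produces terms with psi(j) b, which complete those of
    bor_r1_step. *)
Lemma bor_r2_step p q r b u :
  bor_r2 (nprod psi n (YM a)) (twist (~~ e) (YM b)) p q r u =
  isum (fun k => sbin n k *: fact psi (n - k%:Z)
     (bor_r2 (YM a) (twist e (YM b)) (p + k%:Z) q r u)) -
  (-1) ^+ e *: isum (fun j => binz n j *:
     bor_r2 (YM a) (twist e (YM (act psi j%:Z b))) p q (r + n - j%:Z) u) -
  ((-1) ^ n * (-1) ^+ e) *: isum (fun k => sbin n k *:
     bor_r2 (YM a) (twist (~~ e) (YM b)) (p + n - k%:Z) q r (fact psi k%:Z u)).
Proof.
pose x t := fmode (YM a) (p + t%:Z) u.
have [Nx xN] : fin x := fmode_fin (YM a) p u.
pose T := twist (~~ e) (YM b).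
pose U i k := fact psi (n - k%:Z) (fmode (twist e (YM b)) (q + r - i%:Z) (x (i + k)%N)).
have Uf : fin2 U.
  by exists Nx => i k ik; rewrite /U xN ?linear0 //; lia.
pose Z j t := fmode (twist e (YM (act psi j%:Z b))) (q + (r + n - j%:Z) - t%:Z) (x t).
have Zf j : fin (Z j).
  by exists Nx => t tN; rewrite /Z xN ?linear0.
have [Nj jN] := SFact_fin psi b.
have T0 : twist e 0 = 0 by case: (e) => //=; rewrite linear0.
have Z0 j t : (Nj <= j)%N -> Z j t = 0.
  by move=> /jN E; rewrite /Z E linear0 T0 fmode0.
pose W i k j := Z j (i + k)%N.
have Wf i : fin2 (W i).
  apply: fin2_ofr => [|j]; first by exists Nj => k j; exact: Z0.
  by exists Nx => k Nk; rewrite /W /Z xN ?linear0 //; lia.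
pose WW i k := isum (fun j => binz (n - k%:Z) j *: W i k j).
have WWf : fin2 WW.
  exists Nx => i k ik; rewrite /WW (_ : (fun _ => _) = fun=> 0) ?isum0 //.
  by apply: funext => j; rewrite /W /Z xN ?linear0 ?scaler0 //; lia.
pose V i k := fmode T (q + r - i%:Z) (fmode (YM a) (p + i%:Z + n - k%:Z) (fact psi k%:Z u)).
have Vf : fin2 V.
  by apply: fin2_le (rprod_fin2 psi n (YM a) p u) => i k; rewrite /V => ->; rewrite linear0.
have E1 i : fmode T (q + r - i%:Z) (fmode (nprod psi n (YM a)) (p + i%:Z) u) =
   isum (fun k => sbin n k *: U i k) - (-1) ^+ e *: isum (fun k => sbin n k *: WW i k) -
   ((-1) ^ n * (-1) ^+ e) *: isum (fun k => sbin n k *: V i k).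
  rewrite nprod_mode linearB linearZ /= (isum_lin (fmode T _)); last exact: lprod_fin.
  rewrite (isum_lin (fmode T _)); last first.
    exact: (rprod_fin psi (fun k => p + i%:Z + n - k%:Z) (YM a)).
  congr (_ - _ *: _); rewrite -isumZ; last by apply: finZ; exact: fin2_row.
  rewrite -isumB; last 2 first.
  - by apply: finZ; exact: fin2_row.
  - by apply: (finZ (fun=> _)); apply: finZ; exact: fin2_row.
  apply: eq_isum => k; rewrite scaler_swap -scalerBr /= /T twist_comm; congr (_ *: (_ - _ *: _)).
    by rewrite /U /x PoszD addrA.
  apply: eq_isum => j; rewrite /W /Z /x; congr (_ *: fmode _ _ (fmode _ _ _)); lia.
rewrite /bor_r2; under eq_isum do rewrite E1 !scalerBr (scaler_swap _ ((-1) ^+ e)) (scaler_swap _ ((-1) ^ n * (-1) ^+ e)).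
have fU : fin (fun i => sbin r i *: isum (fun k => sbin n k *: U i k)).
  by apply: finZ; apply: fin2_isum; exact: fin2Z.
have fV : fin (fun i => sbin r i *: isum (fun k => sbin n k *: V i k)).
  by apply: finZ; apply: fin2_isum; exact: fin2Z.
have fW : fin (fun i => sbin r i *: isum (fun k => sbin n k *: WW i k)).
  by apply: finZ; apply: fin2_isum; exact: fin2Z.
have fUW := finD fU (finN (finZ (fun=> (-1) ^+ e) fW)).
rewrite isumB //; last exact: (finZ (fun=> _)).
rewrite isumB //; last exact: (finZ (fun=> _)).
rewrite (isumZ _ fW) (isumZ _ fV); congr (_ - _ *: _ - _ *: _).
- rewrite (isum_exchZ _ _ Uf); apply: eq_isum => k; congr (_ *: _); rewrite (isum_lin (fact psi _)).
    by apply: eq_isum => i; rewrite /U /x; congr (_ *: fact _ _ (fmode _ _ (fmode _ _ _))); lia.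
  apply: fin_le (fmode_fin (YM a) (p + k%:Z) u) => i ->; exact: linear0.
- pose X i j := isum (fun k => sbin (n - j%:Z) k *: Z j (i + k)%N).
  have Xf : fin2 X.
    apply: fin2_ofr => [|j].
      exists Nj => i j Njj; rewrite /X (_ : (fun _ => _) = fun=> 0) ?isum0 //.
      by apply: funext => l; rewrite Z0 ?scaler0.
    have [N ZN] := Zf j; exists N => i Ni; rewrite /X (_ : (fun _ => _) = fun=> 0) ?isum0 //.
    by apply: funext => l; rewrite ZN ?scaler0 //; lia.
  transitivity (isum (fun i => sbin r i *: isum (fun j => binz n j *: X i j))).
    by apply: eq_isum => i; congr (_ *: _); rewrite isum_triCZ.
  rewrite (isum_exchZ _ _ Xf); apply: eq_isum => j; congr (_ *: _).
  rewrite (isum_svdmZ r (n - j%:Z) (Zf j)).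
  by rewrite addrA.
- rewrite (isum_exchZ _ _ Vf).
  apply: eq_isum => k; congr (_ *: _); apply: eq_isum => i; rewrite /V.
  by congr (_ *: fmode _ _ (fmode _ _ _)); lia.
Qed.

Lemma fpar_bor_r1 (A B : field M) p q r u :
  fpar (bor_r1 A B p q r (fpar u)) = bor_r1 (fconj A) (fconj B) p q r u.
Proof.
rewrite /bor_r1 isum_lin; last exact: bor_r1_fin.
by apply: eq_isum => i; rewrite !fconjE fparK.
Qed.

Lemma fpar_bor_r2 (A B : field M) p q r u :
  fpar (bor_r2 A B p q r (fpar u)) = bor_r2 (fconj A) (fconj B) p q r u.
Proof.
rewrite /bor_r2 isum_lin; last exact: bor_r1_fin.
by apply: eq_isum => i; rewrite !fconjE fparK.
Qed.

Lemma bor_r1Zl c (A B : field M) p q r u : bor_r1 (c *: A) B p q r u = c *: bor_r1 A B p q r u.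
Proof.
rewrite /bor_r1 -isumZ; last by apply: finZ; exact: bor_r1_fin.
by apply: eq_isum => i; rewrite fmodeZ scaler_swap.
Qed.

Lemma bor_r2Zl c (A B : field M) p q r u : bor_r2 (c *: A) B p q r u = c *: bor_r2 A B p q r u.
Proof.
rewrite /bor_r2 -isumZ; last by apply: finZ; exact: bor_r1_fin.
apply: eq_isum => i; rewrite fmodeZ (linearZ_LR (fmode B _)) /=; exact: scaler_swap.
Qed.

Lemma bor_r1_fin_p (A B : field M) p q r u : fin (fun k => bor_r1 A B (p + k%:Z) q r u).
Proof.
apply: fin2_isum; apply: fin2Z; apply: fin2_ofr => [|i].
  by have [N BN] := fmode_fin B q u; exists N => k i /BN ->; rewrite linear0.
apply: fin_le (fmode_fin A (p + r - i%:Z) (fmode B (q + i%:Z) u)) => k <-.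
by congr (fmode _ _ _); lia.
Qed.

Lemma bor_r2_fin_p (A B : field M) p q r u : fin (fun k => bor_r2 A B (p + k%:Z) q r u).
Proof.
apply: fin2_isum; apply: fin2Z; apply: fin2_diag (fmode_fin A p u) => k i E.
by rewrite (_ : p + k%:Z + i%:Z = p + (k + i)%N%:Z) ?E ?linear0 //; lia.
Qed.

Lemma bor_r1_eq0 (A B : field M) p q r u : B = 0 \/ u = 0 -> bor_r1 A B p q r u = 0.
Proof.
by move=> H; apply: isum_eq0 => i; case: H => ->; rewrite ?fmode0 !linear0.
Qed.

Lemma bor_r2_eq0 (A B : field M) p q r u : B = 0 \/ u = 0 -> bor_r2 A B p q r u = 0.
Proof.
by move=> H; apply: isum_eq0 => i; case: H => ->; rewrite ?fmode0 !linear0.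
Qed.

(** The bookkeeping of signs in bor_r_step: s, t, x stand for (-1)^n, (-1)^r
    and (-1)^e. *)
Lemma assemble (V : lmodType K) (s t x : K) (a1 b1 c1 a2 b2 c2 : V) : s * s = 1 ->
  a1 - (s * x) *: (b1 + c1) - t *: (a2 - x *: c2 - (s * x) *: b2) =
  a1 - t *: a2 - s *: (x *: b1 - t *: (x *: b2)) - (s * x) *: (c1 - (t * s) *: c2).
Proof.
move=> ss; rewrite !scalerBr !scalerDr !scalerA.
have -> : s * x * (t * s) = t * x by transitivity (s * s * (t * x)); [ring | rewrite ss mul1r].
have -> : t * (s * x) = s * (t * x) by ring.
rewrite !opprD !opprK !addrA.
by rewrite [LHS](ACl (1 * 4 * 2 * 6 * 3 * 5)%AC).
Qed.

Lemma twist0 f : twist f 0 = 0 :> field M.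
Proof. by case: f => //=; rewrite linear0. Qed.

Lemma bor_r_step p q r b u : bor_r (~~ e) (act psi n a) p q r b u =
  bor_step e psi n (bor_r e a) p q r b u.
Proof.
have [Nj jN] := SFact_fin psi b; have [Nu uN] := fact_fin psi u.
rewrite {1}/bor_r Y_act bor_r1_step bor_r2_step assemble ?signzM // /bor_step.
congr (_ - _ *: _ - _ *: _).
- rewrite -isumZ -?isumB.
  + by apply: eq_isum => k; rewrite /bor_r (linearB (fact psi _)) (linearZ_LR (fact psi _)) /= scalerBr scaler_swap.
  + by apply: finZ; apply: fin_le (bor_r1_fin_p (YM a) (YM b) p q r u) => k ->; rewrite linear0.
  + apply: (finZ (fun=> _)); apply: finZ.
    by apply: fin_le (bor_r2_fin_p (YM a) (twist e (YM b)) p q r u) => k ->; rewrite linear0.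
  + apply: finZ.
    by apply: fin_le (bor_r2_fin_p (YM a) (twist e (YM b)) p q r u) => k ->; rewrite linear0.
- have F1 : fin (fun k => bor_r1 (YM a) (fconj (YM b)) (p + n - k%:Z) q r (fact psi k%:Z u)).
    by exists Nu => k /uN ->; apply: bor_r1_eq0; right.
  have F2 : fin (fun k => bor_r2 (YM a) (twist (~~ e) (YM b)) (p + n - k%:Z) q r (fact psi k%:Z u)).
    by exists Nu => k /uN ->; apply: bor_r2_eq0; right.
  rewrite -!isumZ; try exact: finZ; last by apply: (finZ (fun=> _)); exact: finZ.
  rewrite -isumB; last 2 first.
  + by apply: (finZ (fun=> _)); exact: finZ.
  + by apply: (finZ (fun=> _)); apply: (finZ (fun=> _)); exact: finZ.
  apply: eq_isum => k; rewrite /bor_r (linearB fpar) (linearZ_LR fpar) /= fpar_bor_r1 fpar_bor_r2.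
  rewrite parM bor_r1Zl bor_r2Zl scalerBr.
  rewrite (_ : fconj (twist e (YM b)) = twist (~~ e) (YM b)); last by case: (e); rewrite /= ?fconjK.
  by congr (_ - _); rewrite ![in RHS](scaler_swap (sbin n k)).
- have F1 : fin (fun j => bor_r1 (YM a) (YM (act psi j%:Z b)) p q (r + n - j%:Z) u).
    by exists Nj => j /jN ->; apply: bor_r1_eq0; left; rewrite linear0.
  have F2 : fin (fun j => bor_r2 (YM a) (twist e (YM (act psi j%:Z b))) p q (r + n - j%:Z) u).
    by exists Nj => j /jN ->; apply: bor_r2_eq0; left; rewrite linear0 twist0.
  rewrite -!isumZ; try exact: finZ.
  rewrite -isumB; [|exact: finZ|by apply: (finZ (fun=> _)); exact: finZ].
  apply: eq_isum => j; rewrite /bor_r scalerBr; congr (_ - _).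
  rewrite [LHS]scalerA [RHS]scalerA; congr (_ *: _).
  by rewrite -addrA signzD [RHS]mulrCA sbin_sign [RHS]mulrA.
Qed.

End Step.

Lemma word_parity (N : ferm_module form) (s : seq (h * int)) :
  fconj (Y N (word s (SFvac form))) = (-1) ^+ odd (size s) *: Y N (word s (SFvac form)).
Proof.
elim: s => [|x s IH]; first by rewrite Y_vac fconj_id scale1r.
by rewrite Y_act fconj_nprod IH linearZ /= signrN scaleNr.
Qed.

(** For the vacuum the identity is the delta function identity. *)
Lemma bor_vac p q r b u :
  bor_l (SFvac form) p q r b u = bor_r false (SFvac form) p q r b u.
Proof.
rewrite /bor_l /bor_r /bor_r1 /bor_r2 !Y_vac /twist.
have -> : isum (fun i => binz p i *: state_mode (p + q - i%:Z) u (fmode (idfield _) (r + i%:Z) b)) =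
   binZ K p (- r - 1) *: fmode (YM b) (p + q + r + 1) u.
  rewrite (_ : p + q + r + 1 = p + q - (- r - 1)); last by lia.
  rewrite -(@isum_binz_pick _ _ p (- r - 1) (fun i => r + i%:Z == -1)
    (fun z => fmode (YM b) (p + q - z) u)); last by move=> i; lia.
  by apply: eq_isum => i; rewrite mkfieldE; case: eqP; rewrite ?linear0.
have -> : isum (fun i => sbin r i *: fmode (idfield M) (p + r - i%:Z) (fmode (YM b) (q + i%:Z) u)) =
   sbinZ K r (p + 1 + r) *: fmode (YM b) (p + q + r + 1) u.
  rewrite (_ : p + q + r + 1 = q + (p + 1 + r)); last by lia.
  rewrite -(@isum_sbin_pick _ _ r (p + 1 + r) (fun i => p + r - i%:Z == -1)
    (fun z => fmode (YM b) (q + z) u)); last by move=> i; lia.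
  by apply: eq_isum => i; rewrite mkfieldE.
have -> : isum (fun i => sbin r i *: fmode (YM b) (q + r - i%:Z) (fmode (idfield M) (p + i%:Z) u)) =
   sbinZ K r (- (p + 1)) *: fmode (YM b) (p + q + r + 1) u.
  rewrite (_ : p + q + r + 1 = q + r - (- (p + 1))); last by lia.
  rewrite -(@isum_sbin_pick _ _ r (- (p + 1)) (fun i => p + i%:Z == -1)
    (fun z => fmode (YM b) (q + r - z) u)); last by move=> i; lia.
  by apply: eq_isum => i; rewrite mkfieldE; case: eqP; rewrite ?linear0.
by rewrite scalerA -scalerBl binz_delta addrK.
Qed.

(** Induction on the word: a new first letter switches the parity and applies
    bor_step to both sides. *)
Lemma bor_word s p q r b u :
  bor_l (word s (SFvac form)) p q r b u =
  bor_r (odd (size s)) (word s (SFvac form)) p q r b u.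
Proof.
elim: s p q r b u => [|x s IH] p q r b u; first exact: bor_vac.
rewrite [word _ _]/= [odd _]/=.
rewrite (bor_l_step _ _ (word_parity _ _)) (bor_r_step _ _ (word_parity _ _)).
rewrite (_ : bor_l _ = bor_r (odd (size s)) (word s (SFvac form))) //.
by do 5 (apply: funext => ?); exact: IH.
Qed.

End Borcherds.

(** * Normally ordered products *)

Section NormalOrdering.
Variables (K : numFieldType) (h : lmodType K) (form : h -> h -> K).
Local Notation SF := (SF form).
Local Notation act psi m := (lact (gen form psi m)).
Local Notation fock := (fock form).

Lemma fock_cons x w : fock (x :: w) = act x.1 (- x.2.+1%:Z) (fock w).
Proof. by []. Qed.

(** The easy half of the PBW theorem: the creation words span SF, because an
    annihilation mode can be moved to the right until it kills the vacuum. *)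
Lemma SF_fock_ind (P : SF -> Prop) :
  (forall (c : K) u v, P u -> P v -> P (c *: u + v)) ->
  (forall w, P (fock w)) -> forall v, P v.
Proof.
pose lin (Q : SF -> Prop) := forall (c : K) u v, Q u -> Q v -> Q (c *: u + v).
pose span v := forall Q, lin Q -> (forall w, Q (fock w)) -> Q v.
have slin : lin span by move=> c u v su sv Q Ql Qf; apply: (Ql); [exact: su Q Ql Qf | exact: sv Q Ql Qf].
have sfock w : span (fock w) by move=> Q _; exact.
have s0 : span 0 by rewrite -(addNr (fock [::])) -scaleN1r; apply: slin.
have sext (f : {linear SF -> SF}) : (forall w, span (f (fock w))) -> forall v, span v -> span (f v).
  move=> fw v sv; apply: (sv (fun v => span (f v))) => // c x y fx fy.
  by rewrite linearP; exact: slin.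
have screate psi (n : nat) v : span v -> span (act psi (- n.+1%:Z) v).
  by apply: (sext (lact (gen form psi (- n.+1%:Z)))) => w; exact: (sfock ((psi, n) :: w)).
move=> Plin Pf v; suff : span v by apply.
elim/SF_word_ind: v => //; first exact: (sfock [::]).
move=> psi m; apply: (sext (lact (gen form psi m))) => w.
change (span (act psi m (fock w))); case: (leP 0 m) => m0; last first.
  have -> : m = - (`|m|%N.-1).+1%:Z by lia.
  exact: screate.
elim: w => [|x w IH]; first by have -> : act psi m (fock [::]) = 0 by exact: act_vac.
have /(canRL (addrK _)) -> := act_comm (form := form) psi x.1 m (- x.2.+1%:Z) (fock w).
rewrite -scaleN1r addrC; apply: (slin); first exact: screate.
by rewrite -[_ *: _]addr0; exact: (slin).
Qed.

Lemma word_cat s t (v : SF) : word (s ++ t) v = word s (word t v).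
Proof. by rewrite /word foldr_cat. Qed.

Fact word_lin s : linear (@word _ _ form s).
Proof. by elim: s => // x s IH c u v /=; rewrite IH linearP. Qed.
HB.instance Definition _ s := GRing.isLinear.Build K SF SF *:%R (@word _ _ form s) (word_lin s).

(** Two annihilation modes always anticommute: the factor m is zero when the
    pairing is not. *)
Lemma ann_word psi m s (v : SF) : 0 <= m -> all (predC (@creation _ h)) s ->
  act psi m (word s v) = (-1) ^+ size s *: word s (act psi m v).
Proof.
move=> m0; elim: s => [|x s IH] /=; first by rewrite scale1r.
move=> /andP[x0 /IH E]; have xm : 0 <= x.2 by rewrite leNgt.
have /(canRL (addrK _)) -> := act_comm (form := form) psi x.1 m x.2 (word s v).
rewrite E linearZ /= exprS mulN1r scaleNr; case: eqP => [e|_]; last by rewrite mulr0 scale0r add0r.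
by have -> : m = 0 by [lia]; rewrite mulr0z !mul0r scale0r add0r.
Qed.

Lemma normal_ordered_create psi m s (v : SF) : m < 0 ->
  normal_ordered ((psi, m) :: s) v = act psi m (normal_ordered s v).
Proof. by move=> m0; rewrite /normal_ordered /= /creation /= m0 /= linearZ. Qed.

Lemma normal_ordered_ann psi m s (v : SF) : 0 <= m ->
  normal_ordered ((psi, m) :: s) v = (-1) ^+ size s *: normal_ordered s (act psi m v).
Proof.
move=> m0; have cr : creation (psi, m) = false by rewrite /creation /= ltNge m0.
rewrite /normal_ordered /= cr /=.
rewrite !word_cat /= ann_word //; last by apply/allP => x; rewrite mem_filter => /andP[].
rewrite linearZ !scalerA -!exprD; congr (_ *: _).
rewrite addnAC size_filter -(count_predC (@creation _ h) s); congr (_ ^+ _).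
Qed.

Lemma normal_ordered0 s : normal_ordered s (0 : SF) = 0.
Proof. by rewrite /normal_ordered linear0 scaler0. Qed.

(** The tuples of modes that contribute to a normally ordered product lie in a
    box, which makes the sum over all tuples an iterated sum. *)
Definition modes (B : nat) : seq int := [seq i%:Z - B%:Z | i <- iota 0 (B + B)].

Fixpoint box (B r : nat) : seq (seq int) :=
  if r is r'.+1 then [seq m :: ms | m <- modes B, ms <- box B r'] else [:: [::]].

Lemma mem_modes B m : (m \in modes B) = (- B%:Z <= m < B%:Z).
Proof.
apply/mapP/idP; last by move=> mB; exists `|(m + B%:Z)%R|%N; rewrite ?mem_iota; lia.
by case=> i; rewrite mem_iota => iB ->; lia.
Qed.

Lemma big_modes B (F : int -> SF) : \sum_(m <- modes B) F m =
  \sum_(j < B) F (- j%:Z - 1) + \sum_(i < B) F i%:Z.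
Proof.
rewrite big_map -[X in iota 0 X]subn0 -/(index_iota 0 _) big_mkord big_split_ord /=.
congr (_ + _); last by apply: eq_bigr => i _; congr F; lia.
rewrite (reindex_inj rev_ord_inj) /=; apply: eq_bigr => j _; congr F.
by have := ltn_ord j; lia.
Qed.

Lemma uniq_modes B : uniq (modes B).
Proof. by rewrite map_inj_uniq ?iota_uniq // => i j; lia. Qed.

Lemma mem_box B r ms : (ms \in box B r) = (size ms == r) && all (mem (modes B)) ms.
Proof.
elim: r ms => [|r IH] [|m ms] //=.
  by apply/negbTE/negP => /allpairsP[[? ?] []].
rewrite eqSS andbCA -IH; apply/allpairsP/andP => [[[x y] /= [xB yB [-> ->]]]//|[mB msB]].
by exists (m, ms).
Qed.

Lemma uniq_box B r : uniq (box B r).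
Proof.
elim: r => //= r IH; apply: allpairs_uniq => //; first exact: uniq_modes.
by move=> [x y] [x' y'] _ _ /= [-> ->].
Qed.

(** The exponent condition and the summand of normal_field. *)
Definition nf_total (w : seq (h * nat)) (ms : seq int) : int :=
  \sum_(x <- zip w ms) (x.2 + x.1.2%:Z + 1).

Definition nf_term (w : seq (h * nat)) (ms : seq int) (v : SF) : SF :=
  (\prod_(x <- zip w ms) binz K (- x.2 - 1) x.1.2) *:
    normal_ordered [seq (x.1.1, x.2) | x <- zip w ms] v.

Lemma nf_total_cons x w m ms :
  nf_total (x :: w) (m :: ms) = m + x.2%:Z + 1 + nf_total w ms.
Proof. by rewrite /nf_total /= big_cons. Qed.

Lemma nf_total_step x w (m : int) ms (k : int) : (nf_total (x :: w) (m :: ms) == k + 1) =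
  (nf_total w ms == k - m - x.2%:Z - 1 + 1).
Proof. by rewrite nf_total_cons; move: (nf_total w ms) => t; apply/eqP/eqP; lia. Qed.

Lemma nf_term_create x w m ms v : m < 0 ->
  nf_term (x :: w) (m :: ms) v = binz K (- m - 1) x.2 *: act x.1 m (nf_term w ms v).
Proof.
by move=> m0; rewrite /nf_term /= big_cons /= normal_ordered_create // [in RHS](linearZ_LR (lact _)) [RHS]scalerA.
Qed.

Lemma nf_term_ann x w m ms v : 0 <= m -> size ms = size w ->
  nf_term (x :: w) (m :: ms) v =
  binz K (- m - 1) x.2 *: ((-1) ^+ size w *: nf_term w ms (act x.1 m v)).
Proof.
move=> m0 sz; rewrite /nf_term /= big_cons /= normal_ordered_ann //.
rewrite size_map size1_zip ?sz // -[LHS]scalerA; congr (_ *: _).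
exact: scaler_swap.
Qed.

Lemma normal_field_box w (k : int) v B :
  (forall ms, size ms = size w -> nf_total w ms = k + 1 -> nf_term w ms v != 0 ->
     all (mem (modes B)) ms) ->
  normal_field w k v = \sum_(ms <- box B (size w) | nf_total w ms == k + 1) nf_term w ms v.
Proof.
move=> HB; rewrite -big_filter fsbig_seq; last by rewrite filter_uniq ?uniq_box.
apply/esym/fsbig_widen => [ms|ms] /=.
  by rewrite mem_filter mem_box => /andP[/eqP ? /andP[/eqP]].
move=> [[sz tot]]; rewrite mem_filter mem_box sz eqxx /nf_total tot eqxx /= => /negP nB.
by apply/eqP; apply: contraNT nB => ?; exact: HB.
Qed.

Definition kills (U : nat) w v := forall ms, size ms = size w ->
  has (fun m => U%:Z <= m) ms -> nf_term w ms v = 0.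

Lemma kills_le U U' w v : (U <= U')%N -> kills U w v -> kills U' w v.
Proof.
move=> UU kU ms sz /hasP[m mms Um]; apply: kU => //; apply/hasP; exists m => //.
by apply: le_trans Um; lia.
Qed.

Lemma kills0 U w : kills U w 0.
Proof. by move=> ms _ _; rewrite /nf_term normal_ordered0 scaler0. Qed.

Lemma kills_cons_ex psi w v : (forall v, exists U, kills U w v) ->
  exists U, [/\ kills U w v, forall m : nat, kills U w (act psi m%:Z v)
    & forall m, U%:Z <= m -> act psi m v = 0].
Proof.
move=> kw; have [U1 k1] := kw v; have [N vN] := SFact_fin psi v.
have [U2 k2] : exists U2, forall m : nat, (m < N)%N -> kills U2 w (act psi m%:Z v).
  elim: (N) => [|n [U2 k2]]; first by exists 0%N.
  have [U3 k3] := kw (act psi n%:Z v); exists (maxn U2 U3) => m.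
  rewrite ltnS leq_eqVlt => /predU1P[->|/k2].
    by apply: kills_le k3; exact: leq_maxr.
  by apply: kills_le; exact: leq_maxl.
exists (maxn N (maxn U1 U2)); split=> [|m|m mU].
- by apply: kills_le k1; rewrite !leq_max leqnn orbT.
- have [Nm|mN] := leqP N m; first by rewrite vN //; exact: kills0.
  by apply: kills_le (k2 _ mN); rewrite !leq_max leqnn !orbT.
- by have -> : m = `|m|%N by [lia]; apply: vN; lia.
Qed.

Lemma kills_cons U x w v : kills U w v -> (forall m : nat, kills U w (act x.1 m%:Z v)) ->
  (forall m, U%:Z <= m -> act x.1 m v = 0) -> kills U (x :: w) v.
Proof.
move=> k1 k2 k3 [|m ms] //= [sz]; have [m0|m0] := ltP m 0.
  rewrite nf_term_create // => /orP[|hms]; first by lia.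
  by rewrite k1 // linear0 scaler0.
rewrite nf_term_ann // => /orP[/k3 ->|hms].
  by rewrite /nf_term normal_ordered0 !scaler0.
have -> : m = `|m|%N by lia.
by rewrite k2 // !scaler0.
Qed.

Lemma kills_ex w v : exists U, kills U w v.
Proof.
elim: w v => [|x w IH] v; first by exists 0%N => -[].
by have [U [k1 k2 k3]] := kills_cons_ex x.1 v IH; exists U; exact: kills_cons.
Qed.

Definition wsum (w : seq (h * nat)) : nat := sumn [seq x.2.+1 | x <- w].

Lemma nf_total_upper (U : nat) w ms : size ms = size w -> all (fun m => m < U%:Z) ms ->
  nf_total w ms <= (wsum w)%:Z + (size w * U)%N%:Z.
Proof.
elim: w ms => [|x w IH] [|m ms] //=; first by rewrite /nf_total big_nil.
move=> [sz] /andP[mU msU]; have := IH _ sz msU.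
by rewrite nf_total_cons /wsum /= -/(wsum w) mulSn; lia.
Qed.

(** The total is fixed, so an upper bound on all modes is a lower bound on each
    of them. *)
Lemma nf_total_lower (U : nat) w ms m : size ms = size w -> all (fun m => m < U%:Z) ms ->
  m \in ms -> nf_total w ms - (wsum w)%:Z - (size w * U)%N%:Z <= m.
Proof.
elim: w ms => [|x w IH] [|m0 ms] //= [sz] /andP[mU msU].
rewrite inE nf_total_cons /wsum /= -/(wsum w) mulSn => /predU1P[->|/(IH _ sz msU)]; last by lia.
by have := nf_total_upper sz msU; lia.
Qed.

Lemma normal_field_kills w (k : int) v U B : kills U w v -> (U <= B)%N ->
  - B%:Z <= k + 1 - (wsum w)%:Z - (size w * U)%N%:Z ->
  normal_field w k v = \sum_(ms <- box B (size w) | nf_total w ms == k + 1) nf_term w ms v.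
Proof.
move=> kU UB kB; apply: normal_field_box => ms sz tot nz.
have msU : all (fun m => m < U%:Z) ms.
  apply: contraNT nz; rewrite -has_predC => hms; apply/eqP/kU => //.
  by apply: sub_has hms => m /=; rewrite -leNgt.
apply/allP => m mms /=; rewrite mem_modes; have := nf_total_lower sz msU mms.
by have := allP msU _ mms; rewrite tot; lia.
Qed.

Local Notation YV := (Y (SFmod form)).

Lemma fconj_fock (N : ferm_module form) w :
  fconj (Y N (fock w)) = (-1) ^+ size w *: Y N (fock w).
Proof. by rewrite /fock word_parity size_map signr_odd. Qed.

(** The product of psi(-n-1) with a field is the normally ordered product of
    the n-th divided derivative of psi(z) with it: the coefficients of both
    expansions of (x - z)^(-n-1) become the binomials of that derivative after
    reflecting the upper index. *)
Lemma Y_fock_cons x w (k : int) v (B : nat) :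
  (forall m, m < - B%:Z -> fmode (YV (fock w)) (k - m - x.2%:Z - 1) v = 0) ->
  (forall m, B%:Z <= m -> act x.1 m v = 0) ->
  fmode (YV (fock (x :: w))) k v =
  \sum_(m <- modes B) binz K (- m - 1) x.2 *:
    (if m < 0 then act x.1 m (fmode (YV (fock w)) (k - m - x.2%:Z - 1) v)
     else (-1) ^+ size w *: fmode (YV (fock w)) (k - m - x.2%:Z - 1) (act x.1 m v)).
Proof.
case: x => psi n /= H1 H2.
rewrite fock_cons Y_act /nprod fmodeD fmodeN fmodeZ /=.
rewrite (@lprodE _ _ _ (SFmod form)) (@rprodE _ _ _ (SFmod form)).
pose f m := binz K (- m - 1) n *: act psi m (fmode (YV (fock w)) (k - m - n%:Z - 1) v).
pose g m := binz K (- m - 1) n *: ((-1) ^+ size w *: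
   fmode (YV (fock w)) (k - m - n%:Z - 1) (act psi m v)).
have f0 j : (B <= j)%N -> f (- j%:Z - 1) = 0.
  by move=> Bj; rewrite /f H1 ?linear0 ?scaler0 //; lia.
have -> : isum (fun i => sbin K (- n.+1%:Z) i *: act psi (- n.+1%:Z - i%:Z)
     (fmode (YV (fock w)) (k + i%:Z) v)) = \sum_(j < B) f (- j%:Z - 1).
  rewrite -(isumE (f := fun j : nat => f (- j%:Z - 1))) //.
  rewrite (isum_shift (j := n) (f := fun j : nat => f (- j%:Z - 1))); last by exists B; exact: f0.
    apply: eq_isum => i; rewrite /f.
    rewrite (_ : - (- (n + i)%N%:Z - 1) - 1 = (n + i)%N); last by lia.
    rewrite /sbin binz_neg (_ : i%:Z - - n.+1%:Z - 1 = (n + i)%N); last by lia.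
    rewrite !binz_nat -(@bin_sub (n + i) n) ?leq_addr // addKn.
    by congr (_ *: lact (gen _ _ _) (fmode _ _ _)); lia.
  move=> i ni; rewrite /f (_ : - (- i%:Z - 1) - 1 = i); last by lia.
  by rewrite binz_small // scale0r.
have -> : isum (fun i => sbin K (- n.+1%:Z) i *: fmode (fconj (YV (fock w)))
     (k - n.+1%:Z - i%:Z) (act psi i%:Z v)) = (-1) ^+ n *: \sum_(i < B) g i%:Z.
  rewrite -(isumE (f := fun i : nat => g i)) => [|i Bi]; last first.
    by rewrite /g H2 ?linear0 ?scaler0 //; lia.
  rewrite -isumZ; last by exists B => i Bi; rewrite /g H2 ?linear0 ?scaler0 //; lia.
  apply: eq_isum => i; rewrite fconj_fock fmodeZ /g.
  have -> : sbin K (- n.+1%:Z) i = (-1) ^+ n * binz K (- i%:Z - 1) n.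
    rewrite /sbin !binz_neg (_ : i%:Z - - n.+1%:Z - 1 = (n + i)%N); last by lia.
    rewrite (_ : n%:Z - (- i%:Z - 1) - 1 = (n + i)%N); last by lia.
    by rewrite !binz_nat -(@bin_sub (n + i) n) ?leq_addr // addKn.
  by rewrite -[LHS]scalerA; congr (_ *: (_ *: (_ *: fmode _ _ _))); lia.
rewrite scalerA (_ : (-1) ^ (- n.+1%:Z) * (-1) ^+ n = -1); last first.
  by rewrite signzN -exprnP exprS -mulrA -expr2 sqrr_sign mulr1.
rewrite scaleN1r opprK big_modes; congr (_ + _); apply: eq_bigr => i _.
  by rewrite ifT //; lia.
Qed.

(** Induction on the number of factors: the sum over tuples in a box splits off
    its first mode, as does Y_fock_cons. *)
Theorem normal_fieldE w (k : int) v : normal_field w k v = fmode (YV (fock w)) k v.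
Proof.
elim: w k v => [|x w IH] k v.
  rewrite (@normal_field_kills [::] k v 0 `|k|.+1) //; last 2 first.
  - by case.
  - by rewrite /wsum /=; lia.
  rewrite big_cons big_nil /= addr0 Y_vac mkfieldE /nf_total big_nil.
  have -> : (0 == k + 1) = (k == -1) by lia.
  by case: ifP => // _; rewrite /nf_term /= big_nil scale1r /normal_ordered /= scale1r.
have [U [k1 k2 k3]] := kills_cons_ex x.1 v (@kills_ex w).
have [N YN] := fmode_fin (YV (fock w)) k v.
(* Any bound beyond the modes that act nontrivially on v, the truncation of
   Y(fock w), and the lower bound of nf_total_lower. *)
pose B := (`|k| + wsum (x :: w) + size (x :: w) * U + U + N + x.2.+1)%N.
have BE : B = (`|k| + (x.2.+1 + wsum w) + (U + size w * U) + U + N + x.2.+1)%N.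
  by rewrite /B /wsum /= mulSn.
have sU : (size w * U <= B)%N by rewrite BE; lia.
rewrite (@normal_field_kills (x :: w) k v U B); last 3 first.
- exact: kills_cons.
- by rewrite BE; lia.
- rewrite /wsum /= -/(wsum w) mulSn BE; move: (size w * U)%N (wsum w) (x.2) => a b c.
  by clear; lia.
rewrite (@Y_fock_cons x w k v B); last 2 first.
- move=> m mB; rewrite (_ : k - m - x.2%:Z - 1 = k + `|(- m - x.2%:Z - 1)%R|%N%:Z); last by lia.
  by apply: YN; rewrite BE in mB; lia.
- by move=> m Bm; apply: k3; rewrite BE in Bm; lia.
rewrite big_mkcond /= big_allpairs_dep /=.
rewrite big_seq [RHS]big_seq; apply: eq_bigr => m; rewrite mem_modes => mB.
rewrite -big_mkcond /=.
rewrite (eq_bigl _ _ (fun ms => nf_total_step x w m ms k)).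
have low : m < U%:Z -> - B%:Z <= k - m - x.2%:Z - 1 + 1 - (wsum w)%:Z - (size w * U)%N%:Z.
  by rewrite BE; move: (size w * U)%N (wsum w) (x.2) => a b c; clear; lia.
case: ifP => m0.
  under eq_bigr do rewrite nf_term_create //.
  rewrite -scaler_sumr -raddf_sum -IH (@normal_field_kills w _ v U B) //.
  - by rewrite BE; lia.
  - by apply: low; lia.
rewrite big_seq_cond; under eq_bigr => ms /andP[].
  rewrite mem_box => /andP[/eqP sz _] _; rewrite nf_term_ann //; last by lia.
  over.
rewrite -big_seq_cond -!scaler_sumr; congr (_ *: (_ *: _)); rewrite -IH.
have [Um|mU] := leP U%:Z m.
  rewrite k3 // [RHS](_ : _ = 0); first by apply: big1 => ms _; rewrite /nf_term normal_ordered0 scaler0.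
  by rewrite IH linear0.
rewrite (@normal_field_kills w _ _ U B) //; last 2 first.
- by rewrite BE; lia.
- exact: low.
by have -> : m = `|m|%N by lia.
Qed.

(** The map Y is a state-field correspondence by normal_fieldE, and the only
    one because the vectors fock w span SF. *)
Theorem SFprodE (a : SF) (n : int) b : SFprod a n b = fmode (YV a) n b.
Proof.
have Ysf : state_field (fun a n b => fmode (YV a) n b).
  split=> [k v c x y|w k v]; first by rewrite linearP fmodeD fmodeZ.
  by rewrite normal_fieldE.
rewrite /SFprod; case: xgetP => [Y' _ [Ylin Yfock]|/(_ _ Ysf)//].
elim/SF_fock_ind: a n b => [c x y IHx IHy n b|w n b]; last by rewrite Yfock normal_fieldE.
by rewrite Ylin IHx IHy linearP fmodeD fmodeZ.
Qed.

End NormalOrdering.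

(** * Weak modules over the even part *)

Section WeakModule.
Variables (K : numFieldType) (h : lmodType K) (form : h -> h -> K).
Variables (d : nat) (e f : 'I_d -> h).
Local Notation SF := (SF form).
Local Notation YV := (Y (SFmod form)).
Local Notation V := (SFplus_voa form e f).

Lemma SFpar_word s : SFpar (word s (SFvac form)) = (-1) ^+ odd (size s) *: word s (SFvac form).
Proof.
elim: s => [|x s IH]; first by rewrite scale1r SFpar_vac.
by rewrite SFpar_act IH linearZ /= signrN scaleNr.
Qed.

(** The even part is the image of the projection (1 + SFpar) / 2. *)
Lemma SFevenE (v : SF) : v \in @SFeven K h form <-> SFpar v = v.
Proof.
have two0 : (2%:R : K) != 0 by rewrite pnatr_eq0.
split=> [/SFevenP|vv]; first elim=> {v} [s|c u v _ IHu _ IHv].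
- by move=> /negbTE sE; rewrite SFpar_word sE scale1r.
- by rewrite (linearP (@SFpar K h form)) /= IHu IHv.
suff : v + SFpar v \in @SFeven K h form.
  rewrite vv -mulr2n -scaler_nat => /(rpredZ 2%:R^-1).
  by rewrite scalerA mulVf // scale1r.
elim/SF_fock_ind: (v) => [c x y IHx IHy|w].
  by rewrite linearP addrACA -scalerDr rpredD // rpredZ.
rewrite /fock; set s := map _ w; rewrite SFpar_word.
case E : (odd _); first by rewrite scaleN1r subrr rpred0.
by rewrite scale1r rpredD //; apply/SFevenP/even_word; rewrite E.
Qed.

Lemma SFplus_par (a : SFplus form) : SFpar (val a) = val a.
Proof. exact/SFevenE/(valP a). Qed.

(** Modes of even states preserve the fixed points of the parity. *)
Lemma val_vprod (a b : SFplus form) (n : int) :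
  val (vprod (v := V) a n b) = fmode (YV (val a)) n (val b).
Proof.
rewrite /= insubdK ?SFprodE //; apply/SFevenE.
by have := fpar_Y (val a) n (val b : SFmod form); rewrite /= !SFplus_par.
Qed.

Variable M : ferm_module form.

Lemma bor_even (a b : SF) p q r (u : M) : SF_even a ->
  bor_l a p q r b u = @bor_r K h form M false a p q r b u.
Proof.
elim=> {a} [s /negbTE sE|c a a' _ IH _ IH']; first by rewrite bor_word sE.
have Lf a0 : fin (fun i => state_mode (p + q - i%:Z) u (fmode (YV a0) (r + i%:Z) b)).
  by apply: fin_le (fmode_fin (YV a0) r b) => i ->; rewrite linear0.
have -> : bor_l (c *: a + a') p q r b u = c *: bor_l a p q r b u + bor_l a' p q r b u.
  rewrite /bor_l -isumZ -?isumD; do ?[exact: finZ | apply: (finZ (fun=> c)); exact: finZ].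
  apply: eq_isum => i; rewrite (linearP (Y (SFmod form))) fmodeD fmodeZ.
  by rewrite (linearP (@state_mode K h form M _ u)) scalerDr scaler_swap.
have fins (A B : field M) (g : nat -> K) (F : nat -> int) q' :
    fin (fun i => g i *: fmode A (F i) (fmode B (q' + i%:Z) u)).
  by apply: finZ; exact: bor_r1_fin.
have r1 : bor_r1 (Y M (c *: a + a')) (Y M b) p q r u =
    c *: bor_r1 (Y M a) (Y M b) p q r u + bor_r1 (Y M a') (Y M b) p q r u.
  rewrite /bor_r1 -isumZ -?isumD; do ?[exact: fins | apply: (finZ (fun=> c)); exact: fins].
  apply: eq_isum => i; rewrite (linearP (Y M)) fmodeD fmodeZ.
  by rewrite scalerDr scaler_swap.
have r2 : bor_r2 (Y M (c *: a + a')) (Y M b) p q r u =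
    c *: bor_r2 (Y M a) (Y M b) p q r u + bor_r2 (Y M a') (Y M b) p q r u.
  rewrite /bor_r2 -isumZ -?isumD; do ?[exact: fins | apply: (finZ (fun=> c)); exact: fins].
  apply: eq_isum => i; rewrite (linearP (Y M)) fmodeD fmodeZ.
  by rewrite (linearP (fmode _ _)) scalerDr scaler_swap.
rewrite IH IH' /bor_r r1 r2 scalerBr scalerDr opprD addrACA.
by rewrite (scaler_swap c).
Qed.

Definition plus_mode (a : V) (n : int) (u : M) : M := fmode (Y M (val (a : SFplus form))) n u.

Fact plus_linearl n u (c : K) a b :
  plus_mode (c *: a + b) n u = c *: plus_mode a n u + plus_mode b n u.
Proof.
have E : val (c *: (a : SFplus form) + b) = c *: val (a : SFplus form) + val (b : SFplus form).
  by rewrite !raddfD /=; congr (_ + _).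
by rewrite /plus_mode E (linearP (Y M)) fmodeD fmodeZ.
Qed.

Fact plus_linearr a n (c : K) u v :
  plus_mode a n (c *: u + v) = c *: plus_mode a n u + plus_mode a n v.
Proof. exact: linearP. Qed.

Fact plus_truncation a u : exists N : int, forall n, N <= n -> plus_mode a n u = 0.
Proof.
have [N aN] := fmode_fin (Y M (val (a : SFplus form))) 0 u; exists N => n Nn.
by rewrite /plus_mode (_ : n = 0 + `|n|%N%:Z) ?aN //; lia.
Qed.

Fact plus_vacuum n u : plus_mode (vacuum V) n u = if n == -1 then u else 0.
Proof. by rewrite /plus_mode /= Y_vac. Qed.

Fact plus_borcherds (a b : V) (p q r : int) u :
  \sum_(i \in [set: nat]%classic)
     binz K p i *: plus_mode (vprod a (r + i%:Z) b) (p + q - i%:Z) u =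
  \sum_(i \in [set: nat]%classic)
     ((-1) ^+ i * binz K r i) *:
       (plus_mode a (p + r - i%:Z) (plus_mode b (q + i%:Z) u)
        - (-1) ^ r *: plus_mode b (q + r - i%:Z) (plus_mode a (p + i%:Z) u)).
Proof.
have /SFevenP aE := valP (a : SFplus form).
transitivity (bor_l (val (a : SFplus form)) p q r (val (b : SFplus form)) u).
  by apply: eq_isum => i; rewrite /plus_mode val_vprod.
rewrite bor_even // /bor_r -isumZ; last by apply: finZ; exact: bor_r1_fin.
rewrite -isumB; last 2 first.
- by apply: finZ; exact: bor_r1_fin.
- by apply: (finZ (fun=> _)); apply: finZ; exact: bor_r1_fin.
by apply: eq_isum => i; rewrite scalerBr scaler_swap.
Qed.

Definition weak_of_ferm : weak_module V := WeakModule plus_linearl plus_linearr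
  plus_truncation plus_vacuum plus_borcherds.

End WeakModule.

(** * Weights *)

(** Induction on s: applying L - n removes the term of eigenvalue n. *)
Lemma eigen_independent (K : numFieldType) (V : lmodType K) (L : {linear V -> V})
    (s : seq int) (x : int -> V) : uniq s ->
  (forall i, L (x i) = i%:~R *: x i) -> \sum_(i <- s) x i = 0 ->
  forall i, i \in s -> x i = 0.
Proof.
elim: s x => // n s IH x /= /andP[ns us] Lx; rewrite big_cons => sum0.
pose y i := (i - n)%:~R *: x i.
have y0 i : i \in s -> y i = 0.
  apply: (IH y us) => [j|]; first by rewrite /y linearZ /= Lx scaler_swap.
  have /(congr1 (fun v => L v - n%:~R *: v)) := sum0.
  rewrite linear0 scaler0 subr0 linearD /= Lx scalerDr opprD addrACA subrr add0r.
  rewrite linear_sum scaler_sumr -sumrB => E; rewrite -[RHS]E; apply: eq_bigr => j _.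
  by rewrite /y Lx -scalerBl rmorphB.
have x0 i : i \in s -> x i = 0.
  move=> si; have /eqP := y0 i si; rewrite scaler_eq0 intr_eq0 subr_eq0.
  by case/orP => /eqP // E; rewrite -E si in ns.
move=> i; rewrite inE => /predU1P[->|]; last exact: x0.
by move: sum0; rewrite big_seq big1 ?addr0 // => j; exact: x0.
Qed.

Section Weights.
Variables (K : numFieldType) (h : lmodType K) (form : h -> h -> K).
Local Notation SF := (SF form).
Local Notation act psi m := (lact (gen form psi m)).
Local Notation vac := (SFvac form).
Variables (d : nat) (e f : 'I_d -> h).
Hypothesis form_expand : forall psi,
  psi = \sum_(i < d) (form psi (e i) *: f i - form psi (f i) *: e i).
Local Notation omega := (SFomega form e f).

Definition L0 (M : ferm_module form) : M -> M := fmode (Y M omega) 1.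
HB.instance Definition _ M := GRing.Linear.on (@L0 M).

Lemma act0 m v : act 0 m v = 0 :> SF.
Proof.
by have := act_linl (form := form) (-1) 0 0 m v; rewrite scaler0 addr0 scaleN1r addNr.
Qed.

Lemma act_sum (I : Type) (s : seq I) (c : I -> h) m (v : SF) :
  act (\sum_(i <- s) c i) m v = \sum_(i <- s) act (c i) m v.
Proof.
elim: s => [|i s IH]; first by rewrite !big_nil act0.
by rewrite !big_cons -IH -[c i]scale1r act_linl !scale1r.
Qed.

Lemma actB (a b : K) psi phi m (v : SF) :
  act (a *: psi - b *: phi) m v = a *: act psi m v - b *: act phi m v.
Proof.
rewrite act_linl -scaleNr -[(- b) *: phi]addr0 act_linl act0 addr0.
by rewrite scaleNr.
Qed.

Lemma act_ann_gen psi phi (j : nat) :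
  act psi j%:Z (act phi (-1) vac) = if j == 1%N then form psi phi *: vac else 0.
Proof.
have /(canRL (addrK _)) -> := act_comm (form := form) psi phi j (-1) vac.
rewrite act_vac // linear0 subr0 (_ : (j%:Z + -1 == 0) = (j == 1%N)); last by lia.
by case: eqP => [->|_]; rewrite ?mulr1 ?mul1r // mulr0 scale0r.
Qed.

Lemma act_ann_pair psi phi chi (j : nat) :
  act psi j%:Z (act phi (-1) (act chi (-1) vac)) =
  if j == 1%N then form psi phi *: act chi (-1) vac - form psi chi *: act phi (-1) vac else 0.
Proof.
have /(canRL (addrK _)) -> := act_comm (form := form) psi phi j (-1) (act chi (-1) vac).
rewrite act_ann_gen (_ : (j%:Z + -1 == 0) = (j == 1%N)); last by lia.
case: eqP => [->|_]; first by rewrite linearZ mulr1 mul1r.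
by rewrite linear0 mulr0 scale0r subr0.
Qed.

Lemma omegaE : omega = \sum_(i < d) act (e i) (-1) (act (f i) (-1) vac).
Proof. by []. Qed.

Lemma act_ann_omega psi (j : nat) :
  act psi j%:Z omega = if j == 1%N then act psi (-1) vac else 0.
Proof.
rewrite omegaE linear_sum.
rewrite (eq_bigr _ (fun i _ => act_ann_pair psi (e i) (f i) j)).
case: eqP => _; last by rewrite big1.
by rewrite [in RHS](form_expand psi) act_sum; apply: eq_bigr => i _; rewrite actB.
Qed.

Lemma SFpar_omega : SFpar omega = omega.
Proof. by apply/SFevenE; exact: SFomega_even. Qed.

Section OnModule.
Variable M : ferm_module form.
Implicit Types (u : M).

(** The commutator formula has a single term here, as psi(j) omega is psi(-1)1
    for j = 1 and zero for the other j >= 0. *)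
Lemma L0_act psi m u : L0 (fact psi m u) = fact psi m (L0 u) - m%:~R *: fact psi m u.
Proof.
rewrite /L0 Y_comm fconj_Y SFpar_omega.
rewrite (_ : isum _ = m%:~R *: fact psi m u) ?addrK //.
rewrite -(Y_gen psi m u) -[m in m%:~R]subr0.
rewrite (_ : (fun _ => _) = fun j => if j == 1%N then binz K m j *:
   fmode (Y M (act psi (-1) vac)) (m + 1 - j%:Z) u else 0); last first.
  apply: funext => j; rewrite act_ann_omega; case: eqP => // _.
  by rewrite linear0 fmode0 scaler0.
rewrite (isum_pick (i := 1%N)) // addrK; congr (_ *: _).
by have := binzS K m 0; rewrite mul1r binz0 mulr1.
Qed.

(** The normally ordered product of two generating fields, on an arbitrary
    module. *)
Lemma Y_pair phi chi n u :
  fmode (Y M (act phi (-1) (act chi (-1) vac))) n u =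
  isum (fun i => fact phi (- 1 - i%:Z) (fact chi (n + i%:Z) u)) -
  isum (fun i => fact chi (n - 1 - i%:Z) (fact phi i%:Z u)).
Proof.
have s1 i : sbin K (-1) i = 1.
  by rewrite /sbin binz_neg (_ : i%:Z - -1 - 1 = i) ?binz_nat ?binn //; lia.
rewrite Y_act /nprod fmodeD fmodeN fmodeZ lprodE rprodE exprN1 invrN1 scaleN1r opprK.
congr (_ + _); first by apply: eq_isum => i; rewrite s1 scale1r Y_gen.
rewrite -isumN; last first.
  by apply: fin_le (fact_fin phi u) => i ->; rewrite linear0.
by apply: eq_isum => i; rewrite s1 scale1r fconjE Y_gen act_fpar linearN /= fparK.
Qed.

Lemma L0_sum u : L0 u = \sum_(i < d)
  (isum (fun j => fact (e i) (- 1 - j%:Z) (fact (f i) (1 + j%:Z) u)) -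
   isum (fun j => fact (f i) (1 - 1 - j%:Z) (fact (e i) j%:Z u))).
Proof.
rewrite /L0 -[fmode _ _ _]/(state_mode 1 u omega) omegaE linear_sum /=.
by apply: eq_bigr => i _; rewrite -Y_pair.
Qed.

End OnModule.

Local Notation L0V := (@L0 (SFmod form)).

Lemma L0_vac : L0V vac = 0.
Proof.
rewrite L0_sum big1 // => i _; rewrite !isum_eq0 ?subrr // => j /=.
  by rewrite act_vac // linear0.
by rewrite act_vac ?linear0.
Qed.

(** Homogeneous states, described without L(0); weight_degree identifies them
    with the eigenvectors of L(0). *)
Inductive degree (n : int) : SF -> Prop :=
| degree_word s : - \sum_(x <- s) x.2 = n -> degree n (word s vac)
| degree_lin (c : K) u v : degree n u -> degree n v -> degree n (c *: u + v).

Lemma degree_act psi m n v : degree n v -> degree (n - m) (act psi m v).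
Proof.
elim=> {v} [s <-|c u v _ IHu _ IHv]; last by rewrite linearP; exact: degree_lin.
by apply: (@degree_word _ ((psi, m) :: s)); rewrite big_cons opprD addrC.
Qed.

Lemma degree_par n v : degree n v -> degree n (SFpar v).
Proof.
elim=> {v} [s sn|c u v _ IHu _ IHv].
  have D := degree_word sn.
  rewrite SFpar_word; case: odd; last by rewrite scale1r.
  rewrite expr1 scaleN1r (_ : - _ = (- 1 - 1) *: word s vac + word s vac).
    exact: degree_lin.
  by rewrite scalerBl scaleN1r scale1r addrNK.
by rewrite (linearP (@SFpar _ _ form)) /=; exact: degree_lin.
Qed.

Lemma L0_degree n v : degree n v -> L0V v = n%:~R *: v.
Proof.
elim=> {v} [s <-|c u v _ IHu _ IHv]; last first.
  by rewrite (linearP (@L0 (SFmod form))) /= IHu IHv scalerDr !scalerA mulrC.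
elim: s => [|x s IH]; first by rewrite big_nil oppr0 scale0r L0_vac.
rewrite -[word _ _]/(@fact _ _ _ (SFmod form) x.1 x.2 (word s vac)) L0_act IH linearZ /=.
by rewrite -scalerBl -intrB big_cons opprD [in RHS]addrC.
Qed.

Lemma degree0 n : degree n 0.
Proof.
have : degree n (word [:: (0, - n)] vac).
  by apply: degree_word; rewrite big_cons big_nil addr0 opprK.
by rewrite /= act0.
Qed.

Lemma degreeZ n c v : degree n v -> degree n (c *: v).
Proof. by move=> dv; rewrite -[_ *: _]addr0; apply: degree_lin => //; exact: degree0. Qed.

Lemma degreeD n u v : degree n u -> degree n v -> degree n (u + v).
Proof. by move=> du; rewrite -[u]scale1r; exact: degree_lin. Qed.

Lemma degree_fock w : degree (wsum w)%:Z (fock form w).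
Proof.
apply: degree_word; elim: w => [|x w IH]; first by rewrite big_nil oppr0.
by rewrite /= big_cons opprD IH opprK -PoszD.
Qed.

(** The condition on x 0 holds since a creation word of weight 0 is empty; it
    makes the kernel of L(0) one-dimensional. *)
Definition decomposed (v : SF) := exists N (x : nat -> SF),
  [/\ forall j, degree j%:Z (x j), forall j, (N <= j)%N -> x j = 0,
      exists c : K, x 0%N = c *: vac & v = \sum_(j < N) x j].

Lemma sum_widen (N N' : nat) (x : nat -> SF) : (N <= N')%N ->
  (forall j, (N <= j)%N -> x j = 0) -> \sum_(j < N) x j = \sum_(j < N') x j.
Proof.
move=> NN xN; rewrite -!(isumE (f := x)) // => j Nj; apply: xN.
exact: leq_trans Nj.
Qed.

Lemma SF_decomposed v : decomposed v.
Proof.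
elim/SF_fock_ind: v => [c u v [N [x [xd xN [cx x0] ->]]] [N' [y [yd yN [cy y0] ->]]]|w].
  pose L := maxn N N'.
  exists L, (fun j => c *: x j + y j); split=> [j|j||].
  - exact: degree_lin.
  - rewrite geq_max => /andP[Nj N'j]; rewrite xN // yN // scaler0 addr0 //.
  - by exists (c * cx + cy); rewrite x0 y0 scalerDl scalerA.
  - rewrite (@sum_widen N L x) ?leq_maxl // (@sum_widen N' L y) ?leq_maxr //.
    by rewrite big_split /= scaler_sumr.
exists (wsum w).+1, (fun j => if j == wsum w then fock form w else 0); split=> [j|j||].
- by case: eqP => [->|_]; [exact: degree_fock | exact: degree0].
- by case: eqP => //; lia.
- case: w => [|x w]; first by exists 1; rewrite scale1r.
  by exists 0; rewrite scale0r.
- rewrite big_ord_recr /= eqxx big1 ?add0r // => i _.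
  by case: eqP => // E; have := ltn_ord i; lia.
Qed.

(** The homogeneous components of an eigenvector are eigenvectors for distinct
    eigenvalues, so that only one of them is nonzero. *)
Lemma weight_degree (n : int) v : L0V v = n%:~R *: v ->
  [/\ degree n v, n < 0 -> v = 0 & n = 0 -> exists c : K, v = c *: vac].
Proof.
have [N [x [xd xN [c x0] ->]]] := SF_decomposed v; set w := \sum_(j < N) x j => Lw.
pose y (i : int) := if i is Posz j then (i - n)%:~R *: x j else 0.
have y0 : forall i, i \in [seq j%:Z | j <- iota 0 N] -> y i = 0.
  apply: (eigen_independent (L := [the {linear SF -> SF} of L0V])).
  - by rewrite map_inj_uniq ?iota_uniq // => i j [].
  - case=> j /=; last by rewrite linear0 scaler0.
    have LZ c' v' : L0V (c' *: v') = c' *: L0V v' by exact: linearZ_LR.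
    by rewrite -[LHS]/(L0V ((j%:Z - n)%:~R *: x j)) LZ (L0_degree (xd j)) scaler_swap.
  rewrite big_map -[X in iota 0 X]subn0 -/(index_iota 0 _) big_mkord /=.
  have /eqP := Lw; rewrite -subr_eq0 => /eqP E; rewrite -[RHS]E.
  rewrite /w linear_sum scaler_sumr -sumrB; apply: eq_bigr => j _.
  rewrite rmorphB scalerBl; congr (_ - _); exact/esym/(L0_degree (xd j)).
have xj (j : nat) : j%:Z != n -> x j = 0.
  have [jN|Nj] := ltnP j N; last by rewrite xN.
  move=> jn; have jin : j%:Z \in [seq j%:Z | j <- iota 0 N] by rewrite map_f // mem_iota.
  have /eqP := y0 j jin; rewrite /= scaler_eq0 intr_eq0 subr_eq0 (negbTE jn).
  by move=> /eqP.
have wE (m : nat) : n = m -> w = x m.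
  move=> nm; rewrite -(isum_pick (P := fun j => j == m) x) // /w -isumE //.
  by apply: eq_isum => j; case: eqP => // jm; apply: xj; lia.
case: n {Lw y y0} xj wE => [m|m] xj wE; split=> //.
- by rewrite (wE m).
- by move=> m0; exists c; rewrite (wE m) // -x0; congr x; lia.
- by rewrite /w big1 => [|j _]; [exact: degree0 | exact: xj].
- by rewrite /w big1 // => j _; exact: xj.
Qed.

Section Homogeneous.
Variables (M : ferm_module form) (G : int -> M -> Prop).
Hypothesis Glin : forall n (c : K) u v, G n u -> G n v -> G n (c *: u + v).
Hypothesis G0 : forall n, G n 0.
Hypothesis Gact : forall psi m n u, G n u -> G (n - m) (fact psi m u).
Hypothesis Gpar : forall n u, G n u -> G n (fpar u).

Let GD n u v : G n u -> G n v -> G n (u + v).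
Proof. by move=> gu; rewrite -[u]scale1r; exact: Glin. Qed.

Let GZ n c u : G n u -> G n (c *: u).
Proof. by move=> gu; rewrite -[_ *: _]addr0; exact: Glin. Qed.

Let Gisum n (x : nat -> M) : fin x -> (forall i, G n (x i)) -> G n (isum x).
Proof.
move=> [N xN] Gx; rewrite (isumE xN); elim: (N) => [|N' IH]; first by rewrite big_ord0.
by rewrite big_ord_recr /=; exact: GD.
Qed.

(** A grading of M with respect to the modes psi(m) is a grading with respect to
    all fields. *)
Lemma Y_degree (k m n : int) a u : degree k a -> G m u ->
  G (k + m - n - 1) (fmode (Y M a) n u).
Proof.
move=> dk; elim: dk m n u => {a} [s <-|c a b _ IHa _ IHb] m n u Gu; last first.
  rewrite (linearP (Y M)) fmodeD fmodeZ; apply: Glin; [exact: IHa | exact: IHb].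
elim: s m n u Gu => [|[psi p] s IH] m n u Gu.
  rewrite Y_vac mkfieldE; case: eqP => [->|_]; last exact: G0.
  by rewrite big_nil oppr0 (_ : 0 + m - -1 - 1 = m) //; lia.
rewrite [word _ _]/= Y_act /nprod fmodeD fmodeN fmodeZ lprodE rprodE big_cons /= -scaleNr.
apply: GD; [apply: Gisum; first exact/finZ/lprod_fin | apply/GZ/Gisum; first exact/finZ/rprod_fin].
  move=> i; apply: GZ; have := Gact psi (p - i%:Z) (IH m (n + i%:Z) u Gu).
  by congr G; move: (\sum_(_ <- s) _) => S; lia.
move=> i; apply: GZ; rewrite fconjE; apply: Gpar.
have := IH (m - i%:Z) (n + p - i%:Z) (fpar (fact psi i%:Z u)) (Gpar (Gact psi i%:Z Gu)).
by congr G; move: (\sum_(_ <- s) _) => S; lia.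
Qed.

End Homogeneous.
End Weights.

(** * The vacuum is nonzero *)

Section JordanWigner.
Variable K : numFieldType.
Local Notation P := ((nat -> bool) -> K^o).
Implicit Types (j k : nat) (b c : bool) (F G : P) (S : nat -> bool).

Definition flip j S : nat -> bool := fun k => S k (+) (k == j).

Definition jw_sign j S : K := (-1) ^+ (\sum_(i < j) S i).

(** Jordan-Wigner operators on functions of a set S of natural numbers: jw j
    true adds j to the set, jw j false removes it, with the sign of the number
    of elements below j. Arbitrary sets S are allowed, which spares any
    finiteness condition. *)
Definition jw j b (F : P) : P :=
  fun S => if S j == b then jw_sign j S * F (flip j S) else 0.

Lemma flipK j S : flip j (flip j S) = S.
Proof. by apply: funext => k; rewrite /flip addbK. Qed.

Lemma flipC j k S : flip j (flip k S) = flip k (flip j S).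
Proof. by apply: funext => i; rewrite /flip addbAC. Qed.

Lemma jw_sign_flip_ge j k S : (j <= k)%N -> jw_sign j (flip k S) = jw_sign j S.
Proof.
move=> jk; congr (_ ^+ _); apply: eq_bigr => i _; rewrite /flip.
by have := ltn_ord i; case: eqP => [|_]; rewrite ?addbF //; lia.
Qed.

Lemma jw_sign_flip_lt j k S : (k < j)%N -> jw_sign j (flip k S) = - jw_sign j S.
Proof.
move=> kj; rewrite /jw_sign (bigD1 (Ordinal kj)) //= [in RHS](bigD1 (Ordinal kj)) //= /flip eqxx.
rewrite (eq_bigr (fun i : 'I_j => nat_of_bool (S i))) => [|i]; last first.
  by rewrite -val_eqE /= => /negbTE ->; rewrite addbF.
by case: (S k) => /=; rewrite ?add0n ?add1n ?exprS ?mulN1r ?opprK.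
Qed.

Lemma jw_lin j b (c : K) F G : jw j b (c *: F + G) = c *: jw j b F + jw j b G.
Proof.
apply: funext => S; rewrite /jw.
rewrite -[RHS]/(c * (if S j == b then jw_sign j S * F (flip j S) else 0) +
  (if S j == b then jw_sign j S * G (flip j S) else 0)).
case: ifP => _; last by rewrite mulr0 addr0.
rewrite -[(c *: F + G) _]/(c * F (flip j S) + G (flip j S)).
by rewrite mulrDr mulrCA.
Qed.

Lemma jw_comm j k b c F :
  jw j b (jw k c F) + jw k c (jw j b F) = ((j == k) && (b != c))%:R *: F.
Proof.
apply: funext => S; rewrite -[LHS]/(jw j b (jw k c F) S + jw k c (jw j b F) S).
rewrite -[RHS]/(((j == k) && (b != c))%:R * F S).
wlog jk : j k b c / (j <= k)%N.
  move=> H; have [/H //|/ltnW /H E] := leqP j k.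
  by rewrite addrC E (eq_sym k j) (eq_sym c b).
have flipj : flip j S j = ~~ S j by rewrite /flip eqxx addbT.
case: (ltngtP j k) jk => // [jk|<-] _ /=.
  have fk : flip j S k = S k by rewrite /flip; case: eqP => [|_]; rewrite ?addbF //; lia.
  have fj : flip k S j = S j by rewrite /flip; case: eqP => [|_]; rewrite ?addbF //; lia.
  rewrite /jw fk fj; case: (S j == b); case: (S k == c); rewrite ?mulr0 ?addr0 ?mul0r //.
  rewrite jw_sign_flip_lt // jw_sign_flip_ge ?(ltnW jk) // flipC mulNr mulrN.
  by rewrite mulrCA addNr.
have sq : jw_sign j S * (jw_sign j S * F S) = F S.
  by rewrite mulrA -expr2 sqrr_sign mul1r.
rewrite /jw flipj flipK jw_sign_flip_ge //.
by case: (S j); case: b; case: c; rewrite /= ?sq ?mul1r ?mul0r ?mulr0 ?addr0 ?add0r.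
Qed.

Definition jw_vac : P := fun S => if `[< forall k, S k = false >] then 1 else 0.

Lemma jw_vacP j : jw j false jw_vac = 0.
Proof.
apply: funext => S; rewrite /jw /jw_vac; case: eqP => // Sj.
case: asboolP => [/(_ j)|_]; last by rewrite mulr0.
by rewrite /flip eqxx Sj.
Qed.

Lemma jw_vac_neq0 : jw_vac <> 0.
Proof.
move=> /(congr1 (fun F => F (fun=> false))); rewrite /jw_vac; case: asboolP => [_|[]//].
by move=> /eqP; rewrite -[_ == _]/(1 == 0 :> K) oner_eq0.
Qed.

End JordanWigner.

Section FockRepresentation.
Variables (K : numFieldType) (h : lmodType K) (form : h -> h -> K).
Variables (d : nat) (e f : 'I_d -> h).
Hypothesis form_expand : forall psi,
  psi = \sum_(i < d) (form psi (e i) *: f i - form psi (f i) *: e i).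
Hypothesis form_linl : forall c psi phi chi,
  form (c *: psi + phi) chi = c * form psi chi + form phi chi.
Hypothesis form_skew : forall psi phi, form psi phi = - form phi psi.
Local Notation P := ((nat -> bool) -> K^o).
Implicit Types (psi phi : h) (x y : 'I_d * bool).

(** The canonical basis indexed by one finite type, and the dual coordinates. *)
Definition fvec x : h := if x.2 then f x.1 else e x.1.
Definition fcoord x psi : K := if x.2 then form psi (e x.1) else - form psi (f x.1).

Lemma fcoord_lin x c psi phi : fcoord x (c *: psi + phi) = c * fcoord x psi + fcoord x phi.
Proof. by rewrite /fcoord; case: x.2; rewrite form_linl // opprD mulrN. Qed.

Lemma form_coord psi phi : \sum_x form psi (fvec x) * fcoord x phi = form psi phi.
Proof.
have form0 chi : form 0 chi = 0.
  by have := form_linl (-1) 0 0 chi; rewrite scaler0 addr0 mulN1r addNr.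
have formsum (F : 'I_d -> h) chi : form (\sum_i F i) chi = \sum_i form (F i) chi.
  elim/big_rec2: _ => [|i a b _ <-]; first exact: form0.
  by rewrite -[F i]scale1r form_linl scale1r mul1r.
rewrite [RHS]form_skew {2}(form_expand phi) formsum -sumrN.
rewrite -(pair_bigA _ (fun i s => form psi (fvec (i, s)) * fcoord (i, s) phi)) /=.
apply: eq_bigr => i _; rewrite big_bool /= /fvec /fcoord /=.
rewrite form_linl -scaleNr -[- _ *: e i]addr0 form_linl form0 addr0.
by rewrite (form_skew (f i)) (form_skew (e i)); ring.
Qed.

Definition fcoef (m : int) x psi : K :=
  if m < 0 then fcoord x psi else m%:~R * form psi (fvec x).

Definition fidx (m : int) x : nat := pickle (x, `|m|%N).

(** Creation modes become creation operators, and psi(m) with m > 0 becomes m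
    times the contraction with psi. The zero modes act by zero. *)
Definition fock_rep psi (m : int) (F : P) : P :=
  \sum_x fcoef m x psi *: jw (fidx m x) (m < 0) F.

Lemma fock_rep_lin psi m (c : K) F G :
  fock_rep psi m (c *: F + G) = c *: fock_rep psi m F + fock_rep psi m G.
Proof.
rewrite /fock_rep scaler_sumr -big_split; apply: eq_bigr => x _ /=.
by rewrite jw_lin scalerDr scaler_swap.
Qed.

Lemma fock_rep_linl (c : K) psi phi m F :
  fock_rep (c *: psi + phi) m F = c *: fock_rep psi m F + fock_rep phi m F.
Proof.
rewrite /fock_rep scaler_sumr -big_split; apply: eq_bigr => x _ /=.
rewrite scalerA -scalerDl; congr (_ *: _).
rewrite /fcoef; case: ifP => _; first exact: fcoord_lin.
by rewrite form_linl mulrDr mulrCA.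
Qed.

Lemma fock_rep_comm psi phi m n F :
  fock_rep psi m (fock_rep phi n F) + fock_rep phi n (fock_rep psi m F) =
  (m%:~R * form psi phi * (m + n == 0)%:R) *: F.
Proof.
have jw_sum j b (c : 'I_d * bool -> K) (G : 'I_d * bool -> P) :
    jw j b (\sum_y c y *: G y) = \sum_y c y *: jw j b (G y).
  elim/big_rec2: _ => [|y u v _ <-]; last by rewrite jw_lin.
  by apply: funext => S; rewrite /jw mulr0 if_same.
have E chi chi' (p q : int) : fock_rep chi p (fock_rep chi' q F) =
    \sum_x \sum_y (fcoef p x chi * fcoef q y chi') *:
       jw (fidx p x) (p < 0) (jw (fidx q y) (q < 0) F).
  rewrite /fock_rep; apply: eq_bigr => x _; rewrite jw_sum scaler_sumr.
  by apply: eq_bigr => y _; rewrite scalerA.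
rewrite !E [X in _ + X]exchange_big -big_split /=.
transitivity (\sum_x ((fcoef m x psi * fcoef n x phi) *
    ((`|m|%N == `|n|%N) && ((m < 0) != (n < 0)))%:R) *: F).
  apply: eq_bigr => x _; rewrite -big_split /= (bigD1 x) //= big1 ?addr0 => [|y yx].
    rewrite [fcoef n x phi * _]mulrC -scalerDr jw_comm scalerA; congr ((_ * _%:R) *: _).
    congr (nat_of_bool (_ && _)); apply/eqP/eqP => [|mn]; last by rewrite /fidx mn.
    by move=> /(pcan_inj pickleK) [].
  rewrite [fcoef n y phi * _]mulrC -scalerDr jw_comm.
  case: eqP => [|_]; last by rewrite scale0r scaler0.
  by move=> /(pcan_inj pickleK) [xy _]; rewrite xy eqxx in yx.
rewrite -scaler_suml -mulr_suml; congr (_ *: _).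
have [mn|mn] := eqVneq (m + n) 0; last first.
  rewrite mulr0 (_ : (_ && _) = false) ?mulr0 //; lia.
have [m0|m0] := eqVneq m 0.
  rewrite (_ : (_ && _) = false); last by lia.
  by rewrite m0 !mulr0 !mul0r.
rewrite (_ : (_ && _) = true) ?mulr1; last by lia.
have [mneg|mpos] := ltP m 0.
  rewrite (form_skew psi) -form_coord -sumrN mulr_sumr; apply: eq_bigr => x _.
  rewrite /fcoef mneg ltNge (_ : 0 <= n) /=; last by lia.
  by rewrite (_ : n = - m) ?mulrNz; [ring | lia].
rewrite -form_coord mulr_sumr; apply: eq_bigr => x _.
rewrite /fcoef ltNge mpos /= (_ : n < 0); last by lia.
by rewrite mulrA.
Qed.

Lemma fock_rep_vac psi m : 0 <= m -> fock_rep psi m (jw_vac K) = 0.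
Proof.
by move=> m0; rewrite /fock_rep ltNge m0 big1 // => x _; rewrite jw_vacP scaler0.
Qed.

(** A nonzero image in a module shows that the vacuum is nonzero. *)
Theorem SFvac_neq0 : SFvac form <> 0.
Proof.
pose L := SF_lift (form := form) fock_rep (jw_vac K).
have Lvac : L (SFvac form) = jw_vac K.
  exact: (SF_lift_vac fock_rep_lin fock_rep_linl fock_rep_comm fock_rep_vac).
have L0 : L 0 = 0.
  have := SF_lift_lin fock_rep_lin fock_rep_linl fock_rep_comm fock_rep_vac (-1) 0 0.
  by rewrite -/L scaler0 addr0 scaleN1r addNr.
by move=> v0; apply: (@jw_vac_neq0 K); rewrite -Lvac v0.
Qed.

End FockRepresentation.

(** * A self-extension that does not split *)

Section Extension.
Variables (K : numFieldType) (h : lmodType K) (form : h -> h -> K).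
Local Notation SF := (SF form).
Local Notation act psi m := (lact (gen form psi m)).
Local Notation vac := (SFvac form).
Variable lam : h -> K.
Hypothesis lam_lin : forall c psi phi, lam (c *: psi + phi) = c * lam psi + lam phi.

Definition ext_act psi m (u : SF * SF) : SF * SF :=
  (act psi m u.1 + (if m == 0 then lam psi else 0) *: SFpar u.2, act psi m u.2).

Definition ext_par (u : SF * SF) : SF * SF := (SFpar u.1, - SFpar u.2).

Fact ext_act_lin psi m : linear (ext_act psi m).
Proof.
move=> c u v; rewrite /ext_act; congr (_, _); last exact: lact_lin.
rewrite /= lact_lin (linearP (@SFpar _ _ form)) /= scalerDr scaler_swap.
by rewrite addrACA -scalerDr.
Qed.
HB.instance Definition _ psi m :=
  GRing.isLinear.Build K (SF * SF)%type (SF * SF)%type *:%R (ext_act psi m) (ext_act_lin psi m).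

Fact ext_par_lin : linear ext_par.
Proof.
move=> c u v; rewrite /ext_par /= !(linearP (@SFpar _ _ form)) /=.
by congr (_, _); rewrite opprD -scalerN.
Qed.
HB.instance Definition _ :=
  GRing.isLinear.Build K (SF * SF)%type (SF * SF)%type *:%R ext_par ext_par_lin.

Fact ext_linl c psi phi m u : ext_act (c *: psi + phi) m u = c *: ext_act psi m u + ext_act phi m u.
Proof.
rewrite /ext_act; congr (_, _); last exact: act_linl.
rewrite /= act_linl lam_lin; case: eqP => _; last by rewrite !scale0r !addr0.
by rewrite scalerDl -scalerA addrACA -scalerDr.
Qed.

Fact ext_comm psi phi m n u : ext_act psi m (ext_act phi n u) + ext_act phi n (ext_act psi m u) =
  (m%:~R * form psi phi * (m + n == 0)%:R) *: u.
Proof.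
rewrite /ext_act; case: u => u v; congr (_, _) => /=; last exact: act_comm.
rewrite !lactDr !lact_cstC !SFpar_act !scalerN -act_comm.
move: (_ *: act psi m (SFpar v)) (_ *: act phi n (SFpar v)) => x y.
by rewrite !addrA [LHS](ACl (1 * 4 * (2 * 6) * (3 * 5))%AC) /= subrr addNr !addr0.
Qed.

Fact ext_fin psi u : fin (fun i => ext_act psi i%:Z u).
Proof.
have [N uN] := SFact_fin psi u.1; have [N' uN'] := SFact_fin psi u.2.
exists (maxn 1 (maxn N N')) => i; rewrite !geq_max => /and3P[i1 Ni N'i].
by rewrite /ext_act uN // uN' // ifF ?scale0r ?addr0 //; lia.
Qed.

Fact ext_parK : involutive ext_par.
Proof. by case=> u v; rewrite /ext_par /= linearN /= opprK !SFparK. Qed.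

Fact ext_par_act psi m u : ext_par (ext_act psi m u) = - ext_act psi m (ext_par u).
Proof.
case: u => u v; rewrite /ext_par /ext_act; congr (_, _) => /=.
  rewrite linearD linearZ /= SFpar_act SFparK linearN /= SFparK scalerN.
  by rewrite opprD opprK.
by rewrite SFpar_act (linearN (lact (gen form psi m))) /=.
Qed.

(** The extension of SF by itself in which psi(0) maps the second copy to the
    first by the scalar lam(psi). Since psi(0) anticommutes with the other modes
    on SF + SF, the map has to involve the parity, and the second copy is
    shifted in parity. *)
Definition ext_mod : ferm_module form :=
  @FermModule K h form (SF * SF)%type
   (fun psi m => [the {linear (SF * SF)%type -> (SF * SF)%type} of ext_act psi m])
   [the {linear (SF * SF)%type -> (SF * SF)%type} of ext_par]
   ext_linl ext_comm ext_fin ext_parK ext_par_act.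

Definition ext_proj (u : ext_mod) : SFmod form := u.2.
Fact ext_proj_lin : linear ext_proj. Proof. by []. Qed.
HB.instance Definition _ := GRing.isLinear.Build K ext_mod (SFmod form) *:%R ext_proj ext_proj_lin.

Definition ext_inj (u : SFmod form) : ext_mod := (u, 0).
Fact ext_inj_lin : linear ext_inj.
Proof. by move=> c u v; congr (_, _); rewrite /= scaler0 addr0. Qed.
HB.instance Definition _ := GRing.isLinear.Build K (SFmod form) ext_mod *:%R ext_inj ext_inj_lin.

Lemma ext_proj_Y v n (u : ext_mod) :
  (fmode (Y ext_mod v) n u).2 = fmode (Y (SFmod form) v) n u.2.
Proof.
apply: (Y_intertwine (theta := [the {linear ext_mod -> SFmod form} of ext_proj]) (s := -1)).
- by rewrite mulrNN mulr1.
- by [].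
- by move=> w; rewrite scaleN1r.
Qed.

Lemma ext_inj_Y v n (u : SFmod form) :
  fmode (Y ext_mod v) n (u, 0) = (fmode (Y (SFmod form) v) n u, 0).
Proof.
apply/esym.
apply: (Y_intertwine (theta := [the {linear SFmod form -> ext_mod} of ext_inj]) (s := 1)).
- by rewrite mulr1.
- move=> psi m w; congr (_, _); last by rewrite /= linear0.
  by rewrite /= linear0 scaler0 addr0.
- by move=> w; rewrite scale1r; congr (_, _); rewrite /= linear0 oppr0.
Qed.

End Extension.

Section Irrationality.
Variables (K : numFieldType) (h : lmodType K) (form : h -> h -> K).
Variables (d : nat) (e f : 'I_d -> h).
Hypothesis form_expand : forall psi,
  psi = \sum_(i < d) (form psi (e i) *: f i - form psi (f i) *: e i).
Hypothesis form_linl : forall c psi phi chi,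
  form (c *: psi + phi) chi = c * form psi chi + form phi chi.
Hypothesis form_skew : forall psi phi, form psi phi = - form phi psi.
Variable i0 : 'I_d.
Hypothesis form_ef : form (e i0) (f i0) = -1.
Local Notation SF := (SF form).
Local Notation act psi m := (lact (gen form psi m)).
Local Notation vac := (SFvac form).
Local Notation V := (SFplus_voa form e f).
Local Notation omega := (SFomega form e f).

Let lam psi := - form psi (f i0).

Let lam_lin c psi phi : lam (c *: psi + phi) = c * lam psi + lam phi.
Proof. by rewrite /lam form_linl opprD mulrN. Qed.

Let ff0 : form (f i0) (f i0) = 0.
Proof.
have := form_skew (f i0) (f i0) => /eqP; rewrite -subr_eq0 opprK -mulr2n mulrn_eq0 /=.
by move=> /eqP.
Qed.

Let lam_e : lam (e i0) = 1. Proof. by rewrite /lam form_ef opprK. Qed.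
Let lam_f : lam (f i0) = 0. Proof. by rewrite /lam ff0 oppr0. Qed.

Let M := ext_mod form lam_lin.
Let W := weak_of_ferm e f M.

Let vac0 : vac <> 0 := SFvac_neq0 form_expand form_linl form_skew.

(** L(0) does not mix the two copies. It suffices to see that it kills
    (0, 1), by the commutators with the modes; and L(0) contains the zero modes
    only in products of two, each of which vanishes on (0, 1). *)
Lemma ext_L0 (u : M) :
  L0 e f u = (L0 e f (u.1 : SFmod form), L0 e f (u.2 : SFmod form)).
Proof.
have Lvac : L0 e f ((0, vac) : M) = 0.
  rewrite L0_sum big1 // => i _.
  rewrite isum_eq0 => [|j]; last first.
    rewrite (_ : fact (f i) (1 + j%:Z) ((0, vac) : M) = 0) ?linear0 //.
    congr (_, _); last by rewrite /= act_vac.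
    by rewrite /= linear0 add0r scale0r.
  rewrite isum_eq0 ?subrr // => j.
  have -> : fact (e i) j%:Z ((0, vac) : M) = ((if j%:Z == 0 then lam (e i) else 0) *: vac, 0).
    by congr (_, _); rewrite /= ?linear0 ?add0r ?SFpar_vac ?act_vac.
  case: eqP => [->|_].
    by congr (_, _); rewrite /= ?linear0 // linearZ /= act_vac // ?scaler0 ?linear0 ?scaler0 ?addr0.
  by rewrite scale0r; exact: linear0.
have LP (N : ferm_module form) c (x y : N) : L0 e f (c *: x + y) = c *: L0 e f x + L0 e f y.
  exact: linearP.
have L2 (v : SFmod form) : L0 e f ((0, v) : M) = (0, L0 e f v).
  elim/SF_fock_ind: v => [c x y IHx IHy|w].
    have -> : ((0, c *: x + y) : M) = c *: ((0, x) : M) + (0, y).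
      by congr (_, _); rewrite /= ?scaler0 ?addr0.
    by rewrite LP IHx IHy LP; congr (_, _); rewrite /= ?scaler0 ?addr0.
  elim: w => [|x w IH].
    by rewrite -[fock form [::]]/vac Lvac L0_vac.
  have -> : ((0, fock form (x :: w)) : M) = fact x.1 (- x.2.+1%:Z) ((0, fock form w) : M).
    by congr (_, _); rewrite /= linear0 scale0r addr0.
  rewrite (L0_act form_expand) IH fock_cons.
  rewrite -[act _ _ _ in RHS]/(@fact _ _ _ (SFmod form) x.1 (- x.2.+1%:Z) (fock form w)).
  rewrite (L0_act form_expand); congr (_, _).
  by rewrite /= !scale0r !addr0 linear0 ?scaler0 ?subr0.
case: u => u v; have -> : ((u, v) : M) = 1 *: ((u, 0) : M) + (0, v).
  by congr (_, _); rewrite /= ?scale1r ?addr0 ?add0r ?scaler0.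
rewrite LP L2 [L0 e f ((u, 0) : M)]ext_inj_Y scale1r; congr (_, _) => /=.
  by rewrite !addr0 scale1r.
by rewrite scaler0 !add0r.
Qed.

Let G (n : int) : set W :=
  [set u : W | degree n ((u : SF * SF).1) /\ degree n ((u : SF * SF).2)]%classic.

Let G_direct : direct_sum G.
Proof.
split=> [n|[u v]|s x us xG sx i si].
- split=> [|c u v [u1 u2] [v1 v2]]; first by split; exact: degree0.
  by split; exact: degree_lin.
- have [N [x [xd xN _ ->]]] := SF_decomposed u.
  have [N' [y [yd yN _ ->]]] := SF_decomposed v.
  pose L := maxn N N'.
  exists [seq j%:Z | j <- iota 0 L], (fun n => if n is Posz j then (x j, y j) else 0).
  split=> [[j|j]|]; first by split; [exact: xd | exact: yd].
    by split; exact: degree0.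
  rewrite big_map -[X in iota 0 X]subn0 -/(index_iota 0 _) big_mkord.
  rewrite (@sum_widen _ _ _ N L x) ?leq_maxl // (@sum_widen _ _ _ N' L y) ?leq_maxr //.
  elim: L => [|L IH]; first by rewrite !big_ord0.
  by rewrite !big_ord_recr -IH.
- have E (g : {linear W -> SF}) : (forall j u, G j u -> degree j (g u)) -> g (x i) = 0.
    move=> Gg; apply: (eigen_independent (L := [the {linear SF -> SF} of @L0 _ _ _ _ e f (SFmod form)])
      (x := fun j => g (x j)) us) => //.
      by move=> j; apply: L0_degree => //; apply: Gg.
    by rewrite -linear_sum sx linear0.
  pose g1 (u : W) : SF := (u : SF * SF).1; pose g2 (u : W) : SF := (u : SF * SF).2.
  have l1 : linear g1 by [].
  have l2 : linear g2 by [].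
  pose h1 : {linear W -> SF} := HB.pack g1 (GRing.isLinear.Build _ _ _ _ g1 l1).
  pose h2 : {linear W -> SF} := HB.pack g2 (GRing.isLinear.Build _ _ _ _ g2 l2).
  have := E h1 (fun j u => @proj1 _ _); have := E h2 (fun j u => @proj2 _ _).
  rewrite /= /g1 /g2; case: (x i) => a b /= -> ->; by [].
Qed.

Lemma ext_gradable : gradable W.
Proof.
exists G; split=> [|n n0|k a m n u ka Gu]; first exact: G_direct.
- apply/seteqP; split=> [[u v] [/= du dv]|_ ->]; last by split; exact: degree0.
  have [_ /(_ n0) -> _] := weight_degree form_expand (L0_degree form_expand du).
  by have [_ /(_ n0) -> _] := weight_degree form_expand (L0_degree form_expand dv).
have da : degree k%:Z (val (a : SFplus form)).
  have /(congr1 val) := ka; rewrite val_vprod => E.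
  have E' : L0 e f (val (a : SFplus form) : SFmod form) = k%:Z%:~R *: val (a : SFplus form).
    by apply: (etrans E).
  by have [] := weight_degree form_expand E'.
apply: (Y_degree (M := M) (G := fun n u => G n u) _ _ _ _ n da Gu).
- by move=> n' c u' v' [u1 u2] [v1 v2]; split; exact: degree_lin.
- by move=> n'; split; exact: degree0.
- move=> psi m' n' u' [u1 u2]; split; last exact: degree_act.
  apply: degreeD; first exact: degree_act.
  case: eqP => [->|_]; last by rewrite scale0r; exact: degree0.
  by rewrite subr0; apply/degreeZ/degree_par.
- move=> n' u' [u1 u2]; split; first exact: degree_par.
  by rewrite /= -scaleN1r; apply/degreeZ/degree_par.
Qed.

Let L0_ker (v : SFmod form) : L0 e f v = 0 -> exists c : K, v = c *: vac.
Proof.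
move=> Lv; have [_ _] := weight_degree (n := 0) form_expand (etrans Lv (esym (scale0r v))).
exact.
Qed.

Let Omega : V := conformal V.

Let Ef : V := SFPlus (introT (SFevenP _) (@even_word _ _ form [:: (e i0, -1); (f i0, -1)] isT)).

(** Of the modes of e and f in the zeroth mode of e(-1)f(-1)1, only f(-1)e(0)
    acts nontrivially on the vacua. *)
Let Ef_mode (a b : K) : fmode (Y M (val (Ef : SFplus form))) 0 ((a *: vac, b *: vac) : M) =
  (- b *: act (f i0) (-1) vac, 0).
Proof.
rewrite -[val _]/(act (e i0) (-1) (act (f i0) (-1) vac)) Y_pair.
rewrite isum_eq0 => [|i]; last first.
  have -> : fact (f i0) (0 + i%:Z) ((a *: vac, b *: vac) : M) = 0.
    congr (_, _); rewrite /= linearZ /= act_vac // scaler0 //.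
    by case: ifP; rewrite ?lam_f scale0r addr0.
  exact: linear0.
have -> : isum (fun i => fact (f i0) (0 - 1 - i%:Z) (fact (e i0) i%:Z ((a *: vac, b *: vac) : M))) =
    isum (fun i => if i == 0%N then (b *: act (f i0) (-1) vac, 0) : M else 0).
  apply: eq_isum => i.
  have -> : fact (e i0) i%:Z ((a *: vac, b *: vac) : M) = ((if i == 0%N then b else 0) *: vac, 0).
    congr (_, _); rewrite /= !linearZ /= act_vac // scaler0 // add0r SFpar_vac.
    by case: i => [|i] /=; rewrite ?lam_e ?scale1r // !scale0r scaler0.
  case: i => [|i] /=; last by rewrite scale0r; exact: linear0.
  by congr (_, _); rewrite /= ?lact_cstC !linear0 ?addr0.
rewrite (isum_pick (i := 0%N)) // sub0r.
by congr (_, _); rewrite ?scaleNr ?oppr0.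
Qed.

Let f1_neq0 : act (f i0) (-1) vac <> 0.
Proof.
move=> f1; apply: vac0; have := act_ann_gen form (e i0) (f i0) 1.
rewrite f1 linear0 /= form_ef scaleN1r => /esym/eqP.
by rewrite oppr_eq0 => /eqP.
Qed.

(** A component of (0, 1) in a decomposition generates a submodule that contains
    a nonzero vector of the first copy and is not contained in it. *)
Theorem ext_not_completely_reducible : ~ completely_reducible W.
Proof.
move=> [I [N [Nirr [Nsub Nspan Nind]]]].
have [s [x [xN u0E]]] := Nspan ((0, vac) : W).
(* The index list may have repetitions; they are merged into multiplicities. *)
pose y i : W := x i *+ count_mem i s.
have yN i : N i (y i).
  have [[N0 Nl] _] : submodule (N i) by have [] := Nirr i.
  rewrite /y; elim: (count_mem i s) => [|n IH]; first by rewrite mulr0n.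
  by have := Nl 1 _ _ (xN i) IH; rewrite scale1r mulrS.
have {}u0E : ((0, vac) : W) = \sum_(i <- undup s) y i.
  rewrite u0E -(big_undup_iterop_count _ s xpredT x); apply: eq_bigr => i _.
  by rewrite /y /GRing.natmul.
have L0u : L0 e f ((0, vac) : M) = 0.
  by rewrite ext_L0 /= linear0 (@L0_vac _ _ form _ e f).
(* L(0) is the mode of an element of SF^+, so it preserves every summand; since
   it kills (0, 1), it kills the components as well. *)
have y0 i : i \in undup s -> L0 e f (y i : M) = 0.
  apply: (Nind (undup s) (fun i => L0 e f (y i : M) : W)) => [|j|]; first exact: undup_uniq.
    have [[_ Nm] _ _] := Nirr j; exact: (Nm Omega 1 (y j) (yN j)).
  rewrite -[RHS]L0u u0E; apply/esym.
  exact: (linear_sum [the {linear M -> M} of @L0 _ _ _ _ e f M]).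
have [i is0 yi] : exists2 i, i \in undup s & ((y i : SF * SF).2 <> 0).
  apply: contrapT => H; apply: vac0; have := congr1 (fun u : W => (u : SF * SF).2) u0E.
  move=> /= ->.
  rewrite big_seq; apply: (big_ind (fun u : W => (u : SF * SF).2 = 0)) => //.
    by move=> [u1 u2] [v1 v2] /= -> ->; rewrite addr0.
  by move=> i iS; apply: contrapT => yi; apply: H; exists i.
have [a [b [yE b0]]] : exists a b : K, (y i : SF * SF) = (a *: vac, b *: vac) /\ b != 0.
  have := y0 i is0; rewrite ext_L0; move: yi; case: (y i : SF * SF) => u v /= v0 [uk vk].
  have [a ->] := L0_ker uk; have [b E] := L0_ker vk.
  exists a, b; rewrite E; split=> //; apply: contra_notN v0 => /eqP b0.
  by rewrite E b0 scale0r.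
(* The part of the summand inside the first copy, which irreducibility would
   force to be zero or everything. *)
pose N' : set W := [set u | N i u /\ (u : SF * SF).2 = 0]%classic.
have [[[N0 Nl] Nm] _ Nmin] := Nirr i.
have N'sub : submodule N'.
  split; first split=> [|c u v [Nu u0] [Nv v0]].
  - by split.
  - by split; [exact: Nl | rewrite /= u0 v0 scaler0 addr0].
  - move=> a' n u [Nu u0]; split; first exact: Nm.
    by rewrite [LHS]ext_proj_Y u0 linear0.
case: (Nmin N' N'sub) => [u [] //|N'0|N'N].
- have N'E : N' ((- b *: act (f i0) (-1) vac, 0) : M).
    split=> //; rewrite -(Ef_mode a b) -yE; exact: (Nm Ef 0 (y i) (yN i)).
  move: N'E; rewrite N'0 => -[] /eqP; rewrite scaler_eq0 oppr_eq0 (negbTE b0) => /eqP.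
  exact: f1_neq0.
- have : N' (y i) by rewrite N'N; exact: yN.
  by case=> _; exact: yi.
Qed.

Theorem SFplus_not_rational : ~ rational V.
Proof. by move=> rat; exact/ext_not_completely_reducible/rat/ext_gradable. Qed.

End Irrationality.

(** * Irrationality *)

Theorem proposition5p3 (R : realType) (d : nat) (hd : (1 <= d)%N)
    (h : vectType R[i]) (hdim : \dim {: h} = (2 * d)%N)
    (form : {skew_symmetric h}) (hform : nondegenerate form)
    (e f : 'I_d -> h) (hef : canonical_basis form e f) :
  ~ rational (SFplus_voa form e f).
Proof.
have [basis ee ff ef] := hef.
have linl c psi phi chi : form (c *: psi + phi) chi = c * form psi chi + form phi chi.
  exact: linearPl.
have skew psi phi : form psi phi = - form phi psi.
  by rewrite hermC expr1 mulN1r.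
(* Both sides are linear in psi and agree on the canonical basis. *)
have expand psi : psi = \sum_(i < d) (form psi (e i) *: f i - form psi (f i) *: e i).
  pose D psi := \sum_(i < d) (form psi (e i) *: f i - form psi (f i) *: e i).
  have Dlin : linear D.
    move=> c u v; rewrite /D scaler_sumr -big_split; apply: eq_bigr => i _ /=.
    by rewrite !linl !scalerDl -!scalerA scalerBr opprD addrACA.
  pose L : {linear h -> h} := HB.pack D (GRing.isLinear.Build _ _ _ _ D Dlin).
  have DX x : x \in codom e ++ codom f -> L x = x.
    rewrite mem_cat => /orP[/codomP[j ->]|/codomP[j ->]]; rewrite /L /= /D.
      rewrite (bigD1 j) //= big1 => [|i ij].
        by rewrite ee (ef j j).1 eqxx scale0r sub0r scaleN1r opprK addr0.
      by rewrite ee (ef j i).1 eq_sym (negbTE ij) oppr0 !scale0r subr0.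
    rewrite (bigD1 j) //= big1 => [|i ij].
      by rewrite ff (ef j j).2 eqxx scale0r subr0 scale1r addr0.
    by rewrite ff (ef i j).2 (negbTE ij) !scale0r subr0.
  have /coord_span -> : psi \in <<in_tuple (codom e ++ codom f)>>%VS.
    by rewrite (span_basis basis) memvf.
  rewrite -[RHS]/(L _) linear_sum; apply: eq_bigr => i _.
  by rewrite linearZ /= -[D _]/(L _) DX ?mem_nth.
exact: (@SFplus_not_rational _ _ _ _ e f expand linl skew (Ordinal hd) (etrans (ef _ _).1 _)).
Qed.
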